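(* For every infinite dimensional block subspace $Y$ of $\mathscr B_{mT}$ there exist a block sequence $(y_i)_{i\in\mathbb N}$ in $Y$ and sequences of natural numbers $(j_i)_{i\in\mathbb N}$ and $((k_{i,j})_{j=1}^{n_{j_i}})_{i\in\mathbb N}$ such that the sequences $(y_i)_{i\in\mathbb N}\subset\mathscr B_{mT}$ and $\Big(\frac{m_{j_i}}{n_{j_i}}\sum_{j=1}^{n_{j_i}} e_{k_{i,j}}\Big)_{i\in\mathbb N}\subset T$ are equivalent (i.e. there is a constant $K\ge1$ with $K^{-1}\|\sum_i a_i z_i\|_T\le \|\sum_i a_i y_i\|\le K\|\sum_i a_iz_i\|_T$ for all finitely supported scalar sequences $(a_i)$, where $z_i$ denotes the $i$-th vector of the second sequence).
   Context: Fix sequences $(m_j)_{j\in\mathbb N}$, $(n_j)_{j\in\mathbb N}$ of natural numbers with $m_1=n_1=4$, $m_{j+1}\ge m_j^2$ and $n_{j+1}\ge m_{j+1}^2(4n_j)^{\log_2 m_{j+1}}$ for all $j$. The mixed Tsirelson space $T=T[(m_j)_j,(n_j)_j]$: let $W\subset c_{00}$ be the smallest set containing $\pm e^*_i$ for all $i\in\mathbb N$ and such that whenever $j\in\mathbb N$, $d\le n_j$ and $f_1<\dots<f_d$ are in $W$ (successive supports), then $m_j^{-1}\sum_{i=1}^d f_i\in W$. $T$ is the completion of $c_{00}$ under $\|x\|=\sup\{f(x): f\in W\}$; $(e_n)$ denotes its standard unit vector basis. The space $\mathscr B_{mT}$: define finite disjoint sets $\Delta_q$ inductively. $\Delta_1=\{1\}$.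 Given $\Delta_1,\dots,\Delta_q$, put $\Gamma_0=\emptyset$, $\Gamma_p=\bigcup_{r\le p}\Delta_r$, and let $\Delta_{q+1}$ consist of all tuples $(q+1,0,m_j,\varepsilon e^*_\eta)$ with $j\le q+1$, $\varepsilon=\pm1$, $\eta\in\Gamma_q$, together with all tuples $(q+1,\xi,m_j,\varepsilon e^*_\eta)$ with $1\le p<q$, $j\le p$, $\xi\in\Delta_p$ with $w(\xi)=m_j^{-1}$ and $\mathrm{age}(\xi)<n_j$, $\varepsilon=\pm1$, $\eta\in\Gamma_q\setminus\Gamma_p$. Here the weight of $(q+1,\cdot,m_j,\cdot)$ is $w=m_j^{-1}$, the rank is $q+1$, the age of $(q+1,0,m_j,\varepsilon e^*_\eta)$ is $1$ and the age of $(q+1,\xi,m_j,\varepsilon e^*_\eta)$ is $\mathrm{age}(\xi)+1$. Let $\Gamma=\bigcup_q\Delta_q$. In $\ell_1(\Gamma)$ with unit vectors $e^*_\gamma$ define inductively on rank $d^*_\gamma=e^*_\gamma-c^*_\gamma$, where $c^*_\gamma=m_j^{-1}\varepsilon P^*_{(0,q]}e^*_\eta$ for $\gamma=(q+1,0,m_j,\varepsilon e^*_\eta)$ and $c^*_\gamma=e^*_\xi+m_j^{-1}\varepsilon P^*_{(p,q]}e^*_\eta$ for $\gamma=(q+1,\xi,m_j,\varepsilon e^*_\eta)$ with $\xi\in\Delta_p$; here $P^*_{(p,q]}$ is the projection of $\ell_1(\Gamma_q)$ onto $\mathrm{span}\{d^*_\delta:\mathrm{rank}(\delta)\in(p,q]\}$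 associated with the basis $(d^*_\delta)_{\delta\in\Gamma_q}$ of $\ell_1(\Gamma_q)$. Then $(d^*_\gamma)_{\gamma\in\Gamma}$ is a basis of $\ell_1(\Gamma)$; let $(d_\gamma)\subset\ell_\infty(\Gamma)$ be its biorthogonal sequence and $\mathscr B_{mT}=\overline{\mathrm{span}}\{d_\gamma:\gamma\in\Gamma\}\subset\ell_\infty(\Gamma)$. For finitely supported $x$, $\mathrm{rng}\,x$ is the smallest interval $[p,q]$ with $x\in\mathrm{span}\{d_\gamma:\mathrm{rank}(\gamma)\in[p,q]\}$; a block sequence is a sequence of nonzero finitely supported vectors with $\max\mathrm{rng}\,x_k<\min\mathrm{rng}\,x_{k+1}$, and a block subspace is the closed span of a block sequence. *)

(* Defs.v *)
From Stdlib Require Import Reals Lra Lia List Arith Bool.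
From Coquelicot Require Import Coquelicot.
Import ListNotations.
Open Scope R_scope.

Fixpoint rsum (N : nat) (f : nat -> R) : R :=
  match N with O => 0 | S N' => rsum N' f + f N' end.

Definition sgn (s : bool) : R := if s then 1 else -1.

Definition succ_supp (f g : nat -> R) : Prop :=
  forall a b, f a <> 0 -> g b <> 0 -> (a < b)%nat.

Inductive inW (m n : nat -> nat) : (nat -> R) -> Prop :=
| W_unit (i : nat) (s : bool) :
    inW m n (fun k => if Nat.eqb k i then sgn s else 0)
| W_avg (j : nat) (fs : list (nat -> R)) :
    (1 <= j)%nat -> (1 <= length fs)%nat -> (length fs <= n j)%nat ->
    (forall f, In f fs -> inW m n f) ->
    List.ForallOrdPairs succ_supp fs ->
    inW m n (fun k => / INR (m j) * fold_right (fun f acc => f k + acc) 0 fs).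

Definition Tnorm (m n : nat -> nat) (x : nat -> R) : Rbar :=
  Lub_Rbar (fun r => exists (f : nat -> R) (N : nat),
    inW m n f /\ (forall k, (N <= k)%nat -> x k = 0) /\
    r = rsum N (fun k => f k * x k)).

(* The index set Gamma of B_mT.
   G1 is the element 1 of Delta_1;
   Gf r j s eta  is the tuple (r, 0,  m_j, sgn s e*_eta)   (r = q+1);
   Gn r xi j s eta is the tuple (r, xi, m_j, sgn s e*_eta).
   We store the index j rather than m_j (m is strictly increasing). *)
Inductive gam : Type :=
| G1 : gam
| Gf : nat -> nat -> bool -> gam -> gam
| Gn : nat -> gam -> nat -> bool -> gam -> gam.

Definition gam_eq_dec : forall x y : gam, {x = y} + {x <> y}.
Proof. decide equality; try apply Bool.bool_dec; try apply Nat.eq_dec. Defined.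

Definition rank (g : gam) : nat :=
  match g with G1 => 1%nat | Gf r _ _ _ => r | Gn r _ _ _ _ => r end.

Fixpoint age (g : gam) : nat :=
  match g with G1 => 0%nat | Gf _ _ _ _ => 1%nat | Gn _ xi _ _ _ => S (age xi) end.

(* weight index: w(g) = 1/m_(widx g); G1 has no weight (widx = 0, never a valid j) *)
Definition widx (g : gam) : nat :=
  match g with G1 => 0%nat | Gf _ j _ _ => j | Gn _ _ j _ _ => j end.

(* g belongs to Gamma (and then g is in Delta_(rank g)) *)
Fixpoint valid (n : nat -> nat) (g : gam) : Prop :=
  match g with
  | G1 => True
  | Gf r j s eta =>
      (2 <= r)%nat /\ (1 <= j <= r)%nat /\ valid n eta /\ (rank eta <= r - 1)%nat
  | Gn r xi j s eta =>
      valid n xi /\ valid n eta /\ (1 <= j)%nat /\ widx xi = j /\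
      (1 <= rank xi)%nat /\ (rank xi < r - 1)%nat /\ (j <= rank xi)%nat /\
      (age xi < n j)%nat /\ (rank xi < rank eta)%nat /\ (rank eta <= r - 1)%nat
  end.

(* ecoef m g d = coefficient of d*_d in the expansion of e*_g in the basis
   (d*_delta); obtained from e*_g = d*_g + c*_g, P*_(p,q] keeping the
   components of rank in (p,q]. *)
Fixpoint ecoef (m : nat -> nat) (g : gam) : gam -> R :=
  fun d =>
  (if gam_eq_dec d g then 1 else 0) +
  match g with
  | G1 => 0
  | Gf r j s eta =>
      sgn s / INR (m j) *
      (if andb (Nat.ltb 0 (rank d)) (Nat.leb (rank d) (r - 1))
       then ecoef m eta d else 0)
  | Gn r xi j s eta =>
      ecoef m xi d +
      sgn s / INR (m j) *
      (if andb (Nat.ltb (rank xi) (rank d)) (Nat.leb (rank d) (r - 1))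
       then ecoef m eta d else 0)
  end.

Definition Gamma (n : nat -> nat) : Type := { g : gam | valid n g }.

Definition vec (n : nat -> nat) : Type := Gamma n -> R.

(* d_gamma, biorthogonal to (d*_gamma): d_gamma(delta) = <e*_delta, d_gamma> *)
Definition dvec (m n : nat -> nat) (g : Gamma n) : vec n :=
  fun d => ecoef m (proj1_sig d) (proj1_sig g).

Definition lincomb (m n : nat -> nat) (l : list (Gamma n * R)) : vec n :=
  fun d => fold_right (fun pr acc => snd pr * dvec m n (fst pr) d + acc) 0 l.

Definition Bnorm (n : nat -> nat) (v : vec n) : Rbar :=
  Lub_Rbar (fun r => exists d : Gamma n, r = Rabs (v d)).

Definition supported_in (m n : nat -> nat) (x : vec n) (p q : nat) : Prop :=
  exists l : list (Gamma n * R),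
    List.Forall (fun pr => (p <= rank (proj1_sig (fst pr)) <= q)%nat) l /\
    forall d, x d = lincomb m n l d.

Definition is_block (m n : nat -> nat) (x : nat -> vec n) : Prop :=
  exists p q : nat -> nat, forall k,
    (p k <= q k)%nat /\ (q k < p (S k))%nat /\
    supported_in m n (x k) (p k) (q k) /\ (exists d, x k d <> 0).

Definition in_closed_span (n : nat -> nat) (x : nat -> vec n) (y : vec n) : Prop :=
  forall eps, 0 < eps -> exists (N : nat) (b : nat -> R),
    forall d, Rabs (y d - rsum N (fun k => b k * x k d)) <= eps.

Definition zvec (m n : nat -> nat) (J : nat -> nat) (k : nat -> nat -> nat)
  (i : nat) : nat -> R :=
  fun t => INR (m (J i)) / INR (n (J i)) *
           rsum (n (J i)) (fun j => if Nat.eqb (k i (S j)) t then 1 else 0).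

(* Main.v *)
(* Every block subspace contains rapidly increasing sequences [u] (multiples of
   l1-averages); the [x_k] are weight-[m_p] averages of such sequences with [p = p_k] increasing, and
   [y_i = m_J / n_J sum x_k] over the [i]-th block of [n_J] successive indices, [J = J_i < p_k].

   Lower estimate: a functional of [W] is copied into an element of Gamma as soon as the block sequence is
   sparse; a node of weight [m_j] is available only beyond rank [j], but the coordinates lost by that
   restriction carry coefficients [<= 1 / m_j] and add up to at most one third of the norm.

   Upper estimate: [e*_g] is followed down its tree. On [x_k] only the first node of weight [m_(p_k)] counts,
   so [e*_g] acts on [x_k] essentially as the product of the weights above that node. On the block [i],
   only the paths with exactly one weight [>= m_(J_i)] above that node, equal to [m_(J_i)], matter; the others
   contribute [O(1 / m_(J_i))] times the coefficient of [y_i]. The remaining part of the tree is, up to one child per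
   block, an element of [W]: no splitting of children is needed, so that the number of children of a node of
   weight [m_j] stays at most [n_j]. The double averaging is what makes the last point work. *)
Require Import Defs.
From Stdlib Require Import Classical ClassicalEpsilon FunctionalExtensionality.
From Coquelicot Require Import Coquelicot.
From Stdlib Require Import Reals Lra Lia List Arith Bool.
Import ListNotations.
Open Scope R_scope.

(** * Finite sums *)

(** A node acts on a block vector through a single child only if its links do not cut the range of
    the vector, and each link may cut two vectors. Counting cut vectors as additional children would
    give nodes of weight [m_j] with more than [n_j] children, which [W] does not contain; the cuts
    have to be absorbed by averaging. The first averaging does this inside [x_k]: few of its [n_p]
    summands are cut, and for each functional the range of one suitable summand represents [x_k] up
    to [O(1/m_p)]. As the [p_k] are distinct, a node of weight [m_(p_k)] singles out one index, like
    a unit functional of [W]. The second averaging handles the passage between blocks: on the paths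
    that matter, below a node of weight [m_(J_i)] the block [i] is seen only through weights of
    index less than [J_i] until [m_(p_k)] is reached, and the growth of [n_j] makes this
    [O(1/m_(J_i))], so a child straddling the end of the block may drop it. In the lower estimate
    the difficulty is to have free ranks for all nodes of the copied functional; the gaps of the
    sequence provide them. *)

Definition isum (a c : nat) (f : nat -> R) : R := rsum c f - rsum a f.

Lemma rsum_isum N f : rsum N f = isum 0 N f.
Proof. unfold isum; simpl; ring. Qed.

Lemma isum_nil a f : isum a a f = 0.
Proof. unfold isum; ring. Qed.

Lemma isum_S a c f : isum a (S c) f = isum a c f + f c.
Proof. unfold isum; simpl; ring. Qed.

Lemma isum_chasles a b c f : isum a b f + isum b c f = isum a c f.
Proof. unfold isum; ring. Qed.

Lemma isum_ext a c f g :
  (a <= c)%nat -> (forall k, (a <= k < c)%nat -> f k = g k) ->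
  isum a c f = isum a c g.
Proof.
  intros H; induction H as [|c H IH]; intros E.
  - now rewrite !isum_nil.
  - rewrite !isum_S, IH, E; auto; intros; apply E; lia.
Qed.

Lemma isum_le a c f g :
  (a <= c)%nat -> (forall k, (a <= k < c)%nat -> f k <= g k) ->
  isum a c f <= isum a c g.
Proof.
  intros H; induction H as [|c H IH]; intros E.
  - rewrite !isum_nil; lra.
  - rewrite !isum_S. apply Rplus_le_compat; [apply IH; intros; apply E; lia|].
    apply E; lia.
Qed.

Lemma isum_plus a c f g : isum a c (fun k => f k + g k) = isum a c f + isum a c g.
Proof.
  assert (H : forall N, rsum N (fun k => f k + g k) = rsum N f + rsum N g).
  { induction N as [|N IH]; simpl; [ring|rewrite IH; ring]. }
  unfold isum; rewrite !H; ring.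
Qed.

Lemma isum_scal a c r f : isum a c (fun k => r * f k) = r * isum a c f.
Proof.
  assert (H : forall N, rsum N (fun k => r * f k) = r * rsum N f).
  { induction N as [|N IH]; simpl; [ring|rewrite IH; ring]. }
  unfold isum; rewrite !H; ring.
Qed.

Lemma isum_const a c r : isum a c (fun _ => r) = r * (INR c - INR a).
Proof.
  assert (H : forall N, rsum N (fun _ => r) = r * INR N).
  { induction N as [|N IH]; [simpl; ring|]. rewrite S_INR; simpl; rewrite IH; ring. }
  unfold isum; rewrite !H; ring.
Qed.

Lemma isum_nonneg a c f :
  (a <= c)%nat -> (forall k, (a <= k < c)%nat -> 0 <= f k) -> 0 <= isum a c f.
Proof.
  intros H E. replace 0 with (isum a c (fun _ => 0)) by (rewrite isum_const; ring).
  now apply isum_le.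
Qed.

Lemma isum_zero a c f :
  (a <= c)%nat -> (forall k, (a <= k < c)%nat -> f k = 0) -> isum a c f = 0.
Proof.
  intros H E. rewrite (isum_ext a c f (fun _ => 0)), isum_const by auto. ring.
Qed.

Lemma isum_bound a c f r :
  (a <= c)%nat -> (forall k, (a <= k < c)%nat -> f k <= r) ->
  isum a c f <= r * (INR c - INR a).
Proof. intros H E. rewrite <- isum_const. now apply isum_le. Qed.

Lemma isum_abs a c f : (a <= c)%nat -> Rabs (isum a c f) <= isum a c (fun k => Rabs (f k)).
Proof.
  intros H; induction H as [|c H IH].
  - rewrite !isum_nil, Rabs_R0; lra.
  - rewrite !isum_S. eapply Rle_trans; [apply Rabs_triang|lra].
Qed.

Lemma isum_restrict a b c d f :
  (a <= b <= c)%nat -> (c <= d)%nat ->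
  (forall k, (a <= k < b)%nat -> f k = 0) -> (forall k, (c <= k < d)%nat -> f k = 0) ->
  isum a d f = isum b c f.
Proof.
  intros H1 H2 E1 E2.
  rewrite <- (isum_chasles a b d), <- (isum_chasles b c d).
  rewrite (isum_zero a b), (isum_zero c d) by (auto; lia). ring.
Qed.

Lemma isum_sub_le a b c d f :
  (a <= b <= c)%nat -> (c <= d)%nat -> (forall k, (a <= k < d)%nat -> 0 <= f k) ->
  isum b c f <= isum a d f.
Proof.
  intros H1 H2 E.
  rewrite <- (isum_chasles a b d), <- (isum_chasles b c d).
  assert (0 <= isum a b f) by (apply isum_nonneg; [lia|intros; apply E; lia]).
  assert (0 <= isum c d f) by (apply isum_nonneg; [lia|intros; apply E; lia]).
  lra.
Qed.

Lemma isum_single a c k0 f :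
  (a <= k0 < c)%nat -> (forall k, (a <= k < c)%nat -> k <> k0 -> f k = 0) ->
  isum a c f = f k0.
Proof.
  intros H E. rewrite (isum_restrict a k0 (S k0) c); try lia.
  - rewrite isum_S, isum_nil; ring.
  - intros; apply E; lia.
  - intros; apply E; lia.
Qed.

Lemma isum_at_most_one a c f r :
  (a <= c)%nat -> 0 <= r -> (forall k, (a <= k < c)%nat -> f k <= r) ->
  (forall k l, (a <= k < c)%nat -> (a <= l < c)%nat -> f k <> 0 -> f l <> 0 -> k = l) ->
  isum a c f <= r.
Proof.
  intros H Hr E U.
  destruct (classic (exists k, (a <= k < c)%nat /\ f k <> 0)) as [[k [Hk Fk]]|N].
  - rewrite (isum_single a c k); auto.
    intros l Hl Hne. apply NNPP. intro Fl. apply Hne. eauto.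
  - rewrite isum_zero; auto. intros k Hk. apply NNPP. intro Fk. apply N. eauto.
Qed.

Lemma rsum_blocks (s : nat -> nat) N f :
  s O = O -> rsum (s N) f = rsum N (fun i => isum (s i) (s (S i)) f).
Proof.
  intros H0; induction N as [|N IH]; simpl; [now rewrite H0|].
  rewrite <- IH. unfold isum. ring.
Qed.

Lemma geom4_bound N : rsum N (fun k => (/4) ^ (S k)) <= 1/3.
Proof.
  assert (H : rsum N (fun k => (/4) ^ (S k)) = 1/3 * (1 - (/4) ^ N)).
  { induction N as [|N IH]; [simpl; lra|]. change (rsum (S N) ?f) with (rsum N f + f N). rewrite IH. simpl. field. }
  rewrite H. assert (0 < (/4)^N) by (apply pow_lt; lra). lra.
Qed.

Lemma geom4_isum a c : (a <= c)%nat -> isum a c (fun k => (/4) ^ (S k)) <= 1/3.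
Proof.
  intros H. apply Rle_trans with (isum 0 c (fun k => (/4) ^ (S k))).
  - apply isum_sub_le; try lia. intros; apply pow_le; lra.
  - rewrite <- rsum_isum. apply geom4_bound.
Qed.

(** * Growth of the parameters *)

(** Integer form of the growth condition: the exponent [log2 (m (S j))] is only ever used through
    integers [L] below it. *)
Definition growth (m n : nat -> nat) : Prop :=
  m 1%nat = 4%nat /\ n 1%nat = 4%nat /\
  (forall j, (1 <= j)%nat -> (m j * m j <= m (S j))%nat) /\
  (forall j L, (1 <= j)%nat -> (2 ^ L <= m (S j))%nat ->
     (m (S j) * m (S j) * (4 * n j) ^ L <= n (S j))%nat).

Lemma growth_of_hyps (m n : nat -> nat)
  (hm1 : m 1%nat = 4%nat) (hn1 : n 1%nat = 4%nat)
  (hm : forall j, (1 <= j)%nat -> (m j * m j <= m (S j))%nat)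
  (hn : forall j, (1 <= j)%nat ->
     INR (m (S j)) ^ 2 * Rpower (INR (4 * n j)) (ln (INR (m (S j))) / ln 2)
       <= INR (n (S j))) : growth m n.
Proof.
  assert (M1 : forall j, (1 <= j)%nat -> (1 <= m j)%nat).
  { intros j H; induction H as [|j H IH]; [lia|]. specialize (hm j H). nia. }
  (* [Rpower] is an exponential, so the lower bound for [n (S j)] is positive whatever its base. *)
  assert (N1 : forall j, (1 <= j)%nat -> (1 <= n j)%nat).
  { intros j H; destruct H as [|j H]; [lia|].
    specialize (hn j H). assert (H1 := M1 (S j) ltac:(lia)).
    assert (H0 : 0 < INR (n (S j))).
    { eapply Rlt_le_trans; [|exact hn]. apply Rmult_lt_0_compat.
      - apply pow_lt, lt_0_INR; lia.
      - unfold Rpower; apply exp_pos. }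
    apply (INR_lt 0) in H0. lia. }
  repeat split; auto.
  intros j L Hj HL. apply INR_le. eapply Rle_trans; [|apply hn; auto].
  rewrite (mult_INR (m (S j) * m (S j))), (mult_INR (m (S j))). simpl (_ ^ 2). rewrite Rmult_1_r.
  apply Rmult_le_compat_l.
  { apply Rmult_le_pos; apply pos_INR. }
  rewrite pow_INR. assert (Hp : 0 < INR (4 * n j)) by (apply lt_0_INR; specialize (N1 j Hj); lia).
  rewrite <- Rpower_pow by auto.
  apply Rle_Rpower.
  { apply (le_INR 1). specialize (N1 j Hj). lia. }
  assert (L2 : 0 < ln 2) by (rewrite <- ln_1; apply ln_increasing; lra).
  apply Rmult_le_reg_r with (ln 2); auto. unfold Rdiv. rewrite Rmult_assoc, Rinv_l, Rmult_1_r by lra.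
  replace (INR L * ln 2) with (ln (2 ^ L)).
  - apply ln_le; [apply pow_lt; lra|]. change 2 with (INR 2). rewrite <- pow_INR. now apply le_INR.
  - rewrite <- Rpower_pow by lra. unfold Rpower. now rewrite ln_exp.
Qed.

Section Growth.
Variables (m n : nat -> nat).
Hypothesis G : growth m n.

Lemma m_sqr_le j : (1 <= j)%nat -> (m j * m j <= m (S j))%nat.
Proof. apply G. Qed.

Lemma m_ge_pow4 j : (1 <= j)%nat -> (4 ^ j <= m j)%nat.
Proof.
  intros H; induction H as [|j H IH].
  - destruct G as [E _]. rewrite E. simpl; lia.
  - assert (H2 := m_sqr_le j H). simpl (4 ^ S j)%nat.
    assert (4 <= m j)%nat; [|nia].
    apply Nat.le_trans with (4 ^ j)%nat; auto.
    change 4%nat with (4 ^ 1)%nat at 1. apply Nat.pow_le_mono_r; lia.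
Qed.

Lemma m_ge4 j : (1 <= j)%nat -> (4 <= m j)%nat.
Proof.
  intros H. apply Nat.le_trans with (4 ^ j)%nat; [|now apply m_ge_pow4].
  change 4%nat with (4 ^ 1)%nat at 1. apply Nat.pow_le_mono_r; lia.
Qed.

Lemma m_mono i j : (1 <= i)%nat -> (i <= j)%nat -> (m i <= m j)%nat.
Proof.
  intros Hi H; induction H as [|j H IH]; auto.
  assert (H2 := m_sqr_le j ltac:(lia)). assert (H4 := m_ge4 j ltac:(lia)). nia.
Qed.

Lemma m_sqr_lt i j : (1 <= i)%nat -> (i < j)%nat -> (m i * m i <= m j)%nat.
Proof.
  intros Hi H. apply Nat.le_trans with (m (S i)); [now apply m_sqr_le|]. apply m_mono; lia.
Qed.

Lemma n_growth j L : (1 <= j)%nat -> (2 ^ L <= m (S j))%nat ->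
  (m (S j) * m (S j) * (4 * n j) ^ L <= n (S j))%nat.
Proof. apply G. Qed.

Lemma n_ge4 j : (1 <= j)%nat -> (4 <= n j)%nat.
Proof.
  intros H; destruct H as [|j H].
  - destruct G as [_ [E _]]. lia.
  - assert (H1 := n_growth j 0 H). assert (H4 := m_ge4 (S j) ltac:(lia)). simpl in H1. nia.
Qed.

Lemma n_step j : (1 <= j)%nat -> (m (S j) * m (S j) * (4 * n j) <= n (S j))%nat.
Proof.
  intros H. assert (H4 := m_ge4 (S j) ltac:(lia)).
  assert (H1 := n_growth j 1 H ltac:(simpl; lia)). now rewrite Nat.pow_1_r in H1.
Qed.

Lemma n_mono i j : (1 <= i)%nat -> (i <= j)%nat -> (n i <= n j)%nat.
Proof.
  intros Hi H; induction H as [|j H IH]; auto.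
  assert (H2 := n_step j ltac:(lia)). assert (H4 := m_ge4 (S j) ltac:(lia)).
  assert (1 <= m (S j) * m (S j))%nat by nia. nia.
Qed.

Lemma m_le_n j : (1 <= j)%nat -> (m j <= n j)%nat.
Proof.
  intros H; destruct H as [|j H].
  - destruct G as [E1 [E2 _]]. lia.
  - assert (H1 := n_step j H). assert (H4 := m_ge4 (S j) ltac:(lia)).
    assert (N4 := n_ge4 j H). assert (m (S j) <= m (S j) * m (S j))%nat by nia. nia.
Qed.

Lemma Rm_ge4 j : (1 <= j)%nat -> 4 <= INR (m j).
Proof. intros H. apply m_ge4, le_INR in H. simpl in H; lra. Qed.

Lemma Rn_ge4 j : (1 <= j)%nat -> 4 <= INR (n j).
Proof. intros H. apply n_ge4, le_INR in H. simpl in H; lra. Qed.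

Lemma inv_m_bounds j : (1 <= j)%nat -> 0 < / INR (m j) <= /4.
Proof.
  intros H. assert (H4 := Rm_ge4 j H). split.
  - apply Rinv_0_lt_compat; lra.
  - apply Rinv_le_contravar; lra.
Qed.

Lemma inv_m_mono i j : (1 <= i)%nat -> (i <= j)%nat -> / INR (m j) <= / INR (m i).
Proof.
  intros Hi H. apply Rinv_le_contravar.
  - assert (H4 := Rm_ge4 i Hi); lra.
  - apply le_INR, m_mono; auto.
Qed.

Lemma inv_m_sqr i j : (1 <= i)%nat -> (i < j)%nat -> / INR (m j) <= / INR (m i) * / INR (m i).
Proof.
  intros Hi H. assert (H4 := Rm_ge4 i Hi). rewrite <- Rinv_mult. apply Rinv_le_contravar; [nra|].
  rewrite <- mult_INR. apply le_INR, m_sqr_lt; auto.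
Qed.

Lemma inv_m_geom j : (1 <= j)%nat -> / INR (m j) <= (/4) ^ j.
Proof.
  intros H. rewrite pow_inv. apply Rinv_le_contravar; [apply pow_lt; lra|].
  replace (4 ^ j) with (INR (4 ^ j)%nat).
  - now apply le_INR, m_ge_pow4.
  - rewrite pow_INR. f_equal. simpl; ring.
Qed.

End Growth.

(** * Evaluation functionals on finitely supported vectors *)

Lemma valid_rank_pos n g : valid n g -> (1 <= rank g)%nat.
Proof. destruct g; simpl; lia. Qed.

Lemma valid_widx_le_rank n g : valid n g -> (widx g <= rank g)%nat.
Proof.
  destruct g as [|r j s eta|r xi j s eta]; simpl; lia.
Qed.

Lemma ecoef_Gf m r j s eta d :
  ecoef m (Gf r j s eta) d =
  (if gam_eq_dec d (Gf r j s eta) then 1 else 0) +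
  sgn s / INR (m j) *
  (if andb (Nat.ltb 0 (rank d)) (Nat.leb (rank d) (r - 1)) then ecoef m eta d else 0).
Proof. reflexivity. Qed.

Lemma ecoef_Gn m r xi j s eta d :
  ecoef m (Gn r xi j s eta) d =
  (if gam_eq_dec d (Gn r xi j s eta) then 1 else 0) +
  (ecoef m xi d + sgn s / INR (m j) *
  (if andb (Nat.ltb (rank xi) (rank d)) (Nat.leb (rank d) (r - 1)) then ecoef m eta d else 0)).
Proof. reflexivity. Qed.

Ltac rank_cases :=
  repeat match goal with
  | |- context [gam_eq_dec ?a ?b] =>
      destruct (gam_eq_dec a b) as [?E|?E];
      [ try (exfalso; subst; simpl in *; lia) | ]
  | |- context [Nat.ltb ?a ?b] => destruct (Nat.ltb_spec a b); try (exfalso; lia)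
  | |- context [Nat.leb ?a ?b] => destruct (Nat.leb_spec a b); try (exfalso; lia)
  end; simpl andb; cbv iota.

Lemma ecoef_above m n g d : valid n g -> (rank g < rank d)%nat -> ecoef m g d = 0.
Proof.
  revert d; induction g as [|r j s eta IHe|r xi IHx j s eta IHe]; intros d V H.
  - simpl in *. rank_cases. ring.
  - rewrite ecoef_Gf. simpl in V, H. rank_cases; ring.
  - rewrite ecoef_Gn. simpl in V, H. rewrite IHx by (intuition lia). rank_cases; ring.
Qed.

Definition lcomb (m : nat -> nat) (l : list (gam * R)) (g : gam) : R :=
  fold_right (fun pr acc => snd pr * ecoef m g (fst pr) + acc) 0 l.

(** Vectors are functions on all of [gam], so that inductions on trees carry no validity proofs
    inside terms; only the spanning indices must be valid. *)
Definition Blk (m n : nat -> nat) (x : gam -> R) (p q : nat) : Prop :=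
  exists l : list (gam * R),
    Forall (fun pr => valid n (fst pr) /\ (p <= rank (fst pr) <= q)%nat) l /\
    forall g, x g = lcomb m l g.

Lemma lcomb_ext m (P : gam -> Prop) l g g' t :
  Forall (fun pr => P (fst pr)) l ->
  (forall d, P d -> ecoef m g d = t * ecoef m g' d) ->
  lcomb m l g = t * lcomb m l g'.
Proof.
  intros F H; induction F as [|[d c] l Hd F IH]; unfold lcomb in *; simpl in *; [ring|].
  rewrite IH, H by auto. ring.
Qed.

Section Evaluation.
Variables (m n : nat -> nat).

Lemma Blk_ext_eval x p q g g' t :
  Blk m n x p q ->
  (forall d, valid n d -> (p <= rank d <= q)%nat -> ecoef m g d = t * ecoef m g' d) ->
  x g = t * x g'.
Proof.
  intros (l & F & E) H. rewrite !E.
  apply lcomb_ext with (P := fun d => valid n d /\ (p <= rank d <= q)%nat); auto.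
  intros d [H1 H2]; auto.
Qed.

Lemma eval_low x p q g : Blk m n x p q -> valid n g -> (rank g < p)%nat -> x g = 0.
Proof.
  intros B V H. rewrite (Blk_ext_eval x p q g g 0 B); [ring|].
  intros d Vd Hd. rewrite (ecoef_above m n) by (auto; lia). ring.
Qed.

(** The range ends below [r], so the cut-off keeps all coefficients of [eta] and the component of
    the new node itself is not seen. *)
Lemma eval_Gf x p q r j s eta :
  Blk m n x p q -> (q < r)%nat -> x (Gf r j s eta) = sgn s / INR (m j) * x eta.
Proof.
  intros B H. apply (Blk_ext_eval x p q); auto.
  intros d Vd Hd. assert (H1 := valid_rank_pos n d Vd).
  rewrite ecoef_Gf. rank_cases. ring.
Qed.

Lemma eval_Gn_old x p q r xi j s eta :
  Blk m n x p q -> valid n (Gn r xi j s eta) -> (q <= rank xi)%nat ->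
  x (Gn r xi j s eta) = x xi.
Proof.
  intros B V H. rewrite <- (Rmult_1_l (x xi)). apply (Blk_ext_eval x p q); auto.
  intros d Vd Hd. rewrite ecoef_Gn. simpl in V. rank_cases. ring.
Qed.

Lemma eval_Gn_new x p q r xi j s eta :
  Blk m n x p q -> valid n (Gn r xi j s eta) -> (rank xi < p)%nat -> (q < r)%nat ->
  x (Gn r xi j s eta) = sgn s / INR (m j) * x eta.
Proof.
  intros B V H1 H2. apply (Blk_ext_eval x p q); auto.
  intros d Vd Hd. rewrite ecoef_Gn. simpl in V.
  rewrite (ecoef_above m n xi) by (intuition lia). rank_cases. ring.
Qed.

Hypothesis G : growth m n.

Lemma sgn_abs s : Rabs (sgn s) = 1.
Proof. destruct s; simpl; unfold Rabs; destruct Rcase_abs; lra. Qed.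

Lemma sgn_div_abs s j t : (1 <= j)%nat ->
  Rabs (sgn s / INR (m j) * t) = / INR (m j) * Rabs t.
Proof.
  intros Hj. unfold Rdiv. assert (H := inv_m_bounds m n G j Hj).
  rewrite !Rabs_mult, sgn_abs, (Rabs_pos_eq (/ INR (m j))) by lra. ring.
Qed.

(** The summands of [ecoef] live on disjoint sets of ranks (up to [rank xi], strictly between
    [rank xi] and [r], and [r]), so they never add up. *)
Lemma ecoef_bound g d : valid n g -> Rabs (ecoef m g d) <= 1.
Proof.
  revert d; induction g as [|r j s eta IHe|r xi IHx j s eta IHe]; intros d V.
  - simpl. rank_cases; rewrite Rplus_0_r, ?Rabs_R0, ?Rabs_R1; lra.
  - simpl in V. destruct V as (H1 & H2 & V & H3). rewrite ecoef_Gf.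
    assert (Hm := inv_m_bounds m n G j ltac:(lia)). specialize (IHe d V).
    assert (Hs := sgn_div_abs s j (ecoef m eta d) ltac:(lia)).
    assert (0 <= Rabs (ecoef m eta d)) by apply Rabs_pos.
    rank_cases; subst; simpl in *; try lia;
      rewrite ?Rmult_0_r, ?Rplus_0_r, ?Rplus_0_l, ?Rabs_R0, ?Rabs_R1; try lra.
    rewrite Hs. nra.
  - simpl in V. destruct V as (Vx & Ve & H1 & H2 & H3 & H4 & H5 & H6 & H7 & H8).
    rewrite ecoef_Gn.
    assert (Hm := inv_m_bounds m n G j ltac:(lia)).
    assert (Hs := sgn_div_abs s j (ecoef m eta d) ltac:(lia)).
    assert (He := IHe d Ve). assert (Hx := IHx d Vx).
    assert (0 <= Rabs (ecoef m eta d)) by apply Rabs_pos.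
    destruct (le_lt_dec (rank d) (rank xi)) as [L|L].
    + rank_cases; rewrite ?Rmult_0_r, ?Rplus_0_r, ?Rplus_0_l; auto.
    + rewrite (ecoef_above m n xi) by auto.
      rank_cases; subst; simpl in *; try lia;
        rewrite ?Rmult_0_r, ?Rplus_0_r, ?Rplus_0_l, ?Rabs_R0, ?Rabs_R1; try lra.
      rewrite Hs. nra.
Qed.

Lemma Blk_bounded x p q : Blk m n x p q ->
  exists M, 0 <= M /\ forall g, valid n g -> Rabs (x g) <= M.
Proof.
  intros (l & F & E). exists (fold_right (fun pr acc => Rabs (snd pr) + acc) 0 l).
  assert (H : 0 <= fold_right (fun pr acc => Rabs (snd pr) + acc) 0 l /\
     forall g, valid n g -> Rabs (lcomb m l g) <= fold_right (fun pr acc => Rabs (snd pr) + acc) 0 l).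
  { clear - G; induction l as [|[d c] l [IH1 IH2]]; unfold lcomb in *; simpl.
    - split; [lra|]. intros; rewrite Rabs_R0; lra.
    - assert (0 <= Rabs c) by apply Rabs_pos. split; [lra|]. intros g V.
      eapply Rle_trans; [apply Rabs_triang|]. rewrite Rabs_mult.
      assert (Rabs (ecoef m g d) <= 1) by now apply ecoef_bound.
      assert (0 <= Rabs (ecoef m g d)) by apply Rabs_pos.
      specialize (IH2 g V). nra. }
  split; [apply H|]. intros g V. rewrite E. now apply H.
Qed.

Lemma lcomb_app l l' g : lcomb m (l ++ l') g = lcomb m l g + lcomb m l' g.
Proof. induction l as [|[d c] l IH]; unfold lcomb in *; simpl; [ring|rewrite IH; ring]. Qed.

Lemma Blk_widen x p q p' q' : Blk m n x p q -> (p' <= p)%nat -> (q <= q')%nat -> Blk m n x p' q'.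
Proof.
  intros (l & F & E) H1 H2. exists l; split; auto.
  eapply Forall_impl; [|exact F]. simpl; intros a [? ?]; split; auto; lia.
Qed.

Lemma Blk_plus x y p q : Blk m n x p q -> Blk m n y p q -> Blk m n (fun g => x g + y g) p q.
Proof.
  intros (l & F & E) (l' & F' & E'). exists (l ++ l'); split.
  - now apply Forall_app.
  - intros g. now rewrite lcomb_app, E, E'.
Qed.

Lemma Blk_scal x p q t : Blk m n x p q -> Blk m n (fun g => t * x g) p q.
Proof.
  intros (l & F & E). exists (map (fun pr => (fst pr, t * snd pr)) l); split.
  - apply Forall_map. simpl. exact F.
  - intros g. rewrite E. clear. induction l as [|[d c] l IH]; unfold lcomb in *; simpl; [ring|].
    rewrite <- IH. ring.
Qed.

End Evaluation.

(** * Lower [T]-estimates for sparse block sequences *)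

Definition wsum (fs : list (nat -> R)) (k : nat) : R :=
  fold_right (fun (f : nat -> R) acc => f k + acc) 0 fs.

Lemma wsum_single fs k :
  ForallOrdPairs succ_supp fs -> wsum fs k = 0 \/ exists f, In f fs /\ wsum fs k = f k.
Proof.
  intros F; induction F as [|f fs Hf F IH]; [left; reflexivity|].
  unfold wsum in *; simpl.
  destruct (Req_dec (f k) 0) as [E|E].
  - rewrite E, Rplus_0_l. destruct IH as [IH|(g & Hg & IH)]; auto.
    right; exists g; auto.
  - right; exists f; split; auto.
    destruct IH as [IH|(g & Hg & IH)]; [rewrite IH; ring|].
    rewrite Forall_forall in Hf. specialize (Hf g Hg k k).
    destruct (Req_dec (g k) 0) as [E'|E']; [rewrite IH, E'; ring|].
    specialize (Hf E E'); lia.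
Qed.

Lemma cut_exists (p : nat -> Prop) a c :
  (a <= c)%nat -> (forall k, p k -> p (S k)) ->
  exists e, (a <= e <= c)%nat /\ (forall k, (a <= k < e)%nat -> ~ p k) /\
    (forall k, (e <= k)%nat -> (k < c)%nat -> p k).
Proof.
  intros H M; induction H as [|c H IH].
  - exists a; split; [lia|split; intros; lia].
  - destruct IH as (e & He & H1 & H2).
    destruct (le_lt_dec c e) as [L|L].
    + assert (e = c) by lia; subst e. destruct (classic (p c)) as [pc|pc].
      * exists c. split; [lia|split; auto]. intros. assert (k = c) by lia. now subst.
      * exists (S c). split; [lia|split; [|intros; lia]].
        intros. destruct (Nat.eq_dec k c); [now subst|apply H1; lia].
    + exists e. split; [lia|split; auto]. intros k Hk1 Hk2.
      destruct (Nat.eq_dec k c); [|apply H2; lia]. subst.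
      destruct c as [|c]; [lia|]. apply M, H2; lia.
Qed.

Lemma last_support (f : nat -> R) a c : (a <= c)%nat ->
  exists e, (a <= e <= c)%nat /\ (forall k, (e <= k < c)%nat -> f k = 0) /\
    ((a < e)%nat -> f (e - 1)%nat <> 0).
Proof.
  intros H; induction H as [|c H (e & He & H1 & H2)].
  - exists a; split; [lia|split; intros; lia].
  - destruct (Req_dec (f c) 0) as [E|E].
    + exists e. split; [lia|split; auto]. intros k Hk.
      destruct (Nat.eq_dec k c); [now subst|apply H1; lia].
    + exists (S c). split; [lia|split; [intros; lia|]]. intros _.
      now replace (S c - 1)%nat with c by lia.
Qed.

Lemma inW_bound m n f k : growth m n -> inW m n f -> Rabs (f k) <= 1.
Proof.
  intros G; induction 1 as [i s|j fs Hj H1 H2 Hf IH F].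
  - destruct (Nat.eqb k i); [rewrite sgn_abs; lra|rewrite Rabs_R0; lra].
  - change (Rabs (/ INR (m j) * wsum fs k) <= 1). rewrite Rabs_mult.
    assert (Hm := inv_m_bounds m n G j Hj). rewrite (Rabs_pos_eq (/ _)) by lra.
    assert (Rabs (wsum fs k) <= 1); [|assert (0 <= Rabs (wsum fs k)) by apply Rabs_pos; nra].
    destruct (wsum_single fs k F) as [E|(f & Hin & E)]; rewrite E.
    + rewrite Rabs_R0; lra.
    + now apply IH.
Qed.

Definition spread (m n : nat -> nat) (x : nat -> gam -> R) (P Q : nat -> nat)
  (lf : nat -> gam) : Prop :=
  forall k, Blk m n (x k) (P k) (Q k) /\ valid n (lf k) /\
    (P k <= rank (lf k))%nat /\ (Q k <= rank (lf k))%nat /\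
    (rank (lf k) + k + 2 <= P (S k))%nat /\ (k + 2 <= P k)%nat /\
    x k (lf k) = 1 /\ (forall i, (i < k)%nat -> x i (lf k) = 0).

Section Lower.
Variables (m n : nat -> nat).
Hypothesis G : growth m n.
Variables (x : nat -> gam -> R) (P Q : nat -> nat) (lf : nat -> gam).
Hypothesis Sp : spread m n x P Q lf.
Variable b : nat -> R.

Lemma sp_P i k : (i <= k)%nat -> (P i <= P k)%nat.
Proof. induction 1 as [|k H IH]; auto. destruct (Sp k) as (_&_&?&_&?&_). lia. Qed.

Lemma sp_lf_P i k : (i < k)%nat -> (rank (lf i) + i + 2 <= P k)%nat.
Proof. intros H. destruct (Sp i) as (_&_&_&_&?&_). assert (P (S i) <= P k)%nat by (apply sp_P; lia). lia. Qed.

Lemma sp_lf i k : (i <= k)%nat -> (rank (lf i) <= rank (lf k))%nat.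
Proof.
  intros H. destruct (Nat.eq_dec i k); [now subst|].
  assert (H1 := sp_lf_P i k ltac:(lia)). destruct (Sp k) as (_&_&?&_). lia.
Qed.

Lemma sp_Q_lf i k : (i <= k)%nat -> (Q i <= rank (lf k))%nat.
Proof. intros H. destruct (Sp i) as (_&_&_&?&_). assert (H1 := sp_lf i k H). lia. Qed.

Lemma sp_leaf k i : x i (lf k) = if Nat.eq_dec i k then 1 else 0.
Proof.
  destruct (Sp k) as (_&V&_&_&_&_&E1&E2).
  destruct (Nat.eq_dec i k); [now subst|].
  destruct (le_lt_dec k i) as [L|L]; [|now apply E2].
  destruct (Sp i) as (B&_). apply (eval_low m n _ _ _ _ B V).
  assert (H1 := sp_lf_P k i ltac:(lia)). lia.
Qed.

(** A copy in [Gamma] of a functional living on [a, c), with value at least [V] up to sign. The rank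
    allowance [c - 1 - a] pays for its nodes and, by the gaps in [spread], keeps it below [P c]. *)
Definition Good (a c : nat) (V : R) : Prop :=
  (a < c)%nat /\ exists g e, valid n g /\
    (rank (lf (c - 1)) <= rank g <= rank (lf (c - 1)) + (c - 1 - a))%nat /\
    (forall k, ~ (a <= k < c)%nat -> x k g = 0) /\
    V <= sgn e * isum a c (fun k => b k * x k g).

(** An unfinished node of weight [m j] with [t] children so far; its rank may be chosen anywhere
    between [lo] and the start of the vector of index [c]. The sign of [Good] is gone, since the
    tuple absorbs it. *)
Definition PreChain (j t a c : nat) (V : R) (lo : nat) : Prop :=
  (a < c)%nat /\ (rank (lf (c - 1)) <= lo)%nat /\
  forall r, (lo <= r < P c)%nat -> exists g, valid n g /\ widx g = j /\ age g = t /\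
    rank g = r /\ (forall k, ~ (a <= k < c)%nat -> x k g = 0) /\
    V / INR (m j) <= isum a c (fun k => b k * x k g).

Lemma Good_PreChain j a c V :
  (1 <= j <= P a)%nat -> Good a c V ->
  exists lo, (lo <= rank (lf (c - 1)) + (c - 1 - a) + 1)%nat /\ PreChain j 1 a c V lo.
Proof.
  intros Hj (Hac & g & e & Vg & Hr & Z & HV).
  exists (rank g + 1)%nat. split; [lia|]. split; [auto|split; [lia|]].
  intros r Hr'. exists (Gf r j e g).
  assert (Hg : (P a <= rank g)%nat).
  { assert (H1 := sp_P a (c-1) ltac:(lia)). destruct (Sp (c-1)%nat) as (_&_&?&_). lia. }
  assert (Hg1 := valid_rank_pos n g Vg).
  assert (Vn : valid n (Gf r j e g)) by (simpl; repeat split; auto; lia).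
  assert (Eold : forall k, (k < c)%nat -> x k (Gf r j e g) = sgn e / INR (m j) * x k g).
  { intros k Hk. destruct (Sp k) as (B&_). apply (eval_Gf m n _ _ _ _ _ _ _ B).
    assert (H1 := sp_Q_lf k (c-1) ltac:(lia)). lia. }
  split; [exact Vn|]. split; [reflexivity|]. split; [reflexivity|]. split; [reflexivity|].
  assert (Hm := inv_m_bounds m n G j ltac:(lia)).
  split.
  - intros k Hk. destruct (le_lt_dec c k) as [L|L].
    + destruct (Sp k) as (B&_). apply (eval_low m n _ _ _ _ B Vn).
      assert (H1 := sp_P c k L). simpl; lia.
    + rewrite Eold by auto. rewrite Z by lia. ring.
  - rewrite (isum_ext a c _ (fun k => (sgn e / INR (m j)) * (b k * x k g))).
    + rewrite isum_scal. unfold Rdiv. nra.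
    + lia.
    + intros k Hk. rewrite Eold by lia. ring.
Qed.

Lemma PreChain_extend j t a c V lo a' c' V' :
  (1 <= j)%nat -> PreChain j t a c V lo -> (lo < P c)%nat -> Good a' c' V' -> (c <= a')%nat ->
  (t < n j)%nat ->
  exists lo', (lo' <= rank (lf (c' - 1)) + (c' - 1 - a))%nat /\
    PreChain j (S t) a c' (V + V') lo'.
Proof.
  intros Hj (Hac & Hlo & C) Hlo2 (Hac' & g & e & Vg & Hr & Z & HV) Hca Ht.
  exists (rank g + 1)%nat. split; [lia|]. split; [lia|split; [lia|]].
  intros r Hr'.
  (* The link [xi] takes the last rank before the vector of index [c]: vectors before [c] are read
     by [xi], those from [c] on by [g]. *)
  destruct (C (P c - 1)%nat ltac:(lia)) as (xi & Vx & Wx & Ax & Rx & Zx & Sx).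
  exists (Gn r xi j e g).
  assert (Hg : (P c <= rank g)%nat).
  { assert (H1 := sp_P c (c'-1) ltac:(lia)). destruct (Sp (c'-1)%nat) as (_&_&?&_). lia. }
  assert (Hx1 := valid_rank_pos n xi Vx). assert (Hx2 := valid_widx_le_rank n xi Vx).
  assert (Vn : valid n (Gn r xi j e g)) by (simpl; repeat split; auto; lia).
  assert (Eold : forall k, (k < c)%nat -> x k (Gn r xi j e g) = x k xi).
  { intros k Hk. destruct (Sp k) as (B&_). apply (eval_Gn_old m n _ _ _ _ _ _ _ _ B Vn).
    assert (H1 := sp_Q_lf k (c-1) ltac:(lia)). lia. }
  assert (Enew : forall k, (c <= k < c')%nat ->
     x k (Gn r xi j e g) = sgn e / INR (m j) * x k g).
  { intros k Hk. destruct (Sp k) as (B&_). apply (eval_Gn_new m n _ _ _ _ _ _ _ _ B Vn).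
    - assert (H1 := sp_P c k ltac:(lia)). lia.
    - assert (H1 := sp_Q_lf k (c'-1) ltac:(lia)). lia. }
  split; [exact Vn|]. split; [reflexivity|]. split; [simpl; congruence|]. split; [reflexivity|].
  assert (Hm := inv_m_bounds m n G j ltac:(lia)).
  split.
  - intros k Hk. destruct (le_lt_dec c' k) as [L|L].
    + destruct (Sp k) as (B&_). apply (eval_low m n _ _ _ _ B Vn).
      assert (H1 := sp_P c' k L). simpl; lia.
    + destruct (le_lt_dec c k) as [L'|L'].
      * lia.
      * rewrite Eold by auto. apply Zx; lia.
  - rewrite <- (isum_chasles a c c').
    rewrite (isum_ext a c _ (fun k => b k * x k xi)); [|lia|].
    2:{ intros k Hk. rewrite Eold by lia. ring. }
    rewrite (isum_ext c c' _ (fun k => (sgn e / INR (m j)) * (b k * x k g))); [|lia|].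
    2:{ intros k Hk. rewrite Enew by lia. ring. }
    rewrite isum_scal, (isum_restrict c a' c' c') by (try lia; intros; rewrite Z by lia; ring).
    unfold Rdiv in *. nra.
Qed.

Lemma PreChain_Good j t a c V lo :
  PreChain j t a c V lo -> (lo <= rank (lf (c - 1)) + (c - 1 - a))%nat ->
  Good a c (V / INR (m j)).
Proof.
  intros (Hac & Hlo & C) H. split; auto.
  assert (H1 := sp_lf_P (c-1) c ltac:(lia)).
  destruct (C lo ltac:(lia)) as (g & Vg & _ & _ & Rg & Zg & Sg).
  exists g, true. rewrite Rg. repeat split; auto. simpl; lra.
Qed.

Fixpoint goods (c u : nat) (gs : list (nat * nat * R)) : Prop :=
  match gs with
  | [] => True
  | (a', c', V) :: gs' => (c <= a')%nat /\ (c' <= u)%nat /\ Good a' c' V /\ goods c' u gs'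
  end.

Definition gsum (gs : list (nat * nat * R)) : R := fold_right (fun g acc => snd g + acc) 0 gs.

Lemma PreChain_extend_list j gs : (1 <= j)%nat -> forall t a c u V lo,
  PreChain j t a c V lo -> (lo <= rank (lf (c - 1)) + (c - 1 - a))%nat ->
  (c <= u)%nat -> goods c u gs -> (t + length gs <= n j)%nat ->
  exists c', (c <= c' <= u)%nat /\ Good a c' ((V + gsum gs) / INR (m j)).
Proof.
  intros Hj; induction gs as [|[[a' c'] V'] gs IH]; intros t a c u V lo PC Hlo Hcu Hg Hl.
  - exists c. split; [lia|]. unfold gsum; simpl. rewrite Rplus_0_r.
    now apply (PreChain_Good j t a c V lo).
  - destruct Hg as (H1 & H2 & H3 & H4). simpl in Hl.
    assert (Hac : (a < c)%nat) by apply PC. assert (H5 := sp_lf_P (c-1) c ltac:(lia)).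
    destruct (PreChain_extend j t a c V lo a' c' V' Hj PC ltac:(lia) H3 H1 ltac:(lia)) as (lo' & L1 & PC').
    destruct (IH (S t) a c' u (V + V') lo' PC' L1 H2 H4 ltac:(lia)) as (c'' & Hc & Hgd).
    exists c''. split.
    + assert (a' < c')%nat by apply H3. lia.
    + unfold gsum in *; simpl. now rewrite <- Rplus_assoc.
Qed.

(** A node over a single child would cost a rank that the length of its interval does not pay for;
    the child itself is kept instead, which is no loss as [/ m j <= 1]. With a second child the
    interval is longer by at least one and the allowance suffices. *)
Lemma goods_avg j a u gs :
  (1 <= j <= P a)%nat -> (length gs <= n j)%nat -> goods a u gs -> (forall k, In k gs -> 0 <= snd k) ->
  exists V, 0 <= V /\ gsum gs / INR (m j) <= V /\
    (V = 0 \/ exists a' c', (a <= a')%nat /\ (c' <= u)%nat /\ Good a' c' V).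
Proof.
  intros Hj Hl Hg Hpos.
  assert (Hm := inv_m_bounds m n G j ltac:(lia)).
  destruct gs as [|[[a1 c1] V1] [|[[a2 c2] V2] gs]].
  - exists 0. unfold gsum, Rdiv; simpl. rewrite Rmult_0_l. repeat split; auto; lra.
  - destruct Hg as (H1 & H2 & H3 & _). assert (0 <= V1) by (apply (Hpos (a1,c1,V1)); left; auto).
    exists V1. unfold gsum, Rdiv; simpl. split; [auto|split; [nra|]].
    right; exists a1, c1. split; [lia|split; [lia|exact H3]].
  - destruct Hg as (H1 & H2 & H3 & H4 & H5 & H6 & H7).
    assert (Hac : (a1 < c1)%nat) by apply H3. assert (Hac2 : (a2 < c2)%nat) by apply H6.
    assert (HP := sp_P a a1 H1). assert (HP2 := sp_lf_P (c1-1) c1 ltac:(lia)).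
    destruct (Good_PreChain j a1 c1 V1 ltac:(lia) H3) as (lo & L1 & PC).
    simpl in Hl.
    destruct (PreChain_extend j 1 a1 c1 V1 lo a2 c2 V2 ltac:(lia) PC ltac:(lia) H6 H4 ltac:(lia)) as (lo' & L1' & PC').
    destruct (PreChain_extend_list j gs ltac:(lia) 2 a1 c2 u (V1 + V2) lo' PC' L1' H5 H7 ltac:(lia)) as (c' & Hc & Hgd).
    exists ((V1 + V2 + gsum gs) / INR (m j)). split.
    + assert (0 <= V1) by (apply (Hpos (a1,c1,V1)); left; auto).
      assert (0 <= V2) by (apply (Hpos (a2,c2,V2)); right; left; auto).
      assert (0 <= gsum gs).
      { clear - Hpos. assert (Hp : forall k, In k gs -> 0 <= snd k) by (intros; apply Hpos; right; right; auto).
        clear Hpos. induction gs as [|g gs IH]; unfold gsum in *; simpl in *; [lra|].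
        assert (0 <= snd g) by auto. assert (0 <= fold_right (fun g acc => snd g + acc) 0 gs) by auto. lra. }
      unfold Rdiv. apply Rmult_le_pos; lra.
    + split; [unfold gsum; simpl; right; unfold Rdiv; ring|].
      right; exists a1, c'. split; [lia|split; [lia|exact Hgd]].
Qed.

Definition tau (k : nat) : R := (/4) ^ (S k).

Lemma tau_pos k : 0 <= tau k.
Proof. apply pow_le; lra. Qed.

(** Stated on all intervals because the children of a functional act on consecutive ones. The error
    does not grow with the depth of [f]: a coordinate is either dropped at a node or passed on with
    a factor at most 1. *)
Definition simulated (f : nat -> R) : Prop := forall a c, (a <= c)%nat -> exists V, 0 <= V /\
  Rabs (isum a c (fun k => f k * b k)) <= isum a c (fun k => tau k * Rabs (b k)) + V /\
  (V = 0 \/ exists a' c', (a <= a')%nat /\ (c' <= c)%nat /\ Good a' c' V).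

Lemma tau_sum_nonneg a c : (a <= c)%nat -> 0 <= isum a c (fun k => tau k * Rabs (b k)).
Proof.
  intros; apply isum_nonneg; auto. intros. apply Rmult_le_pos; [apply tau_pos|apply Rabs_pos].
Qed.

Lemma Good_unit i : Good i (S i) (Rabs (b i)).
Proof.
  split; [lia|]. destruct (Sp i) as (_&V&_).
  exists (lf i), (if Rle_dec 0 (b i) then true else false).
  replace (S i - 1)%nat with i by lia. repeat split; auto; try lia.
  - intros k Hk. rewrite sp_leaf. destruct (Nat.eq_dec k i); [lia|auto].
  - rewrite isum_S, isum_nil, sp_leaf. destruct (Nat.eq_dec i i); [|lia].
    destruct (Rle_dec 0 (b i)); simpl; unfold Rabs; destruct Rcase_abs; lra.
Qed.

Lemma simulated_unit i s : simulated (fun k => if Nat.eqb k i then sgn s else 0).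
Proof.
  intros a c H. assert (Ht := tau_sum_nonneg a c H).
  destruct (le_lt_dec a i) as [L1|L1]; [destruct (le_lt_dec c i) as [L2|L2]|].
  2:{ exists (Rabs (b i)). split; [apply Rabs_pos|split].
      - rewrite (isum_single a c i) by (try lia; intros k _ Hk; apply Nat.eqb_neq in Hk; rewrite Hk; ring).
        rewrite Nat.eqb_refl, Rabs_mult, sgn_abs. lra.
      - right; exists i, (S i). split; [lia|split; [lia|apply Good_unit]]. }
  all: exists 0; split; [lra|split; [|auto]];
    rewrite isum_zero; [rewrite Rabs_R0; lra|auto|];
    intros k Hk; destruct (Nat.eqb_spec k i); [lia|ring].
Qed.

Lemma simulated_list fs :
  ForallOrdPairs succ_supp fs -> (forall f, In f fs -> simulated f) ->
  forall a c, (a <= c)%nat -> exists gs, (length gs <= length fs)%nat /\ goods a c gs /\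
    (forall k, In k gs -> 0 <= snd k) /\
    Rabs (isum a c (fun k => wsum fs k * b k)) <= isum a c (fun k => tau k * Rabs (b k)) + gsum gs.
Proof.
  intros F; induction F as [|f fs Hf F IH]; intros HS a c H.
  - exists []. simpl. repeat split; auto; [tauto|].
    unfold wsum, gsum; simpl. rewrite isum_zero by (auto; intros; ring).
    rewrite Rabs_R0. assert (Ht := tau_sum_nonneg a c H). lra.
  (* After the cut at the last support point of [f] in [a, c), the later functionals vanish on the
     left part and [f] on the right part. *)
  - destruct (last_support f a c H) as (e & He & Z1 & Z2).
    destruct (IH ltac:(intros; apply HS; right; auto) e c ltac:(lia)) as (gs & L & Gd & Pos & B).
    destruct (HS f (or_introl eq_refl) a e ltac:(lia)) as (V & V0 & BV & HV).
    assert (Z3 : forall k, (a <= k < e)%nat -> wsum fs k = 0).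
    { intros k Hk. destruct (wsum_single fs k F) as [E|(g & Hg & E)]; auto.
      rewrite E. apply NNPP. intros Ne. rewrite Forall_forall in Hf.
      specialize (Hf g Hg (e - 1)%nat k (Z2 ltac:(lia)) Ne). lia. }
    assert (EQ : isum a c (fun k => wsum (f :: fs) k * b k) =
       isum a e (fun k => f k * b k) + isum e c (fun k => wsum fs k * b k)).
    { rewrite <- (isum_chasles a e c). f_equal.
      - apply isum_ext; [lia|]. intros k Hk. unfold wsum; simpl. fold (wsum fs k).
        rewrite Z3 by auto. ring.
      - apply isum_ext; [lia|]. intros k Hk. unfold wsum; simpl. fold (wsum fs k).
        rewrite Z1 by auto. ring. }
    assert (EQ2 := isum_chasles a e c (fun k => tau k * Rabs (b k))).
    assert (Tri := Rabs_triang (isum a e (fun k => f k * b k)) (isum e c (fun k => wsum fs k * b k))).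
    destruct HV as [HV|(a' & c' & H1 & H2 & HG)].
    + exists gs. split; [simpl; lia|]. split; [|split; auto].
      * clear - Gd He. destruct gs as [|[[a' c'] V'] gs]; simpl in *; auto.
        intuition lia.
      * rewrite EQ. lra.
    + exists ((a', c', V) :: gs). split; [simpl; lia|]. split; [|split].
      * split; [lia|split; [lia|split; [exact HG|]]].
        clear - Gd H2. destruct gs as [|[[a1 c1] V'] gs]; simpl in *; auto. intuition lia.
      * intros k [<-|Hk]; simpl; auto.
      * rewrite EQ. unfold gsum in *; simpl. lra.
Qed.

Lemma inW_simulated f : inW m n f -> simulated f.
Proof.
  induction 1 as [i s|j fs Hj L1 L2 Hf IH F]; [apply simulated_unit|].
  assert (Wf : inW m n (fun k => / INR (m j) * wsum fs k)) by (apply W_avg; auto).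
  intros a c H.
  (* Before [e] the weight [m j] is not yet available; those coordinates are dropped, at the price
     [/ m j <= tau k] each. From [e] on the node can be copied. *)
  destruct (cut_exists (fun k => (j <= P k)%nat) a c H) as (e & He & N1 & N2).
  { intros k Hk. assert (H1 := sp_P k (S k) ltac:(lia)). lia. }
  assert (Hm := inv_m_bounds m n G j Hj).
  change (fun k => / INR (m j) * fold_right (fun f acc => f k + acc) 0 fs * b k)
    with (fun k => / INR (m j) * wsum fs k * b k).
  destruct (simulated_list fs F IH e c ltac:(lia)) as (gs & L & Gd & Pos & B).
  assert (Low : isum a e (fun k => Rabs (/ INR (m j) * wsum fs k * b k))
                <= isum a e (fun k => tau k * Rabs (b k))).
  { apply isum_le; [lia|]. intros k Hk. rewrite !Rabs_mult. rewrite (Rabs_pos_eq (/ _)) by lra.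
    apply Rmult_le_compat_r; [apply Rabs_pos|].
    assert (Rabs (wsum fs k) <= 1).
    { destruct (wsum_single fs k F) as [E|(f & Hin & E)]; rewrite E; [rewrite Rabs_R0; lra|].
      apply (inW_bound m n); auto. }
    assert (0 <= Rabs (wsum fs k)) by apply Rabs_pos.
    assert (/ INR (m j) <= tau k); [|nra].
    specialize (N1 k Hk). destruct (Sp k) as (_&_&_&_&_&HP&_).
    eapply Rle_trans; [apply (inv_m_mono m n G (S k)); lia|]. apply (inv_m_geom m n G); lia. }
  assert (High : Rabs (isum e c (fun k => / INR (m j) * wsum fs k * b k))
      <= isum e c (fun k => tau k * Rabs (b k)) + gsum gs / INR (m j)).
  { rewrite (isum_ext e c _ (fun k => / INR (m j) * (wsum fs k * b k))) by (try lia; intros; ring).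
    rewrite isum_scal, Rabs_mult, (Rabs_pos_eq (/ _)) by lra.
    assert (Ht := tau_sum_nonneg e c ltac:(lia)).
    assert (0 <= Rabs (isum e c (fun k => wsum fs k * b k))) by apply Rabs_pos. unfold Rdiv. nra. }
  assert (Main : exists V, 0 <= V /\ gsum gs / INR (m j) <= V /\
    (V = 0 \/ exists a' c', (e <= a')%nat /\ (c' <= c)%nat /\ Good a' c' V)).
  { destruct (le_lt_dec c e) as [Le|Le].
    - destruct gs as [|[[a' c'] V'] gs].
      + exists 0. unfold gsum, Rdiv; simpl. rewrite Rmult_0_l. repeat split; auto; lra.
      + destruct Gd as (H1 & H2 & H3 & _). destruct H3 as [H3 _]. lia.
    - assert (HPe := N2 e ltac:(lia) Le). apply goods_avg; auto; lia. }
  destruct Main as (V & V0 & V1 & V2). exists V. split; [auto|split].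
  - rewrite <- (isum_chasles a e c). rewrite <- (isum_chasles a e c (fun k => tau k * Rabs (b k))).
    assert (Tri := Rabs_triang (isum a e (fun k => / INR (m j) * wsum fs k * b k))
                     (isum e c (fun k => / INR (m j) * wsum fs k * b k))).
    assert (Habs := isum_abs a e (fun k => / INR (m j) * wsum fs k * b k) ltac:(lia)).
    simpl in *. lra.
  - destruct V2 as [V2|(a' & c' & H1 & H2 & H3)]; auto.
    right; exists a', c'. split; [lia|split; [lia|exact H3]].
Qed.

(** The constant is 1 + 1/3: the copy contributes at most [M], and since the leaves give
    [|b k| <= M], the dropped coordinates cost at most [M] times the sum of the [tau k]. *)
Lemma lower_estimate f N M :
  inW m n f ->
  (forall g, valid n g -> Rabs (rsum N (fun k => b k * x k g)) <= M) ->
  Rabs (rsum N (fun k => f k * b k)) <= 4/3 * M.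
Proof.
  intros Wf HM. rewrite !rsum_isum.
  assert (Hb : forall k, (k < N)%nat -> Rabs (b k) <= M).
  { intros k Hk. destruct (Sp k) as (_&V&_). specialize (HM (lf k) V).
    rewrite rsum_isum, (isum_single 0 N k) in HM; [|lia|].
    - rewrite sp_leaf in HM. destruct (Nat.eq_dec k k); [|lia]. now rewrite Rmult_1_r in HM.
    - intros i _ Hi. rewrite sp_leaf. destruct (Nat.eq_dec i k); [lia|ring]. }
  assert (M0 : 0 <= M).
  { eapply Rle_trans; [apply Rabs_pos|]. apply (HM G1 I). }
  destruct (inW_simulated f Wf 0%nat N ltac:(lia)) as (V & V0 & B & HV).
  assert (T : isum 0 N (fun k => tau k * Rabs (b k)) <= 1/3 * M).
  { apply Rle_trans with (isum 0 N (fun k => M * tau k)).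
    - apply isum_le; [lia|]. intros k Hk. specialize (Hb k ltac:(lia)).
      assert (H := tau_pos k). nra.
    - rewrite isum_scal. assert (H := geom4_isum 0 N ltac:(lia)). unfold tau. nra. }
  assert (VM : V <= M).
  { destruct HV as [->|(a & c & H1 & H2 & Hac & g & e & Vg & _ & Z & HV)]; auto.
    specialize (HM g Vg). rewrite rsum_isum in HM.
    rewrite (isum_restrict 0 a c N) in HM by (try lia; intros; rewrite Z by lia; ring).
    eapply Rle_trans; [exact HV|]. eapply Rle_trans; [apply Rle_abs|].
    now rewrite Rabs_mult, sgn_abs, Rmult_1_l. }
  lra.
Qed.

End Lower.

(** * Sparse sequences in the span of a block sequence *)

(** One node over unit functionals: the test functional behind all lower bounds for flat
    averages. *)
Lemma inW_flat m n j s len (sg : nat -> bool) :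
  (1 <= j)%nat -> (1 <= len <= n j)%nat ->
  inW m n (fun k => / INR (m j) *
    (if andb (s <=? k) (k <? s + len) then sgn (sg k) else 0)).
Proof.
  intros Hj Hl.
  set (u := fun i k : nat => if Nat.eqb k i then sgn (sg i) else 0).
  replace (fun k => / INR (m j) * (if andb (s <=? k) (k <? s + len) then sgn (sg k) else 0))
    with (fun k => / INR (m j) * fold_right (fun (f : nat -> R) acc => f k + acc) 0 (map u (seq s len))).
  - apply W_avg; auto.
    + rewrite length_map, length_seq; lia.
    + rewrite length_map, length_seq; lia.
    + intros f Hf. apply in_map_iff in Hf. destruct Hf as (i & <- & _). apply W_unit.
    + clear Hl. revert s. induction len as [|len IH]; intros s; simpl; constructor; auto.
      apply Forall_map, Forall_forall. intros i Hi. apply in_seq in Hi.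
      intros a c. unfold u. destruct (Nat.eqb_spec a s); [|tauto].
      destruct (Nat.eqb_spec c i); [|tauto]. intros; lia.
  - apply functional_extensionality. intros k. f_equal. clear Hl. revert s.
    induction len as [|len IH]; intros s; simpl.
    + destruct (Nat.leb_spec s k), (Nat.ltb_spec k (s + 0)); simpl; auto; lia.
    + rewrite IH. unfold u.
      destruct (Nat.eqb_spec k s), (Nat.leb_spec s k), (Nat.leb_spec (S s) k),
        (Nat.ltb_spec k (S s + len)), (Nat.ltb_spec k (s + S len)); simpl; subst; try lia; ring.
Qed.

Lemma isum_blocks_const a N len f :
  isum a (a + N * len) f = rsum N (fun l => isum (a + l * len) (a + S l * len) f).
Proof.
  induction N as [|N IH].
  - replace (a + 0 * len)%nat with a by lia. apply isum_nil.
  - cbn [rsum]. rewrite <- IH, isum_chasles. reflexivity.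
Qed.

Section Span.
Variables (m n : nat -> nat).
Hypothesis G : growth m n.
Variable X : nat -> gam -> R.

Definition InY (v : gam -> R) : Prop :=
  exists (N : nat) (c : nat -> R), forall g, v g = rsum N (fun k => c k * X k g).

Definition YB (v : gam -> R) (p q : nat) : Prop := Blk m n v p q /\ InY v.

Lemma rsum_extend N M (c : nat -> R) (f : nat -> R) : (N <= M)%nat ->
  rsum M (fun k => (if k <? N then c k else 0) * f k) = rsum N (fun k => c k * f k).
Proof.
  intros H. rewrite !rsum_isum, (isum_restrict 0 0 N M); try lia.
  - apply isum_ext; [lia|]. intros k Hk. destruct (Nat.ltb_spec k N); [auto|lia].
  - intros k Hk. destruct (Nat.ltb_spec k N); [lia|ring].
Qed.

Lemma InY_plus v w : InY v -> InY w -> InY (fun g => v g + w g).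
Proof.
  intros (N & c & E) (N' & c' & E'). exists (max N N'),
    (fun k => (if k <? N then c k else 0) + (if k <? N' then c' k else 0)).
  intros g. rewrite E, E'.
  rewrite <- (rsum_extend N (max N N')), <- (rsum_extend N' (max N N')) by lia.
  rewrite !rsum_isum, <- isum_plus. apply isum_ext; [lia|]. intros; ring.
Qed.

Lemma InY_scal v t : InY v -> InY (fun g => t * v g).
Proof.
  intros (N & c & E). exists N, (fun k => t * c k). intros g. rewrite E.
  rewrite !rsum_isum, <- isum_scal. apply isum_ext; [lia|]. intros; ring.
Qed.

Lemma YB_scal v p q t : YB v p q -> YB (fun g => t * v g) p q.
Proof. intros [B Y]. split; [now apply Blk_scal|now apply InY_scal]. Qed.

Lemma YB_isum v (P Q : nat -> nat) (be : nat -> R) a c p q :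
  (a <= c)%nat ->
  (forall k, (a <= k < c)%nat -> YB (v k) (P k) (Q k) /\ (p <= P k)%nat /\ (Q k <= q)%nat) ->
  YB (fun g => isum a c (fun k => be k * v k g)) p q.
Proof.
  intros H; induction H as [|c H IH]; intros HY.
  - replace (fun g => isum a a (fun k => be k * v k g)) with (fun _ : gam => 0)
      by (apply functional_extensionality; intros; now rewrite isum_nil).
    split; [exists []; split; [constructor|reflexivity]|exists O, (fun _ => 0); reflexivity].
  - replace (fun g => isum a (S c) (fun k => be k * v k g))
      with (fun g => isum a c (fun k => be k * v k g) + be c * v c g)
      by (apply functional_extensionality; intros; now rewrite isum_S).
    destruct (IH ltac:(intros; apply HY; lia)) as [B1 Y1].
    destruct (HY c ltac:(lia)) as ([B2 Y2] & H1 & H2).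
    split.
    + apply Blk_plus; auto. apply Blk_scal. eapply Blk_widen; eauto.
    + apply InY_plus; auto. now apply InY_scal.
Qed.

(** The bound [2 <= p'] excludes rank 1, which is still seen by an auxiliary component sitting on
    [G1]. *)
Definition leafed (x : gam -> R) (p q : nat) (g : gam) : Prop :=
  YB x p q /\ (p <= q)%nat /\ valid n g /\ (p <= rank g)%nat /\ (q <= rank g)%nat /\
  x g = 1 /\
  (forall v p' q', Blk m n v p' q' -> (2 <= p')%nat -> (q' + 2 <= p)%nat -> v g = 0).

(* The first component of the new functional is spent on a node of rank [p - 1] built on [G1];
   this cuts off everything supported strictly below [p], at the price of the factor 4. *)
Lemma leaf_exists v p q eta :
  YB v p q -> (3 <= p <= q)%nat -> valid n eta -> v eta <> 0 ->
  exists g, leafed (fun d => 4 / v eta * v d) p q g.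
Proof.
  intros HY Hp Ve Hv. assert (B : Blk m n v p q) by apply HY.
  assert (Hr : (p <= rank eta)%nat).
  { destruct (le_lt_dec p (rank eta)); auto. exfalso. apply Hv.
    now apply (eval_low m n v p q). }
  assert (N1 : n 1%nat = 4%nat) by apply G. assert (M1 : m 1%nat = 4%nat) by apply G.
  set (xi := Gf (p - 1) 1 true G1).
  assert (Vx : valid n xi) by (simpl; repeat split; lia).
  exists (Gn (max (rank eta) q + 1) xi 1 true eta).
  assert (Vg : valid n (Gn (max (rank eta) q + 1) xi 1 true eta)).
  { simpl valid. simpl (rank xi). simpl (age xi). rewrite N1.
    repeat split; auto; simpl; try lia. }
  split; [now apply YB_scal|]. split; [lia|]. split; [exact Vg|].
  split; [simpl; lia|]. split; [simpl; lia|]. split.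
  - rewrite (eval_Gn_new m n v p q) by (auto; simpl; lia).
    rewrite M1. simpl. field. exact Hv.
  - intros w p' q' Bw H1 H2.
    rewrite (eval_Gn_old m n w p' q') by (auto; simpl; lia).
    unfold xi. rewrite (eval_Gf m n w p' q') by (auto; lia).
    rewrite (eval_low m n w p' q' G1); simpl; auto; ring.
Qed.

(** [Pr] receives the threshold [P0] because a rapidly increasing sequence needs estimates relative
    to the place where the preceding vectors end. [Q k < P0 (S k)] makes the intervals from [P0 k]
    to [Q k] disjoint. *)
Lemma leafed_sequence (Pr : nat -> nat -> (gam -> R) -> nat -> nat -> gam -> Prop) (start : nat) :
  (3 <= start)%nat ->
  (forall k P0, (start <= P0)%nat -> exists x p q g, (P0 <= p)%nat /\ leafed x p q g /\ Pr k P0 x p q g) ->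
  exists (x : nat -> gam -> R) (P Q : nat -> nat) (lf : nat -> gam) (P0 : nat -> nat),
    spread m n x P Q lf /\
    forall k, leafed (x k) (P k) (Q k) (lf k) /\ (start <= P0 k <= P k)%nat /\
      (Q k < P0 (S k))%nat /\ Pr k (P0 k) (x k) (P k) (Q k) (lf k).
Proof.
  intros Hs H.
  assert (H' : forall k P0, exists t : (gam -> R) * nat * nat * gam,
    (start <= P0)%nat -> let '(x, p, q, g) := t in (P0 <= p)%nat /\ leafed x p q g /\ Pr k P0 x p q g).
  { intros k P0. destruct (le_lt_dec start P0) as [L|L].
    - destruct (H k P0 L) as (x & p & q & g & Hx). exists (x, p, q, g). auto.
    (* A default below [start], where nothing is required; the choice function must be total. *)
    - exists ((fun _ => 0), O, O, G1). lia. }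
  set (F := fun k P0 => proj1_sig (constructive_indefinite_description _ (H' k P0))).
  assert (HF : forall k P0, (start <= P0)%nat -> let '(x, p, q, g) := F k P0 in
     (P0 <= p)%nat /\ leafed x p q g /\ Pr k P0 x p q g).
  { intros k P0. unfold F. destruct (constructive_indefinite_description _ (H' k P0)) as [t Ht]; auto. }
  set (P0 := fix P0 k := match k with O => start
      | S k' => max start (rank (snd (F k' (P0 k'))) + k' + 4) end).
  assert (HP0 : forall k, (start <= P0 k)%nat) by (destruct k; simpl; lia).
  assert (HP1 : forall k, (rank (snd (F k (P0 k))) + k + 4 <= P0 (S k))%nat) by (intros k; simpl; lia).
  set (x := fun k => fst (fst (fst (F k (P0 k))))).
  set (P := fun k => snd (fst (fst (F k (P0 k))))).
  set (Q := fun k => snd (fst (F k (P0 k)))).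
  set (lf := fun k => snd (F k (P0 k))).
  assert (All : forall k, (P0 k <= P k)%nat /\ leafed (x k) (P k) (Q k) (lf k) /\
     Pr k (P0 k) (x k) (P k) (Q k) (lf k)).
  { intros k. unfold x, P, Q, lf. specialize (HF k (P0 k) (HP0 k)).
    destruct (F k (P0 k)) as [[[? ?] ?] ?]. exact HF. }
  assert (HP2 : forall k, (rank (lf k) + k + 4 <= P0 (S k))%nat) by exact HP1.
  clearbody x P Q lf. clear HP1.
  assert (Mono : forall i k, (i < k)%nat -> (rank (lf i) + i + 4 <= P k)%nat).
  { intros i k; induction 1 as [|k Hk IH].
    - destruct (All (S i)) as [? _]. specialize (HP2 i). lia.
    - destruct (All (S k)) as [? _]. destruct (All k) as (_ & (_ & _ & _ & ? & _) & _).
      specialize (HP2 k). lia. }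
  exists x, P, Q, lf, P0. split.
  - intros k. destruct (All k) as (H1 & ((B & Y) & H2 & H3 & H4 & H5 & H6 & H7) & _).
    split; [exact B|]. split; [exact H3|]. split; [exact H4|]. split; [exact H5|].
    split; [assert (H8 := Mono k (S k) ltac:(lia)); lia|].
    split.
    { destruct k as [|k]; [specialize (HP0 O); lia|]. specialize (HP2 k). lia. }
    split; [exact H6|]. intros i Hi.
    destruct (All i) as (H1' & ((B' & Y') & H2' & H3' & H4' & H5' & _) & _).
    apply (H7 _ _ _ B'); [specialize (HP0 i); lia|]. specialize (Mono i k Hi). lia.
  - intros k. destruct (All k) as (H1 & HL & HPr).
    split; [exact HL|]. split; [split; auto|]. split; auto.
    destruct HL as (_ & _ & _ & _ & ? & _). specialize (HP2 k). lia.
Qed.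

(** The supremum may fail to be attained; an element within a factor 2 of it is enough. *)
Lemma near_sup (v : gam -> R) M g0 :
  (forall g, valid n g -> Rabs (v g) <= M) -> valid n g0 -> v g0 <> 0 ->
  exists eta, valid n eta /\ v eta <> 0 /\ forall g, valid n g -> Rabs (v g) <= 2 * Rabs (v eta).
Proof.
  intros HM V0 N0.
  destruct (completeness (fun r => exists g, valid n g /\ r = Rabs (v g))) as [s [U L]].
  - exists M. intros r (g & Vg & ->). auto.
  - exists (Rabs (v g0)), g0; auto.
  - assert (Hs : 0 < s).
    { apply Rlt_le_trans with (Rabs (v g0)); [now apply Rabs_pos_lt|]. apply U. eauto. }
    destruct (classic (exists eta, valid n eta /\ s / 2 < Rabs (v eta))) as [(eta & Ve & He)|N].
    + exists eta. split; [auto|split].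
      * intros E. rewrite E, Rabs_R0 in He. lra.
      * intros g Vg. assert (Rabs (v g) <= s) by (apply U; eauto). lra.
    + exfalso. assert (s <= s / 2); [|lra]. apply L. intros r (g & Vg & ->).
      apply Rnot_lt_le. intros H. apply N. eauto.
Qed.

(** * Normalised vectors and l1-averages in the span *)

Hypothesis HX : forall P0, exists k p q g,
  (P0 <= p <= q)%nat /\ Blk m n (X k) p q /\ valid n g /\ X k g <> 0.

Lemma X_InY k : InY (X k).
Proof.
  exists (S k), (fun i => if i =? k then 1 else 0). intros g.
  rewrite rsum_isum, (isum_single 0 (S k) k); try lia.
  - rewrite Nat.eqb_refl. ring.
  - intros i _ Hi. apply Nat.eqb_neq in Hi. rewrite Hi. ring.
Qed.

(** The bound 8 is the factor 4 of [leaf_exists] times the factor 2 of [near_sup]. *)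
Lemma bounded_vectors P0 : (3 <= P0)%nat -> exists x p q g,
  (P0 <= p)%nat /\ leafed x p q g /\ forall d, valid n d -> Rabs (x d) <= 8.
Proof.
  intros H3. destruct (HX P0) as (k & p & q & g0 & Hp & B & V0 & N0).
  destruct (Blk_bounded m n G _ _ _ B) as (M & _ & HM).
  destruct (near_sup (X k) M g0 HM V0 N0) as (eta & Ve & Ne & He).
  destruct (leaf_exists (X k) p q eta) as (g & Hg); auto; [split; [auto|apply X_InY]|lia|].
  exists (fun d => 4 / X k eta * X k d), p, q, g. split; [lia|split; auto].
  intros d Vd. specialize (He d Vd). unfold Rdiv. rewrite !Rabs_mult, Rabs_inv, (Rabs_pos_eq 4) by lra.
  assert (0 < Rabs (X k eta)) by now apply Rabs_pos_lt.
  apply Rmult_le_reg_r with (Rabs (X k eta)); auto.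
  replace (4 * / Rabs (X k eta) * Rabs (X k d) * Rabs (X k eta)) with (4 * Rabs (X k d)) by (field; lra).
  lra.
Qed.

(* If all normalised blocks [w] of length [N] satisfied [|sum w| <= N/4], then iterating [log2 (m q)]
   times would contradict the lower estimate given by the weight [m q]. *)
Lemma l1_averages N P0 : (1 <= N)%nat -> (3 <= P0)%nat ->
  exists (w : nat -> gam -> R) (A B : nat -> nat),
    (forall l, YB (w l) (A l) (B l) /\ (P0 <= A l <= B l)%nat /\ (B l < A (S l))%nat /\
       forall d, valid n d -> Rabs (w l d) <= 1) /\
    exists eta, valid n eta /\ INR N / 4 < Rabs (rsum N (fun l => w l eta)).
Proof.
  intros HN HP.
  destruct (leafed_sequence (fun _ _ x _ _ _ => forall d, valid n d -> Rabs (x d) <= 8) P0 HP)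
    as (x & P & Q & lf & P1 & Sp & Hx).
  { intros k P2 H2. destruct (bounded_vectors P2 ltac:(lia)) as (x & p & q & g & ?).
    exists x, p, q, g. auto. }
  apply NNPP. intros Contra.
  assert (NR : 0 < INR N) by (apply lt_0_INR; lia).
  assert (It : forall s a g, valid n g ->
     Rabs (isum a (a + N ^ s) (fun k => x k g)) <= 8 * (INR N / 4) ^ s).
  { induction s as [|s IH]; intros a g Vg.
    - simpl (N ^ 0)%nat. replace (a + 1)%nat with (S a) by lia. rewrite isum_S, isum_nil, Rplus_0_l.
      simpl. rewrite Rmult_1_r. now apply (Hx a).
    - set (c := 8 * (INR N / 4) ^ s). assert (Hc : 0 < c).
      { unfold c. apply Rmult_lt_0_compat; [lra|]. apply pow_lt. lra. }
      assert (Ns : (1 <= N ^ s)%nat) by (assert (H := Nat.pow_nonzero N s); lia).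
      (* Sums of length [N ^ s], divided by their inductive bound [c], are blocks of norm at most 1,
         so [Contra] applies to them and saves a factor 4 at every level. *)
      set (w := fun l g => isum (a + l * N ^ s) (a + S l * N ^ s) (fun k => / c * x k g)).
      assert (Hw : Rabs (rsum N (fun l => w l g)) <= INR N / 4).
      { apply Rnot_lt_le. intros Lt. apply Contra.
        exists w, (fun l => P (a + l * N ^ s)%nat), (fun l => Q (a + S l * N ^ s - 1)%nat).
        split; [|exists g; auto]. intros l.
        assert (E : (S l * N ^ s = l * N ^ s + N ^ s)%nat) by (simpl; lia).
        split.
        - apply (YB_isum x P Q (fun _ => / c)); [lia|]. intros k Hk.
          split; [apply (Hx k)|]. split.
          + apply (sp_P m n x P Q lf Sp); lia.
          + destruct (Nat.eq_dec k (a + S l * N ^ s - 1)) as [->|Ne]; auto.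
            assert (H1 := sp_lf_P m n x P Q lf Sp k (a + S l * N ^ s - 1) ltac:(lia)).
            destruct (Hx (a + S l * N ^ s - 1)%nat) as ((_&?&_)&_).
            destruct (Hx k) as ((_&_&_&_&?&_)&_). lia.
        - split; [|split].
          + destruct (Hx (a + l * N ^ s)%nat) as ((_&H1&_&_&H2&_)&H3&_).
            split; [lia|]. destruct (Nat.eq_dec (N ^ s) 1) as [E1|E1].
            * replace (a + S l * N ^ s - 1)%nat with (a + l * N ^ s)%nat by lia. auto.
            * assert (H4 := sp_P m n x P Q lf Sp (a + l * N ^ s) (a + S l * N ^ s - 1) ltac:(lia)).
              destruct (Hx (a + S l * N ^ s - 1)%nat) as ((_&H5&_)&_). lia.
          + assert (H1 := sp_lf_P m n x P Q lf Sp (a + S l * N ^ s - 1) (a + S l * N ^ s) ltac:(lia)).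
            destruct (Hx (a + S l * N ^ s - 1)%nat) as ((_&_&_&_&H2&_)&_). lia.
          + intros d Vd. unfold w. rewrite isum_scal, Rabs_mult, Rabs_pos_eq
              by (left; now apply Rinv_0_lt_compat).
            specialize (IH (a + l * N ^ s)%nat d Vd). fold c in IH.
            replace (a + S l * N ^ s)%nat with (a + l * N ^ s + N ^ s)%nat by lia.
            apply Rmult_le_reg_l with c; auto. rewrite <- Rmult_assoc, Rinv_r; lra. }
      replace (a + N ^ S s)%nat with (a + N * N ^ s)%nat by (simpl; lia).
      assert (E : isum a (a + N * N ^ s) (fun k => x k g) = c * rsum N (fun l => w l g)).
      { rewrite isum_blocks_const, !rsum_isum, <- isum_scal. apply isum_ext; [lia|].
        intros l _. unfold w. rewrite isum_scal. field. lra. }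
      rewrite E, Rabs_mult, (Rabs_pos_eq c) by lra.
      replace (8 * (INR N / 4) ^ S s) with (c * (INR N / 4)) by (unfold c; simpl; ring).
      apply Rmult_le_compat_l; lra. }
  (* [N <= n (N + 2)] and the growth condition give [N ^ L <= n q], so one node of weight [m q]
     covers all [N ^ L] vectors. *)
  set (q := S (N + 2)). set (L := Nat.log2 (m q)).
  assert (Mq := m_ge_pow4 m n G q ltac:(lia)).
  assert (Mq64 : (64 <= m q)%nat).
  { change 64%nat with (4 ^ 3)%nat. eapply Nat.le_trans; [|exact Mq]. apply Nat.pow_le_mono_r; lia. }
  destruct (Nat.log2_spec (m q) ltac:(lia)) as [HL1 HL2]. fold L in HL1, HL2.
  assert (HNn : (N <= n (N + 2))%nat).
  { assert (N <= 4 ^ (N + 2))%nat.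
    { assert (H := Nat.pow_gt_lin_r 4 (N + 2) ltac:(lia)). lia. }
    assert (H1 := m_ge_pow4 m n G (N + 2) ltac:(lia)). assert (H2 := m_le_n m n G (N + 2) ltac:(lia)). lia. }
  assert (Hnq : (N ^ L <= n q)%nat).
  { assert (H1 := n_growth m n G (N + 2) L ltac:(lia) HL1). fold q in H1.
    assert (H2 : (N ^ L <= (4 * n (N + 2)) ^ L)%nat) by (apply Nat.pow_le_mono_l; lia).
    assert (1 <= m q * m q)%nat by nia. nia. }
  assert (NL : (1 <= N ^ L)%nat) by (assert (H := Nat.pow_nonzero N L); lia).
  assert (Wf := inW_flat m n q 0 (N ^ L) (fun _ => true) ltac:(lia) ltac:(lia)).
  assert (Low := lower_estimate m n G x P Q lf Sp (fun _ => 1) _ (N ^ L) (8 * (INR N / 4) ^ L) Wf).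
  assert (Low2 := Low ltac:(intros g Vg; rewrite rsum_isum, (isum_ext 0 _ _ (fun k => x k g)) by (try lia; intros; ring); apply (It L 0%nat g Vg))). clear Low It Contra.
  rewrite rsum_isum, (isum_ext 0 (N ^ L) _ (fun _ => / INR (m q))) in Low2; [|lia|].
  2:{ intros k Hk. destruct (Nat.leb_spec 0 k); [|lia]. destruct (Nat.ltb_spec k (0 + N ^ L)); [|lia].
      simpl. ring. }
  assert (Hm := inv_m_bounds m n G q ltac:(lia)).
  rewrite isum_const, Rabs_pos_eq in Low2.
  2:{ simpl (INR 0). assert (0 <= INR (N ^ L)) by apply pos_INR. nra. }
  simpl (INR 0) in Low2. rewrite Rminus_0_r, pow_INR in Low2.
  unfold Rdiv at 2 in Low2. rewrite Rpow_mult_distr in Low2.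
  assert (HNL : 0 < INR N ^ L) by now apply pow_lt.
  assert (Hmq : 0 < INR (m q)) by (apply lt_0_INR; lia).
  assert (H4 : 0 < 4 ^ L) by (apply pow_lt; lra).
  rewrite pow_inv in Low2.
  (* From [N^L / m_q <= 4/3 * 8 * (N/4)^L]. On the other hand [m_q < 2^(L+1)] gives
     [m_q^2 < 4 * 4^L]; together [m_q < 128/3], contradicting [64 <= m q]. *)
  assert (Key : 4 ^ L <= 32/3 * INR (m q)).
  { apply Rmult_le_reg_l with (INR N ^ L * / 4 ^ L * / INR (m q)).
    - repeat apply Rmult_lt_0_compat; auto; apply Rinv_0_lt_compat; auto.
    - replace (INR N ^ L * / 4 ^ L * / INR (m q) * 4 ^ L) with (/ INR (m q) * INR N ^ L) by (field; lra).
      replace (INR N ^ L * / 4 ^ L * / INR (m q) * (32 / 3 * INR (m q)))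
        with (4 / 3 * (8 * (INR N ^ L * / 4 ^ L))) by (field; lra).
      exact Low2. }
  assert (K2 : INR (m q) * INR (m q) < 4 * 4 ^ L).
  { replace (4 * 4 ^ L) with (INR (2 ^ S L) * INR (2 ^ S L)).
    - apply lt_INR in HL2. nra.
    - rewrite !pow_INR. simpl. replace (1 + 1) with 2 by ring.
      replace 4 with (2 * 2) at 2 by ring. rewrite Rpow_mult_distr. ring. }
  apply le_INR in Mq64. simpl in Mq64. nra.
Qed.

End Span.

(** * Tree analysis of the evaluation functionals *)

(* [child A B g]: the functional through which [e*_g] acts on vectors with range in [[A, B]];
   [None] when the range is cut by, or lies beyond, the nodes of [g]. *)
Fixpoint child (A B : nat) (g : gam) : option gam :=
  match g with
  | G1 => None
  | Gf r _ _ eta => if B <? r then Some eta else None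
  | Gn r xi _ _ eta =>
      if B <=? rank xi then child A B xi
      else if andb (rank xi <? A) (B <? r) then Some eta else None
  end.

(* The weights met when descending from [g] along [child]. *)
Fixpoint path (A B : nat) (g : gam) : list nat :=
  match g with
  | G1 => []
  | Gf r j _ eta => j :: (if B <? r then path A B eta else [])
  | Gn r xi j _ eta =>
      if B <=? rank xi then path A B xi
      else j :: (if andb (rank xi <? A) (B <? r) then path A B eta else [])
  end.

Lemma path_child n A B g : valid n g -> (1 <= widx g)%nat ->
  path A B g = widx g :: match child A B g with Some eta => path A B eta | None => [] end.
Proof.
  induction g as [|r j s eta IHe|r xi IHx j s eta IHe]; intros V H; simpl in H; [lia| |].
  - simpl. destruct (B <? r); auto.
  - simpl in V. simpl. destruct (B <=? rank xi).
    + rewrite IHx by intuition lia. f_equal. tauto.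
    + destruct (andb (rank xi <? A) (B <? r)); auto.
Qed.

Lemma valid_age_le m n g : growth m n -> valid n g -> (1 <= widx g)%nat -> (age g <= n (widx g))%nat.
Proof.
  intros G. destruct g as [|r j s eta|r xi j s eta]; simpl; intros V H; try lia.
  assert (H4 := n_ge4 m n G j H). lia.
Qed.

(** An entry [(e, a1, c1)] stands for a child [e] together with the indices [a1, c1) of the vectors
    it reads. *)
Fixpoint pieces (a c : nat) (l : list (gam * nat * nat)) : Prop :=
  match l with
  | [] => (a <= c)%nat
  | (_, a1, c1) :: l' => (a <= a1 <= c1)%nat /\ pieces c1 c l'
  end.

Definition psum (l : list (gam * nat * nat)) (f : gam -> nat -> R) : R :=
  fold_right (fun t acc => isum (snd (fst t)) (snd t) (f (fst (fst t))) + acc) 0 l.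

Lemma pieces_le a c l : pieces a c l -> (a <= c)%nat.
Proof.
  revert a; induction l as [|[[e a1] c1] l IH]; simpl; auto. intros a [H1 H2]. apply IH in H2. lia.
Qed.

Lemma pieces_snoc a c c' l e a1 c1 :
  pieces a c l -> (c <= a1 <= c1)%nat -> (c1 <= c')%nat -> pieces a c' (l ++ [(e, a1, c1)]).
Proof.
  revert a; induction l as [|[[e' a2] c2] l IH]; simpl; intros a H1 H2 H3.
  - split; lia.
  - destruct H1 as [H1 H4]. split; [lia|]. apply IH; auto.
Qed.

Lemma psum_app l l' f : psum (l ++ l') f = psum l f + psum l' f.
Proof. induction l as [|t l IH]; unfold psum in *; simpl; [ring|rewrite IH; ring]. Qed.

Lemma psum_le_isum a c l f :
  pieces a c l -> (forall k, (a <= k < c)%nat -> 0 <= f k) ->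
  psum l (fun _ => f) <= isum a c f.
Proof.
  revert a; induction l as [|[[e a1] c1] l IH]; intros a H Hf; unfold psum in *; simpl in *.
  - now apply isum_nonneg.
  - destruct H as [H1 H2]. assert (H3 := pieces_le _ _ _ H2).
    specialize (IH c1 H2 ltac:(intros; apply Hf; lia)).
    rewrite <- (isum_chasles a c1 c).
    assert (isum a1 c1 f <= isum a c1 f) by (apply isum_sub_le; try lia; intros; apply Hf; lia).
    lra.
Qed.

Lemma psum_le l f h e :
  (forall t, In t l -> isum (snd (fst t)) (snd t) (f (fst (fst t))) <=
     isum (snd (fst t)) (snd t) (h (fst (fst t))) + e) ->
  psum l f <= psum l h + INR (length l) * e.
Proof.
  induction l as [|t l IH]; intros H; unfold psum in *.
  - simpl; lra.
  - cbn [fold_right length]. rewrite S_INR. assert (H1 := H t (or_introl eq_refl)).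
    specialize (IH ltac:(intros; apply H; right; auto)). lra.
Qed.

Section Tree.
Variables (A B : nat -> nat).
Hypothesis AB : forall k, (A k <= B k)%nat /\ (B k < A (S k))%nat.

Lemma AB_lt i k : (i < k)%nat -> (B i < A k)%nat.
Proof.
  induction 1 as [|k H IH]; [apply AB|]. destruct (AB k). lia.
Qed.

(** The ranges are disjoint, so one rank cuts at most one of them. The two thresholds serve both
    kinds of boundary: [S (rank xi)] and [rank xi] at a link, [r] and [r] at the top of a node. *)
Lemma split_exists r1 r2 a c : (r2 <= r1)%nat -> (a <= c)%nat ->
  exists c1 c2, (a <= c1 <= c2)%nat /\ (c2 <= c)%nat /\ (c2 <= S c1)%nat /\
    (forall k, (a <= k < c1)%nat -> (B k < r1)%nat) /\
    (forall k, (c1 <= k < c2)%nat -> (r1 <= B k)%nat /\ (A k <= r2)%nat) /\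
    (forall k, (c2 <= k < c)%nat -> (r2 < A k)%nat).
Proof.
  intros Hr H.
  destruct (cut_exists (fun k => (r1 <= B k)%nat) a c H) as (e & He & N1 & N2).
  { intros k Hk. destruct (AB k), (AB (S k)). lia. }
  destruct (le_lt_dec c e) as [L|L].
  - exists e, e. repeat split; try lia. intros k Hk. specialize (N1 k ltac:(lia)). lia.
  - assert (He2 := N2 e ltac:(lia) L).
    exists e, (if le_lt_dec (A e) r2 then S e else e).
    destruct (le_lt_dec (A e) r2) as [L'|L']; repeat split; try lia;
      try (intros k Hk; specialize (N1 k ltac:(lia)); lia).
    + assert (k = e) by lia. now subst.
    + assert (k = e) by lia. now subst.
    + intros k Hk. assert (H1 := AB_lt e k ltac:(lia)). lia.
    + intros k Hk. destruct (Nat.eq_dec k e); [now subst|].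
      assert (H1 := AB_lt e k ltac:(lia)). lia.
Qed.

Variable n : nat -> nat.

(** Every link has at most two boundaries, at [rank xi] and at [r], each cutting at most one vector;
    hence the factor [2 * age g]. The pieces do not depend on [f]; when [f] is nonpositive at the
    cut indices, [C = 0] gives a bound without error. *)
Lemma tree_decomposition g : valid n g -> (1 <= widx g)%nat -> forall a c, (a <= c)%nat ->
  exists l, (length l <= age g)%nat /\ pieces a c l /\
    (forall e a1 c1, In (e, a1, c1) l -> valid n e /\ (rank e < rank g)%nat /\
       (a <= a1 <= c1)%nat /\ (c1 <= c)%nat /\
       forall k, (a1 <= k < c1)%nat -> child (A k) (B k) g = Some e) /\
    forall (f : nat -> R) C, 0 <= C ->
      (forall k, (a <= k < c)%nat -> child (A k) (B k) g = None -> f k <= C) ->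
      (forall k, (a <= k < c)%nat -> child (A k) (B k) g = None -> (rank g < A k)%nat -> f k <= 0) ->
      isum a c f <= psum l (fun _ => f) + 2 * INR (age g) * C.
Proof.
  induction g as [|r j s eta IHe|r xi IHx j s eta IHe]; intros V W a c Hac; simpl in W; [lia| |].
  - simpl in V.
    destruct (split_exists r r a c ltac:(lia) Hac) as (c1 & c2 & H1 & H2 & H3 & S1 & S2 & S3).
    exists [(eta, a, c1)]. split; [simpl; lia|]. split; [simpl; lia|]. split.
    + intros e a1 c1' [E|[]]. injection E as <- <- <-.
      split; [tauto|]. split; [simpl; lia|]. split; [lia|]. split; [lia|].
      intros k Hk. specialize (S1 k Hk). simpl. destruct (Nat.ltb_spec (B k) r); [auto|lia].
    + intros f C HC F1 F2. unfold psum; simpl.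
      rewrite <- (isum_chasles a c1 c), <- (isum_chasles c1 c2 c).
      assert (isum c1 c2 f <= C * (INR c2 - INR c1)).
      { apply isum_bound; [lia|]. intros k Hk. specialize (S2 k Hk). apply F1; [lia|].
        simpl. destruct (Nat.ltb_spec (B k) r); [lia|auto]. }
      assert (INR c2 - INR c1 <= 1) by (apply le_INR in H3; rewrite S_INR in H3; lra).
      assert (isum c2 c f <= 0 * (INR c - INR c2)).
      { apply isum_bound; [lia|]. intros k Hk. specialize (S3 k Hk). destruct (AB k). apply F2; [lia| |simpl; lia].
        simpl. destruct (Nat.ltb_spec (B k) r); [lia|auto]. }
      nra.
  - simpl in V. destruct V as (Vx & Ve & V1 & V2 & V3 & V4 & V5 & V6 & V7 & V8).
    destruct (split_exists (S (rank xi)) (rank xi) a c ltac:(lia) Hac)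
      as (c1 & c2 & H1 & H2 & H3 & S1 & S2 & S3).
    destruct (split_exists r r c2 c ltac:(lia) ltac:(lia)) as (d1 & d2 & H4 & H5 & H6 & T1 & T2 & T3).
    destruct (IHx Vx ltac:(lia) a c1 ltac:(lia)) as (l & L & Pc & Ch & Su).
    assert (Old : forall k, (a <= k < c1)%nat -> child (A k) (B k) (Gn r xi j s eta) = child (A k) (B k) xi).
    { intros k Hk. specialize (S1 k Hk). simpl. destruct (Nat.leb_spec (B k) (rank xi)); [auto|lia]. }
    exists (l ++ [(eta, c2, d1)]). split; [rewrite length_app; simpl; lia|].
    split; [apply (pieces_snoc a c1); auto; lia|]. split.
    + intros e a1 c1' Hin. apply in_app_iff in Hin. destruct Hin as [Hin|[E|[]]].
      * destruct (Ch e a1 c1' Hin) as (C1 & C2 & C3 & C4 & C5).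
        split; [auto|]. split; [simpl; lia|]. split; [lia|]. split; [lia|].
        intros k Hk. rewrite Old by lia. auto.
      * injection E as <- <- <-.
        split; [auto|]. split; [simpl; lia|]. split; [lia|]. split; [lia|].
        intros k Hk. specialize (T1 k Hk). specialize (S3 k ltac:(lia)). destruct (AB k). simpl.
        destruct (Nat.leb_spec (B k) (rank xi)); [lia|].
        destruct (Nat.ltb_spec (rank xi) (A k)); [|lia].
        destruct (Nat.ltb_spec (B k) r); [auto|lia].
    + intros f C HC F1 F2. rewrite psum_app.
      assert (Su' := Su f C HC
        ltac:(intros k Hk Hc; apply F1; [lia|now rewrite Old])
        ltac:(intros k Hk _ Hr; specialize (S1 k Hk); destruct (AB k); lia)).
      unfold psum at 2. simpl fold_right. rewrite Rplus_0_r.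
      rewrite <- (isum_chasles a c1 c), <- (isum_chasles c1 c2 c), <- (isum_chasles c2 d1 c), <- (isum_chasles d1 d2 c).
      assert (isum c1 c2 f <= C * (INR c2 - INR c1)).
      { apply isum_bound; [lia|]. intros k Hk. specialize (S2 k Hk). apply F1; [lia|].
        simpl. destruct (Nat.leb_spec (B k) (rank xi)); [lia|].
        destruct (Nat.ltb_spec (rank xi) (A k)); [lia|auto]. }
      assert (isum d1 d2 f <= C * (INR d2 - INR d1)).
      { apply isum_bound; [lia|]. intros k Hk. specialize (T2 k Hk). apply F1; [lia|].
        simpl. destruct (Nat.leb_spec (B k) (rank xi)); [lia|].
        destruct (Nat.ltb_spec (B k) r); [lia|]. now rewrite andb_false_r. }
      assert (isum d2 c f <= 0 * (INR c - INR d2)).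
      { apply isum_bound; [lia|]. intros k Hk. specialize (T3 k Hk). destruct (AB k). apply F2; [lia| |simpl; lia].
        simpl. destruct (Nat.leb_spec (B k) (rank xi)); [lia|].
        destruct (Nat.ltb_spec (B k) r); [lia|]. now rewrite andb_false_r. }
      assert (INR c2 - INR c1 <= 1) by (apply le_INR in H3; rewrite S_INR in H3; lra).
      assert (INR d2 - INR d1 <= 1) by (apply le_INR in H6; rewrite S_INR in H6; lra).
      change (age (Gn r xi j s eta)) with (S (age xi)). rewrite S_INR. simpl snd. simpl fst. nra.
Qed.

(** * Recursive error bounds over trees *)

Variable m : nat -> nat.
Hypothesis G : growth m n.
Variables (phi h : nat -> gam -> R).

(** One step of the recursion. The main term [h] is compatible with the weights and passes through
    the node unchanged; the error proportional to the length is multiplied by the weight, whereas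
    the constant error is paid once per child, together with the two cut vectors. *)
Lemma node_bound g C al M a c :
  valid n g -> (1 <= widx g)%nat -> (a <= c)%nat -> 0 <= C -> 0 <= al -> 0 <= M ->
  (forall k, (a <= k < c)%nat -> phi k g <= C) ->
  (forall k, (a <= k < c)%nat -> (rank g < A k)%nat -> phi k g <= 0) ->
  (forall k e, (a <= k < c)%nat -> child (A k) (B k) g = Some e ->
     phi k g <= / INR (m (widx g)) * phi k e /\ / INR (m (widx g)) * h k e <= h k g) ->
  (forall k, (a <= k < c)%nat -> 0 <= h k g) ->
  (forall e a' c', valid n e -> (a <= a' <= c')%nat -> (c' <= c)%nat ->
     isum a' c' (fun k => phi k e) <= isum a' c' (fun k => h k e) + al * (INR c' - INR a') + M) ->
  isum a c (fun k => phi k g) <= isum a c (fun k => h k g)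
    + / INR (m (widx g)) * al * (INR c - INR a)
    + INR (age g) * (/ INR (m (widx g)) * M + 2 * C).
Proof.
  intros V W Hac HC Hal HM F1 F2 F3 F4 F5.
  destruct (tree_decomposition g V W a c Hac) as (l & L & Pc & Ch & Su).
  specialize (Su (fun k => phi k g) C HC (fun k Hk _ => F1 k Hk) (fun k Hk _ Hr => F2 k Hk Hr)).
  assert (Hm := inv_m_bounds m n G (widx g) W).
  set (mu := / INR (m (widx g))) in *.
  assert (H1 : psum l (fun _ k => phi k g) <=
     psum l (fun _ k => h k g + mu * al * 1) + INR (length l) * (mu * M)).
  { apply psum_le. intros [[e a1] c1] Hin. simpl.
    destruct (Ch e a1 c1 Hin) as (C1 & C2 & C3 & C4 & C5).
    rewrite isum_plus, isum_scal, isum_const.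
    assert (E1 : isum a1 c1 (fun k => phi k g) <= mu * isum a1 c1 (fun k => phi k e)).
    { rewrite <- isum_scal. apply isum_le; [lia|]. intros k Hk.
      apply (F3 k e); [lia|]. now apply C5. }
    assert (E2 : mu * isum a1 c1 (fun k => h k e) <= isum a1 c1 (fun k => h k g)).
    { rewrite <- isum_scal. apply isum_le; [lia|]. intros k Hk.
      apply (F3 k e); [lia|]. now apply C5. }
    specialize (F5 e a1 c1 C1 C3 C4).
    assert (E3 : mu * isum a1 c1 (fun k => phi k e) <=
       mu * (isum a1 c1 (fun k => h k e) + al * (INR c1 - INR a1) + M)) by (apply Rmult_le_compat_l; lra).
    lra. }
  assert (H2 := psum_le_isum a c l (fun k => h k g + mu * al * 1) Pc).
  cbv beta in H2. rewrite isum_plus, isum_scal, isum_const in H2.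
  assert (H3 : psum l (fun _ k => h k g + mu * al * 1) <=
     isum a c (fun k => h k g) + mu * al * (1 * (INR c - INR a))).
  { apply H2. intros k Hk. specialize (F4 k Hk). assert (0 <= mu * al) by (apply Rmult_le_pos; lra). lra. }
  assert (H4 : INR (length l) * (mu * M) <= INR (age g) * (mu * M)).
  { apply Rmult_le_compat_r; [apply Rmult_le_pos; lra|]. now apply le_INR. }
  lra.
Qed.

Variables (q a0 c0 : nat) (C : R).
Hypothesis Hq : (2 <= q)%nat.
Hypothesis HC : 0 <= C.
Hypothesis HA : forall k, (a0 <= k < c0)%nat -> (2 <= A k)%nat.
Hypothesis phi_le : forall k g, (a0 <= k < c0)%nat -> valid n g -> phi k g <= C.
Hypothesis phi_low : forall k g, (a0 <= k < c0)%nat -> valid n g -> (widx g < q)%nat ->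
  (rank g < A k)%nat -> phi k g <= 0.
Hypothesis h_pos : forall k g, (a0 <= k < c0)%nat -> valid n g -> 0 <= h k g.
Hypothesis phi_child : forall k g e, (a0 <= k < c0)%nat -> valid n g -> (1 <= widx g < q)%nat ->
  child (A k) (B k) g = Some e ->
  phi k g <= / INR (m (widx g)) * phi k e /\ / INR (m (widx g)) * h k e <= h k g.
Hypothesis phi_stop : forall g a c, valid n g -> (q <= widx g)%nat -> (a0 <= a <= c)%nat -> (c <= c0)%nat ->
  isum a c (fun k => phi k g) <= isum a c (fun k => h k g) + C.

Lemma depth_bound D : forall g a c, valid n g -> (a0 <= a <= c)%nat -> (c <= c0)%nat ->
  isum a c (fun k => phi k g) <= isum a c (fun k => h k g)
    + C * (/4) ^ D * (INR c - INR a) + C * INR ((4 * n (q - 1)) ^ D).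
Proof.
  induction D as [|D IH]; intros g a c V Ha Hc.
  - simpl. assert (H1 : isum a c (fun k => phi k g) <= C * (INR c - INR a)).
    { apply isum_bound; [lia|]. intros; apply phi_le; auto; lia. }
    assert (0 <= isum a c (fun k => h k g)) by (apply isum_nonneg; [lia|]; intros; apply h_pos; auto; lia).
    lra.
  - assert (Hn := n_ge4 m n G (q - 1) ltac:(lia)).
    assert (Hca : 0 <= INR c - INR a) by (assert (INR a <= INR c) by (apply le_INR; lia); lra).
    assert (Hp : 1 <= INR ((4 * n (q - 1)) ^ D)).
    { apply (le_INR 1). assert (H := Nat.pow_nonzero (4 * n (q - 1)) D). lia. }
    assert (Hp' : INR ((4 * n (q - 1)) ^ S D) = 4 * INR (n (q - 1)) * INR ((4 * n (q - 1)) ^ D)).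
    { cbn [Nat.pow]. rewrite !mult_INR. simpl (INR 4). ring. }
    assert (HnR : 4 <= INR (n (q - 1))) by (apply le_INR in Hn; simpl in Hn; lra).
    assert (Hpow : 0 <= (/4) ^ D) by (apply pow_le; lra).
    assert (HCp : 0 <= C * (/4) ^ D) by (apply Rmult_le_pos; auto).
    assert (Herr : 0 <= C * (/4) ^ S D * (INR c - INR a)).
    { apply Rmult_le_pos; auto. apply Rmult_le_pos; auto. apply pow_le; lra. }
    destruct (le_lt_dec q (widx g)) as [Lq|Lq].
    + specialize (phi_stop g a c V Lq Ha Hc).
      assert (C * 1 <= C * INR ((4 * n (q - 1)) ^ S D)).
      { apply Rmult_le_compat_l; auto. rewrite Hp'. nra. }
      lra.
    + destruct (le_lt_dec 1 (widx g)) as [L1|L1].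
      * assert (Hm := inv_m_bounds m n G (widx g) L1).
        assert (NB := node_bound g C (C * (/4) ^ D) (C * INR ((4 * n (q - 1)) ^ D)) a c V L1 ltac:(lia) HC HCp
          ltac:(apply Rmult_le_pos; lra)
          ltac:(intros; apply phi_le; auto; lia) ltac:(intros; apply phi_low; auto; lia)
          ltac:(intros; apply phi_child; auto; lia) ltac:(intros; apply h_pos; auto; lia)
          ltac:(intros; apply IH; auto; lia)).
        eapply Rle_trans; [exact NB|].
        assert (E1 : / INR (m (widx g)) * (C * (/4) ^ D) * (INR c - INR a) <= C * (/4) ^ S D * (INR c - INR a)).
        { apply Rmult_le_compat_r; auto. simpl. nra. }
        assert (Hage : INR (age g) <= INR (n (q - 1))).
        { apply le_INR. assert (H1 := valid_age_le m n g G V L1).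
          assert (H2 := n_mono m n G (widx g) (q - 1) L1 ltac:(lia)). lia. }
        assert (E2 : / INR (m (widx g)) * (C * INR ((4 * n (q - 1)) ^ D)) + 2 * C
                     <= 4 * (C * INR ((4 * n (q - 1)) ^ D))).
        { set (T := INR ((4 * n (q - 1)) ^ D)) in *. assert (C * 1 <= C * T) by (apply Rmult_le_compat_l; lra). nra. }
        assert (E3 : INR (age g) * (/ INR (m (widx g)) * (C * INR ((4 * n (q - 1)) ^ D)) + 2 * C)
            <= INR (n (q - 1)) * (4 * (C * INR ((4 * n (q - 1)) ^ D)))).
        { apply Rmult_le_compat; auto; [apply pos_INR|].
          apply Rplus_le_le_0_compat; [|lra]. apply Rmult_le_pos; [lra|]. apply Rmult_le_pos; lra. }
        rewrite Hp'. lra.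
      * assert (H0 : isum a c (fun k => phi k g) <= 0 * (INR c - INR a)).
        { apply isum_bound; [lia|]. intros k Hk. apply phi_low; auto; [lia|].
          assert (HAk := HA k ltac:(lia)). destruct g; simpl in *; try lia. }
        assert (0 <= isum a c (fun k => h k g)) by (apply isum_nonneg; [lia|]; intros; apply h_pos; auto; lia).
        assert (0 <= C * INR ((4 * n (q - 1)) ^ S D)) by (apply Rmult_le_pos; [auto|apply pos_INR]).
        lra.
Qed.

(** Depth [L], the integer part of [log2 (m q)], is where the growth condition enters:
    [4^-L <= 4 / m_q^2] and [(4 n_(q-1))^L <= n_q / m_q^2]. Hence 5 = 4 + 1. *)
Lemma tree_bound g a c : valid n g -> (a0 <= a <= c)%nat -> (c <= c0)%nat -> (c - a <= n q)%nat ->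
  isum a c (fun k => phi k g) <= isum a c (fun k => h k g)
    + 5 * C * INR (n q) * (/ INR (m q) * / INR (m q)).
Proof.
  intros V Ha Hc Hn.
  assert (Hm4 := m_ge4 m n G q ltac:(lia)).
  destruct (Nat.log2_spec (m q) ltac:(lia)) as [HL1 HL2].
  set (L := Nat.log2 (m q)) in *.
  assert (DB := depth_bound L g a c V Ha Hc).
  assert (Hmq : 4 <= INR (m q)) by (apply Rm_ge4 with n; auto; lia).
  assert (Hgr : (m q * m q * (4 * n (q - 1)) ^ L <= n q)%nat).
  { replace q with (S (q - 1)) at 1 2 4 by lia. apply (n_growth m n G (q - 1) L); [lia|].
    now replace (S (q - 1)) with q by lia. }
  apply le_INR in Hgr. rewrite (mult_INR (m q * m q)), (mult_INR (m q) (m q)) in Hgr.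
  assert (Hi : 0 < / INR (m q)) by (apply Rinv_0_lt_compat; lra).
  set (mu := / INR (m q)) in *.
  assert (Hmu : mu * INR (m q) = 1) by (unfold mu; apply Rinv_l; lra).
  assert (E1 : INR ((4 * n (q - 1)) ^ L) <= INR (n q) * (mu * mu)).
  { replace (INR ((4 * n (q - 1)) ^ L))
      with (INR (m q) * INR (m q) * INR ((4 * n (q - 1)) ^ L) * (mu * mu)).
    - apply Rmult_le_compat_r; auto. nra.
    - replace (INR (m q) * INR (m q) * INR ((4 * n (q - 1)) ^ L) * (mu * mu))
        with ((mu * INR (m q)) * (mu * INR (m q)) * INR ((4 * n (q - 1)) ^ L)) by ring.
      rewrite Hmu. ring. }
  assert (E2 : (/4) ^ L <= 4 * (mu * mu)).
  { apply lt_INR in HL2. rewrite pow_INR in HL2. simpl in HL2. replace (1 + 1) with 2 in HL2 by ring.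
    assert (H4 : 0 < (/4) ^ L) by (apply pow_lt; lra).
    assert (H2 : 0 < 2 ^ L) by (apply pow_lt; lra).
    assert (E : 2 ^ L * 2 ^ L * (/4) ^ L = 1).
    { rewrite <- !Rpow_mult_distr. replace (2 * 2 * / 4) with 1 by field. apply pow1. }
    assert (K : INR (m q) * INR (m q) * (/4) ^ L <= 4).
    { apply Rle_trans with (2 * 2 ^ L * (2 * 2 ^ L) * (/4) ^ L); [|nra].
      apply Rmult_le_compat_r; [lra|]. nra. }
    replace ((/4) ^ L) with (INR (m q) * INR (m q) * (/4) ^ L * (mu * mu)).
    - apply Rmult_le_compat_r; auto. nra.
    - replace (INR (m q) * INR (m q) * (/4) ^ L * (mu * mu))
        with ((mu * INR (m q)) * (mu * INR (m q)) * (/4) ^ L) by ring.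
      rewrite Hmu. ring. }
  assert (E3 : INR c - INR a <= INR (n q)).
  { rewrite <- minus_INR by lia. now apply le_INR. }
  assert (E4 : 0 <= INR c - INR a) by (assert (INR a <= INR c) by (apply le_INR; lia); lra).
  assert (E5 : C * (/4) ^ L * (INR c - INR a) <= C * (4 * (mu * mu)) * INR (n q)).
  { apply Rmult_le_compat; auto.
    - apply Rmult_le_pos; auto. apply pow_le; lra.
    - apply Rmult_le_compat_l; auto. }
  assert (E6 : C * INR ((4 * n (q - 1)) ^ L) <= C * (INR (n q) * (mu * mu))).
  { apply Rmult_le_compat_l; auto. }
  lra.
Qed.

End Tree.

(** * Rapidly increasing sequences and their averages *)

(** The product of the weights above the first node of weight [m p]: the main term of an evaluation
    on a weight-[m p] average of a rapidly increasing sequence. Paths that meet a larger weight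
    first, or never meet [p], only enter the error [O(1/m_p)]. *)
Fixpoint Gl (m : nat -> nat) (p : nat) (l : list nat) : R :=
  match l with
  | [] => 0
  | j :: l' => if j =? p then 1 else if j <? p then / INR (m j) * Gl m p l' else 0
  end.

Lemma Gl_bounds m n p l : growth m n -> Forall (fun j => (1 <= j)%nat) l -> 0 <= Gl m p l <= 1.
Proof.
  intros G F; induction F as [|j l Hj F IH]; simpl; [lra|].
  assert (Hm := inv_m_bounds m n G j Hj).
  destruct (j =? p); [lra|]. destruct (j <? p); [nra|lra].
Qed.

Lemma path_weights n A B g : valid n g -> Forall (fun j => (1 <= j)%nat) (path A B g).
Proof.
  induction g as [|r j s eta IHe|r xi IHx j s eta IHe]; intros V; simpl in *; [constructor| |].
  - constructor; [lia|]. destruct (B <? r); [apply IHe; tauto|constructor].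
  - destruct (B <=? rank xi); [apply IHx; tauto|]. constructor; [lia|].
    destruct (andb (rank xi <? A) (B <? r)); [apply IHe; tauto|constructor].
Qed.

Lemma child_valid n A B g e : valid n g -> child A B g = Some e -> valid n e.
Proof.
  induction g as [|r j s eta IHe|r xi IHx j s eta IHe]; simpl; intros V E; [discriminate| |].
  - destruct (B <? r); [injection E as <-; tauto|discriminate].
  - destruct (B <=? rank xi); [apply IHx; tauto|].
    destruct (andb (rank xi <? A) (B <? r)); [injection E as <-; tauto|discriminate].
Qed.

(** A weight of index [j] occurs only from rank [j] on, so even the first link of [g] lies beyond
    [B], and the whole range falls to the first child. *)
Lemma child_early n A B g : valid n g -> (B < widx g)%nat -> exists e, child A B g = Some e.
Proof.
  induction g as [|r j s eta IHe|r xi IHx j s eta IHe]; simpl; intros V E; [lia| |].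
  - destruct (Nat.ltb_spec B r); [eauto|lia].
  - destruct (Nat.leb_spec B (rank xi)); [|lia]. apply IHx; [tauto|lia].
Qed.

Lemma exists_above_mean N f : (1 <= N)%nat -> exists l, (l < N)%nat /\ rsum N f <= INR N * f l.
Proof.
  intros HN. apply NNPP. intros C.
  assert (H : forall l, (l < N)%nat -> INR N * f l < rsum N f).
  { intros l Hl. apply Rnot_le_lt. intros L. apply C. eauto. }
  assert (NR : 1 <= INR N) by (apply (le_INR 1); lia).
  assert (S : isum 0 N (fun l => INR N * f l) < INR N * rsum N f).
  { clear C. set (T := rsum N f) in *. clearbody T.
    assert (K : forall M, (1 <= M <= N)%nat -> isum 0 M (fun l => INR N * f l) < INR M * T).
    { intros M HM. destruct HM as [HM1 HM2]. induction HM1 as [|M HM1 IH].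
      - rewrite isum_S, isum_nil. simpl (INR 1). specialize (H 0%nat ltac:(lia)). lra.
      - rewrite isum_S, S_INR. specialize (H M ltac:(lia)). specialize (IH ltac:(lia)). lra. }
    apply K; lia. }
  rewrite isum_scal, <- rsum_isum in S. lra.
Qed.

Section Averages.
Variables (m n : nat -> nat).
Hypothesis G : growth m n.

Lemma eval_child x A B g e :
  Blk m n x A B -> valid n g -> child A B g = Some e ->
  Rabs (x g) = / INR (m (widx g)) * Rabs (x e).
Proof.
  intros HB. induction g as [|r j s eta IHe|r xi IHx j s eta IHe]; intros V E.
  - discriminate.
  - simpl in E. destruct (Nat.ltb_spec B r); [injection E as <-|discriminate].
    rewrite (eval_Gf m n x A B) by auto. simpl in V. simpl widx. apply (sgn_div_abs m n); auto; lia.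
  - assert (V' := V). simpl in V. simpl in E. destruct (Nat.leb_spec B (rank xi)).
    + rewrite (eval_Gn_old m n x A B) by auto. rewrite IHx by tauto.
      simpl. replace (widx xi) with j by (symmetry; tauto). reflexivity.
    + destruct (Nat.ltb_spec (rank xi) A); [|discriminate].
      destruct (Nat.ltb_spec B r); [injection E as <-|discriminate].
      rewrite (eval_Gn_new m n x A B) by auto. simpl widx. apply (sgn_div_abs m n); auto; lia.
Qed.

Variable X : nat -> gam -> R.
Hypothesis HX : forall P0, exists k p q g,
  (P0 <= p <= q)%nat /\ Blk m n (X k) p q /\ valid n g /\ X k g <> 0.

(** Weight indices from [P0] on are unconstrained: beyond the range [child_early] takes over, and in
    a sequence an index between threshold and end of range concerns one vector only. The constant is
    16 * 3: normalisation costs 4 / (1/4), and 3 = 1 + 2 counts the children and the cut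
    summands. *)
Definition ris (P0 : nat) (x : gam -> R) : Prop :=
  (forall d, valid n d -> Rabs (x d) <= 48) /\
  (forall d, valid n d -> (1 <= widx d < P0)%nat -> Rabs (x d) <= 48 * / INR (m (widx d))).

Lemma ris_vectors P0 : (3 <= P0)%nat -> exists x p q g,
  (P0 <= p)%nat /\ leafed m n X x p q g /\ ris P0 x.
Proof.
  (* With [n (S P0)] summands, the at most [2 * age d] summands cut by a node of weight [m j],
     [j < P0], form a fraction at most [2 / m_j] of the average. *)
  intros HP. set (N := n (S P0)).
  assert (HN4 : (4 <= N)%nat) by (apply n_ge4 with m; auto; lia).
  destruct (l1_averages m n G X HX N P0 ltac:(lia) HP) as (w & A & B & Hw & eta & Ve & He).
  assert (AB : forall k, (A k <= B k)%nat /\ (B k < A (S k))%nat).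
  { intros k. destruct (Hw k) as (_ & ? & ? & _). lia. }
  set (u := fun d => isum 0 N (fun l => / INR N * w l d)).
  assert (NR : 4 <= INR N) by (apply le_INR in HN4; simpl in HN4; lra).
  assert (Ni : 0 < / INR N) by (apply Rinv_0_lt_compat; lra).
  assert (NN : / INR N * INR N = 1) by (apply Rinv_l; lra).
  assert (HY : YB m n X u (A O) (B (N - 1)%nat)).
  { apply (YB_isum m n X w A B (fun _ => / INR N)); [lia|]. intros k Hk. destruct (Hw k) as (H1 & _).
    split; [exact H1|]. split.
    - destruct k as [|k]; auto. assert (H2 := AB_lt A B AB 0 (S k) ltac:(lia)). destruct (AB O). lia.
    - destruct (Nat.eq_dec k (N - 1)) as [->|Ne]; auto.
      assert (H2 := AB_lt A B AB k (N - 1) ltac:(lia)). destruct (AB (N - 1)%nat). lia. }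
  assert (Hu : forall d, Rabs (u d) <= / INR N * isum 0 N (fun l => Rabs (w l d))).
  { intros d. unfold u. rewrite isum_scal, Rabs_mult, Rabs_pos_eq by lra.
    apply Rmult_le_compat_l; [lra|]. apply isum_abs; lia. }
  assert (Hue : 1/4 < Rabs (u eta)).
  { unfold u. rewrite isum_scal, Rabs_mult, Rabs_pos_eq, <- rsum_isum by lra.
    replace (1/4) with (/ INR N * (INR N / 4)) by (unfold Rdiv; rewrite <- Rmult_assoc, NN; lra).
    apply Rmult_lt_compat_l; auto. }
  destruct (Hw O) as (_ & HA0 & _).
  assert (HAB : (A O <= B (N - 1))%nat).
  { assert (H2 := AB_lt A B AB 0 (N - 1) ltac:(lia)). destruct (AB O), (AB (N - 1)%nat). lia. }
  destruct (leaf_exists m n G X u (A O) (B (N - 1)%nat) eta HY ltac:(lia) Ve) as (g & Hg).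
  { intros E. rewrite E, Rabs_R0 in Hue. lra. }
  exists (fun d => 4 / u eta * u d), (A O), (B (N - 1)%nat), g.
  split; [lia|]. split; [exact Hg|].
  assert (Hfac : forall d, Rabs (4 / u eta * u d) <= 16 * Rabs (u d)).
  { intros d. rewrite Rabs_mult. apply Rmult_le_compat_r; [apply Rabs_pos|].
    unfold Rdiv. rewrite Rabs_mult, Rabs_inv, (Rabs_pos_eq 4) by lra.
    assert (/ Rabs (u eta) <= / (1/4)) by (apply Rinv_le_contravar; lra). lra. }
  split.
  - intros d Vd. eapply Rle_trans; [apply Hfac|].
    assert (Rabs (u d) <= 1); [|lra].
    eapply Rle_trans; [apply Hu|].
    assert (H1 : isum 0 N (fun l => Rabs (w l d)) <= 1 * (INR N - INR 0)).
    { apply isum_bound; [lia|]. intros k _. now apply (Hw k). }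
    simpl (INR 0) in H1. apply Rle_trans with (/ INR N * INR N); [|lra]. apply Rmult_le_compat_l; lra.
  - intros d Vd Hd. eapply Rle_trans; [apply Hfac|].
    assert (Hm := inv_m_bounds m n G (widx d) ltac:(lia)).
    assert (NB := node_bound A B AB n m G (fun k g => Rabs (w k g)) (fun _ _ => 0) d 1 1 0 0 N
       Vd ltac:(lia) ltac:(lia) ltac:(lra) ltac:(lra) ltac:(lra)).
    assert (NB' : isum 0 N (fun k => Rabs (w k d)) <= isum 0 N (fun _ => 0)
       + / INR (m (widx d)) * 1 * (INR N - INR 0) + INR (age d) * (/ INR (m (widx d)) * 0 + 2 * 1)).
    { apply NB; clear NB.
      - intros k _. now apply (Hw k).
      - intros k _ Hr. destruct (Hw k) as ((HB & _) & _). rewrite (eval_low m n _ _ _ _ HB Vd Hr), Rabs_R0. lra.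
      - intros k e _ Hc. destruct (Hw k) as ((HB & _) & _).
        rewrite (eval_child _ _ _ _ _ HB Vd Hc). lra.
      - intros; lra.
      - intros e a' c' Vv H1 H2. rewrite isum_const.
        assert (isum a' c' (fun k => Rabs (w k e)) <= 1 * (INR c' - INR a')).
        { apply isum_bound; [lia|]. intros k _. now apply (Hw k). }
        lra. }
    rewrite isum_const in NB'. simpl (INR 0) in NB'.
    assert (Hage : INR (age d) <= / INR (m (widx d)) * INR N).
    { assert (H1 := valid_age_le m n d G Vd ltac:(lia)).
      assert (H2 := n_mono m n G (widx d) P0 ltac:(lia) ltac:(lia)).
      assert (H3 := n_step m n G P0 ltac:(lia)). fold N in H3.
      assert (H4 := m_mono m n G (widx d) (S P0) ltac:(lia) ltac:(lia)).
      assert (H5 := m_ge4 m n G (S P0) ltac:(lia)).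
      assert (H6 : (m (widx d) * age d <= N)%nat).
      { apply Nat.le_trans with (m (S P0) * m (S P0) * (4 * n P0))%nat; auto.
        apply Nat.mul_le_mono; nia. }
      apply le_INR in H6. rewrite mult_INR in H6.
      assert (H7 := Rm_ge4 m n G (widx d) ltac:(lia)).
      apply Rmult_le_reg_l with (INR (m (widx d))); [lra|].
      rewrite <- Rmult_assoc, Rinv_r by lra. lra. }
    assert (Hf : Rabs (u d) <= 3 * / INR (m (widx d))); [|lra].
    eapply Rle_trans; [apply Hu|].
    apply Rle_trans with (/ INR N * (3 * / INR (m (widx d)) * INR N)).
    + apply Rmult_le_compat_l; lra.
    + right. transitivity (3 * / INR (m (widx d)) * (/ INR N * INR N)); [ring|]. rewrite NN; ring.
Qed.

(** [tree_bound] controls the mean of [Gl] over the [n p] summands; an index [l], depending on [d],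
    where [Gl] is at least its mean lets one range stand for the whole vector. In the error, 6 = 1 +
    5 collects [/ m (S p)] and the constant of [tree_bound]; 288 = 48 * 6, as 4 / (7/10) < 6. *)
Lemma ris_averages p P0 : (2 <= p)%nat -> (3 <= P0)%nat ->
  exists x p1 q1 g, (P0 <= p1)%nat /\ leafed m n X x p1 q1 g /\
    exists A B : nat -> nat,
      (forall l, (l < n p)%nat -> (p1 <= A l <= B l)%nat /\ (B l <= q1)%nat) /\
      forall d, valid n d -> exists l, (l < n p)%nat /\
        Rabs (x d) <= 288 * (Gl m p (path (A l) (B l) d) + 6 * / INR (m p)).
Proof.
  intros Hp HP.
  destruct (leafed_sequence m n X (fun _ P1 x _ _ _ => ris P1 x) (max P0 (S p)) ltac:(lia))
    as (u & A & B & lf & P1 & Sp & Hu).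
  { intros k P2 H2. destruct (ris_vectors P2 ltac:(lia)) as (x & a & c & g & H1 & H3 & H4).
    exists x, a, c, g. auto. }
  assert (AB : forall k, (A k <= B k)%nat /\ (B k < A (S k))%nat).
  { intros k. destruct (Hu k) as ((_ & ? & _) & _ & ? & _). destruct (Hu (S k)) as (_ & ? & _). lia. }
  assert (AB1 : forall k, (P1 k <= B k)%nat /\ (B k < P1 (S k))%nat).
  { intros k. destruct (AB k). destruct (Hu k) as (_ & ? & ? & _). lia. }
  set (N := n p).
  assert (HN4 : (4 <= N)%nat) by (apply n_ge4 with m; auto; lia).
  assert (NR : 4 <= INR N) by (apply le_INR in HN4; simpl in HN4; lra).
  assert (Hm4 := Rm_ge4 m n G p ltac:(lia)). assert (Hm := inv_m_bounds m n G p ltac:(lia)).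
  set (ce := INR (m p) / INR N).
  assert (Hce : 0 < ce) by (apply Rdiv_lt_0_compat; lra).
  set (v := fun d => isum 0 N (fun l => ce * u l d)).
  assert (HY : YB m n X v (A O) (B (N - 1)%nat)).
  { apply (YB_isum m n X u A B (fun _ => ce)); [lia|]. intros k Hk. destruct (Hu k) as ((H1 & _) & _).
    split; [exact H1|]. split.
    - destruct k as [|k]; auto. assert (H2 := AB_lt A B AB 0 (S k) ltac:(lia)). destruct (AB O). lia.
    - destruct (Nat.eq_dec k (N - 1)) as [->|Ne]; auto.
      assert (H2 := AB_lt A B AB k (N - 1) ltac:(lia)). destruct (AB (N - 1)%nat). lia. }
  (* The flat functional of weight [m p] takes the value 1 on the coefficients [ce], and 4/3 * 7/10
     < 1. *)
  assert (Big : exists eta, valid n eta /\ 7/10 < Rabs (v eta)).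
  { apply NNPP. intros Contra.
    assert (Wf := inW_flat m n p 0 N (fun _ => true) ltac:(lia) ltac:(lia)).
    assert (Low := lower_estimate m n G u A B lf Sp (fun _ => ce) _ N (7/10) Wf).
    assert (Low2 := Low ltac:(intros g Vg; apply Rnot_lt_le; intros Lt; apply Contra; exists g;
       split; [auto|unfold v; rewrite <- rsum_isum; auto])).
    rewrite rsum_isum, (isum_ext 0 N _ (fun _ => / INR N)) in Low2; [|lia|].
    - rewrite isum_const in Low2. simpl (INR 0) in Low2.
      rewrite Rminus_0_r, Rinv_l, Rabs_R1 in Low2 by lra. lra.
    - intros k Hk. destruct (Nat.leb_spec 0 k); [|lia]. destruct (Nat.ltb_spec k (0 + N)); [|lia].
      simpl. unfold ce. field. lra. }
  destruct Big as (eta & Ve & He).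
  assert (HAB : (A O <= B (N - 1))%nat).
  { assert (H2 := AB_lt A B AB 0 (N - 1) ltac:(lia)). destruct (AB O), (AB (N - 1)%nat). lia. }
  destruct (Hu O) as (_ & HP1 & _).
  destruct (leaf_exists m n G X v (A O) (B (N - 1)%nat) eta HY ltac:(lia) Ve) as (g & Hg).
  { intros E. rewrite E, Rabs_R0 in He. lra. }
  exists (fun d => 4 / v eta * v d), (A O), (B (N - 1)%nat), g.
  split; [lia|]. split; [exact Hg|]. exists A, B. split.
  { intros l Hl. destruct (AB l). split; [split; auto|].
    - destruct l as [|l]; auto. assert (H2 := AB_lt A B AB 0 (S l) ltac:(lia)). destruct (AB O). lia.
    - fold N in Hl. destruct (Nat.eq_dec l (N - 1)) as [->|Ne]; auto.
      assert (H2 := AB_lt A B AB l (N - 1) ltac:(lia)). destruct (AB (N - 1)%nat). lia. }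
  assert (HP1k : forall k, (S p <= P1 k)%nat) by (intros k; destruct (Hu k) as (_ & ? & _); lia).
  assert (HmS := inv_m_bounds m n G (S p) ltac:(lia)).
  assert (HmSq := inv_m_sqr m n G p (S p) ltac:(lia) ltac:(lia)).
  intros d Vd.
  (* In the main term, [Gl / m p] follows the paths to a node of weight [m p]; the summand
     [/ m (S p)] pays for the nodes of larger index at which the recursion stops. *)
  assert (TB : isum 0 N (fun k => Rabs (u k d)) <=
    isum 0 N (fun k => 48 * (/ INR (m p) * Gl m p (path (A k) (B k) d) + / INR (m (S p))))
    + 5 * 48 * INR (n p) * (/ INR (m p) * / INR (m p))).
  { apply (tree_bound A B AB n m G (fun k g => Rabs (u k g))
      (fun k g => 48 * (/ INR (m p) * Gl m p (path (A k) (B k) g) + / INR (m (S p)))) p 0%nat N 48);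
      auto; try lia; try lra.
    - intros k _. destruct (Hu k) as (_ & ? & _). lia.
    - intros k e _ Vv. now apply (Hu k).
    - intros k e _ Vv _ Hr. destruct (Hu k) as (((HB & _) & _) & _).
      rewrite (eval_low m n _ _ _ _ HB Vv Hr), Rabs_R0. lra.
    - intros k e _ Vv. assert (HG := Gl_bounds m n p _ G (path_weights n (A k) (B k) e Vv)). nra.
    - intros k f e _ Vv Hw Hc. destruct (Hu k) as (((HB & _) & _) & _).
      split; [rewrite (eval_child _ _ _ _ _ HB Vv Hc); lra|].
      rewrite (path_child n (A k) (B k) f Vv), Hc by lia.
      change (Gl m p (widx f :: ?l)) with (if widx f =? p then 1 else if widx f <? p then / INR (m (widx f)) * Gl m p l else 0).
      destruct (Nat.eqb_spec (widx f) p); [lia|]. destruct (Nat.ltb_spec (widx f) p); [|lia].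
      assert (Hmf := inv_m_bounds m n G (widx f) ltac:(lia)).
      assert (/ INR (m (widx f)) * / INR (m (S p)) <= 1 * / INR (m (S p))) by (apply Rmult_le_compat_r; lra).
      lra.
    - intros f a c Vf Hf Ha Hc.
      assert (HG := fun k => Gl_bounds m n p _ G (path_weights n (A k) (B k) f Vf)).
      destruct (Nat.eq_dec (widx f) p) as [Ep|Ep].
      + apply Rle_trans with (isum a c (fun k => 48 * (/ INR (m p) * Gl m p (path (A k) (B k) f) + / INR (m (S p))))); [|lra].
        apply isum_le; [lia|]. intros k _. rewrite (path_child n (A k) (B k) f Vf) by lia.
        simpl. rewrite Ep, Nat.eqb_refl.
        destruct (Hu k) as (_ & _ & _ & [_ HR]). specialize (HR f Vf).
        rewrite Ep in HR. specialize (HP1k k). specialize (HR ltac:(lia)). lra.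
      (* Weight index above [p]: the value is small by [ris] if the index is below [P1 k], and by
         the factor of the first child if it is beyond [B k]. The intervals from [P1 k] to [B k] are
         disjoint, so one [k] remains, at cost 48. *)
      + assert (Hmf := inv_m_mono m n G (S p) (widx f) ltac:(lia) ltac:(lia)).
        apply Rle_trans with (isum a c (fun k =>
           48 * (/ INR (m p) * Gl m p (path (A k) (B k) f) + / INR (m (S p))) +
           (if andb (P1 k <=? widx f) (widx f <=? B k) then 48 else 0))).
        * apply isum_le; [lia|]. intros k _. specialize (HG k).
          assert (H0 : 0 <= / INR (m p) * Gl m p (path (A k) (B k) f)) by (apply Rmult_le_pos; lra).
          destruct (Hu k) as (((HB & _) & _) & _ & _ & [HR1 HR2]).
          destruct (Nat.leb_spec (P1 k) (widx f)) as [L1|L1]; [destruct (Nat.leb_spec (widx f) (B k)) as [L2|L2]|]; simpl.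
          -- specialize (HR1 f Vf). lra.
          -- destruct (child_early n (A k) (B k) f Vf ltac:(lia)) as [e He'].
             rewrite (eval_child _ _ _ _ _ HB Vf He').
             specialize (HR1 e (child_valid _ _ _ _ _ Vf He')).
             assert (Hmf' := inv_m_bounds m n G (widx f) ltac:(lia)).
             assert (/ INR (m (widx f)) * Rabs (u k e) <= / INR (m (widx f)) * 48) by (apply Rmult_le_compat_l; lra).
             lra.
          -- specialize (HR2 f Vf ltac:(lia)). lra.
        * rewrite isum_plus. apply Rplus_le_compat_l. apply isum_at_most_one; [lia|lra| |].
          -- intros k _. destruct (andb _ _); lra.
          -- intros k l _ _ Hk Hl.
             destruct (Nat.leb_spec (P1 k) (widx f)); [|simpl in Hk; lra].
             destruct (Nat.leb_spec (widx f) (B k)); [|simpl in Hk; lra].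
             destruct (Nat.leb_spec (P1 l) (widx f)); [|simpl in Hl; lra].
             destruct (Nat.leb_spec (widx f) (B l)); [|simpl in Hl; lra].
             destruct (Nat.lt_total k l) as [L|[L|L]]; auto.
             ++ assert (H9 := AB_lt P1 B AB1 k l L). lia.
             ++ assert (H9 := AB_lt P1 B AB1 l k L). lia. }
  destruct (exists_above_mean N (fun k => Gl m p (path (A k) (B k) d)) ltac:(lia)) as (l & Hl & HM).
  exists l. split; [exact Hl|].
  rewrite isum_scal, isum_plus, isum_scal, isum_const in TB. rewrite rsum_isum in HM. simpl (INR 0) in TB. fold N in TB.
  set (g0 := Gl m p (path (A l) (B l) d)) in *.
  assert (Hv : Rabs (v d) <= 48 * (g0 + 6 * / INR (m p))).
  { unfold v. rewrite isum_scal, Rabs_mult, (Rabs_pos_eq ce) by lra.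
    assert (H1 := isum_abs 0 N (fun k => u k d) ltac:(lia)).
    apply Rle_trans with (ce * (48 * (/ INR (m p) * (INR N * g0) + / INR (m p) * / INR (m p) * INR N)
       + 240 * INR N * (/ INR (m p) * / INR (m p)))).
    - apply Rmult_le_compat_l; [lra|]. eapply Rle_trans; [exact H1|]. eapply Rle_trans; [exact TB|].
      assert (/ INR (m p) * isum 0 N (fun k => Gl m p (path (A k) (B k) d)) <= / INR (m p) * (INR N * g0))
        by (apply Rmult_le_compat_l; lra).
      assert (/ INR (m (S p)) * (INR N - 0) <= / INR (m p) * / INR (m p) * INR N)
        by (rewrite Rminus_0_r; apply Rmult_le_compat_r; lra).
      lra.
    - right. unfold ce. field. lra. }
  rewrite Rabs_mult. apply Rle_trans with (6 * Rabs (v d)); [|lra].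
  apply Rmult_le_compat_r; [apply Rabs_pos|].
  unfold Rdiv. rewrite Rabs_mult, Rabs_inv, (Rabs_pos_eq 4) by lra.
  assert (/ Rabs (v eta) <= / (7/10)) by (apply Rinv_le_contravar; lra). lra.
Qed.

End Averages.

(** * The coefficients along the tree are dominated by a functional of [T] *)

(* For an element of a block of index [J] whose end weight is [p > J], the product of the weights on a
   path is split according to the number of occurrences of weights [>= J] before [p]: none ([Zl]),
   exactly one, equal to [J] ([Ol]), or anything else, which contributes at most [2 / m_J^2]. *)
Fixpoint Zl (m : nat -> nat) (J p : nat) (l : list nat) : R :=
  match l with
  | [] => 0
  | j :: l' => if j =? p then 1 else if j <? J then / INR (m j) * Zl m J p l' else 0
  end.

Fixpoint Ol (m : nat -> nat) (J p : nat) (l : list nat) : R :=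
  match l with
  | [] => 0
  | j :: l' => if j =? p then 0 else if j =? J then / INR (m J) * Zl m J p l'
               else if j <? J then / INR (m j) * Ol m J p l' else 0
  end.

Section Lists.
Variables (m n : nat -> nat).
Hypothesis G : growth m n.

Lemma Zl_bounds J p l : Forall (fun j => (1 <= j)%nat) l -> 0 <= Zl m J p l <= 1.
Proof.
  intros F; induction F as [|j l Hj F IH]; simpl; [lra|].
  assert (Hm := inv_m_bounds m n G j Hj).
  destruct (j =? p); [lra|]. destruct (j <? J); [nra|lra].
Qed.

Lemma Ol_bounds J p l : (1 <= J)%nat -> Forall (fun j => (1 <= j)%nat) l ->
  0 <= Ol m J p l <= / INR (m J).
Proof.
  intros HJ F. assert (HmJ := inv_m_bounds m n G J HJ).
  induction F as [|j l Hj F IH]; simpl; [lra|].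
  assert (Hm := inv_m_bounds m n G j Hj). assert (HZ := Zl_bounds J p l F).
  destruct (j =? p); [lra|]. destruct (j =? J); [nra|]. destruct (j <? J); [nra|lra].
Qed.

(** Two weights of index at least [J] have product at most [/ m_J^2], and one of index above [J] is
    already that small because [m_J^2 <= m_(J+1)]. *)
Lemma Gl_split J p l : (1 <= J < p)%nat -> Forall (fun j => (1 <= j)%nat) l ->
  Gl m p l <= Zl m J p l + Ol m J p l + 2 * (/ INR (m J) * / INR (m J)).
Proof.
  intros HJ F. assert (HmJ := inv_m_bounds m n G J ltac:(lia)).
  assert (Hsq : 0 <= / INR (m J) * / INR (m J)) by (apply Rmult_le_pos; lra).
  induction F as [|j l Hj F IH]; simpl; [lra|].
  assert (Hm := inv_m_bounds m n G j Hj). assert (HZ := Zl_bounds J p l F).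
  assert (HO := Ol_bounds J p l ltac:(lia) F). assert (HG := Gl_bounds m n p l G F).
  destruct (Nat.eqb_spec j p) as [E|E].
  - lra.
  - destruct (Nat.eqb_spec j J) as [E2|E2].
    + subst j. destruct (Nat.ltb_spec J J); [lia|]. destruct (Nat.ltb_spec J p); [|lia].
      set (mu := / INR (m J)) in *. nra.
    + destruct (Nat.ltb_spec j J).
      * destruct (Nat.ltb_spec j p); [|lia].
        set (mu := / INR (m J) * / INR (m J)) in *. nra.
      * destruct (Nat.ltb_spec j p); [|lra].
        assert (Hs := inv_m_sqr m n G J j ltac:(lia) ltac:(lia)). nra.
Qed.

Variable b : nat -> R.
Variable N : nat.

(** The alternative [v <= 0] plays the role of the zero functional, since [W_avg] asks for at least
    one child. The support condition lets functionals of consecutive pieces be averaged. *)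
Definition dominated (a c : nat) (v : R) : Prop :=
  v <= 0 \/ exists f, inW m n f /\ (forall k, f k <> 0 -> (a <= k < c)%nat) /\
    v <= rsum N (fun k => f k * b k).

Lemma dominated_mono a c a' c' v :
  dominated a' c' v -> (a <= a')%nat -> (c' <= c)%nat -> dominated a c v.
Proof.
  intros [H|(f & Wf & Sf & Hf)] H1 H2; [now left|right].
  exists f. split; [auto|split; auto]. intros k Hk. specialize (Sf k Hk). lia.
Qed.

Lemma dominated_unit a c k : (a <= k < c)%nat -> (c <= N)%nat -> dominated a c (Rabs (b k)).
Proof.
  intros H1 H2. right.
  set (s := if Rle_dec 0 (b k) then true else false).
  exists (fun i => if Nat.eqb i k then sgn s else 0). split; [apply W_unit|]. split.
  - intros i. destruct (Nat.eqb_spec i k); [now subst|tauto].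
  - rewrite rsum_isum, (isum_single 0 N k); [|lia|].
    + rewrite Nat.eqb_refl. unfold s. destruct (Rle_dec 0 (b k)); simpl; unfold Rabs; destruct Rcase_abs; lra.
    + intros i _ Hi. apply Nat.eqb_neq in Hi. rewrite Hi. ring.
Qed.

Lemma rsum_wsum fs : rsum N (fun k => wsum fs k * b k) =
  fold_right (fun f acc => rsum N (fun k => f k * b k) + acc) 0 fs.
Proof.
  induction fs as [|f fs IH]; simpl.
  - rewrite rsum_isum, isum_zero; [auto|lia|]. intros; unfold wsum; simpl; ring.
  - rewrite <- IH, !rsum_isum, <- isum_plus. apply isum_ext; [lia|]. intros; unfold wsum; simpl; ring.
Qed.

(** One functional per piece, so a node of weight [m j] stays admissible. Superadditivity of [E]
    makes the errors of the pieces sum to at most that of the whole interval, whatever the number of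
    children. *)
Lemma dominated_assemble j l (F : gam -> nat -> R) (E : nat -> nat -> R) :
  (1 <= j)%nat -> (length l <= n j)%nat ->
  (forall a c, 0 <= E a c) ->
  (forall a a1 c1 c, (a <= a1 <= c1)%nat -> (c1 <= c)%nat -> E a1 c1 + E c1 c <= E a c) ->
  forall a c, pieces a c l ->
  (forall e a1 c1, In (e, a1, c1) l -> exists v, dominated a1 c1 v /\
      isum a1 c1 (F e) <= / INR (m j) * v + E a1 c1) ->
  exists v, dominated a c v /\ psum l F <= v + E a c.
Proof.
  intros Hj Hl E0 Esup a c Hp HF.
  assert (Hm := inv_m_bounds m n G j Hj).
  assert (K : exists fs, (length fs <= length l)%nat /\ (forall f, In f fs -> inW m n f) /\
    ForallOrdPairs succ_supp fs /\ (forall f k, In f fs -> f k <> 0 -> (a <= k < c)%nat) /\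
    psum l F <= / INR (m j) * rsum N (fun k => wsum fs k * b k) + E a c).
  { clear Hl. revert a Hp HF. induction l as [|[[e a1] c1] l IH]; intros a Hp HF.
    - exists []. split; [auto|]. split; [simpl; tauto|]. split; [constructor|]. split; [simpl; tauto|].
      rewrite rsum_wsum. unfold psum; simpl. specialize (E0 a c). lra.
    - destruct Hp as [Hp1 Hp2]. assert (Hc := pieces_le _ _ _ Hp2).
      destruct (IH c1 Hp2) as (fs & L1 & L2 & L3 & L4 & L5); [intros; apply HF; right; auto|].
      destruct (HF e a1 c1 (or_introl eq_refl)) as (v & Dv & Hv).
      specialize (Esup a a1 c1 c Hp1 Hc).
      destruct Dv as [Dv|(f & Wf & Sf & Hf)].
      + exists fs. split; [simpl; lia|]. split; [auto|]. split; [auto|]. split.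
        * intros f k Hf Hk. specialize (L4 f k Hf Hk). lia.
        * change (psum ((e, a1, c1) :: l) F) with (isum a1 c1 (F e) + psum l F).
          assert (/ INR (m j) * v <= 0) by nra. lra.
      + exists (f :: fs). split; [simpl; lia|]. split; [intros f' [<-|Hf']; auto|]. split.
        * constructor; auto. apply Forall_forall. intros f' Hf' k k' Hk Hk'.
          specialize (Sf k Hk). specialize (L4 f' k' Hf' Hk'). lia.
        * split.
          { intros f' k [<-|Hf'] Hk; [specialize (Sf k Hk); lia|].
            specialize (L4 f' k Hf' Hk). lia. }
          change (psum ((e, a1, c1) :: l) F) with (isum a1 c1 (F e) + psum l F).
          rewrite rsum_wsum. rewrite rsum_wsum in L5. cbn [fold_right].
          assert (/ INR (m j) * v <= / INR (m j) * rsum N (fun k => f k * b k)) by (apply Rmult_le_compat_l; lra).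
          lra. }
  destruct K as (fs & L1 & L2 & L3 & L4 & L5).
  destruct fs as [|f0 fs'].
  - exists 0. split; [left; lra|]. rewrite rsum_wsum in L5. simpl in L5. lra.
  - set (fs := f0 :: fs') in *.
    exists (/ INR (m j) * rsum N (fun k => wsum fs k * b k)). split; [|exact L5].
    right. exists (fun k => / INR (m j) * wsum fs k). split.
    + apply W_avg; auto; [subst fs; simpl; lia|lia].
    + split.
      * intros k Hk. destruct (wsum_single fs k L3) as [Ek|(f & Hin & Ek)].
        -- rewrite Ek in Hk. exfalso; apply Hk; ring.
        -- apply (L4 f k Hin). intros Ef. apply Hk. rewrite Ek, Ef. ring.
      * right. rewrite !rsum_isum, <- isum_scal. apply isum_ext; [lia|]. intros; ring.
Qed.

End Lists.

(** * Domination of block coefficients by a functional of [T] *)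

Section Blocks.
Variables (m n : nat -> nat).
Hypothesis G : growth m n.
Variables (s J pw blk : nat -> nat).
Hypothesis sS : forall i, s (S i) = (s i + n (J i))%nat.
Hypothesis J_ge : forall i, (i + 2 <= J i)%nat.
Hypothesis J_lt : forall i i', (i < i')%nat -> (J i < J i')%nat.
Hypothesis pw_lt : forall k k', (k < k')%nat -> (pw k < pw k')%nat.
Hypothesis blk_spec : forall k, (s (blk k) <= k < s (S (blk k)))%nat.
Hypothesis J_pw : forall k, (J (blk k) < pw k)%nat.
Variables (A B : nat -> nat).
Hypothesis AB : forall k, (A k <= B k)%nat /\ (B k < A (S k))%nat.
Hypothesis A_ge : forall k, (2 <= A k)%nat.
Variables (b al : nat -> R) (I0 : nat).
Hypothesis al_pos : forall i, 0 <= al i.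
Hypothesis b_eq : forall k, (k < s I0)%nat ->
  Rabs (b k) = al (blk k) * (INR (m (J (blk k))) / INR (n (J (blk k)))).

Notation N0 := (s I0).
Notation pth k g := (path (A k) (B k) g).
Notation Z k g := (Zl m (J (blk k)) (pw k) (pth k g)).
Notation O_ k g := (Ol m (J (blk k)) (pw k) (pth k g)).

Lemma s_mono i i' : (i <= i')%nat -> (s i <= s i')%nat.
Proof. induction 1 as [|i' H IH]; auto. rewrite sS. lia. Qed.

Lemma s_lt_inv i i' : (s i < s i')%nat -> (i < i')%nat.
Proof.
  intros H. destruct (le_lt_dec i' i) as [L|L]; auto. apply s_mono in L. lia.
Qed.

Lemma blk_eq k i : (s i <= k < s (S i))%nat -> blk k = i.
Proof.
  intros H. assert (H1 := blk_spec k).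
  assert (blk k < S i)%nat by (apply s_lt_inv; lia). assert (i < S (blk k))%nat by (apply s_lt_inv; lia).
  lia.
Qed.

Lemma pw_inj k k' : pw k = pw k' -> k = k'.
Proof.
  intros E. destruct (Nat.lt_total k k') as [H|[H|H]]; auto; apply pw_lt in H; lia.
Qed.

Lemma Z_cons k g e : valid n g -> (1 <= widx g)%nat -> child (A k) (B k) g = Some e ->
  Z k g = if widx g =? pw k then 1
          else if widx g <? J (blk k) then / INR (m (widx g)) * Z k e else 0.
Proof. intros V W E. rewrite (path_child n) by auto. now rewrite E. Qed.

Lemma O_cons k g e : valid n g -> (1 <= widx g)%nat -> child (A k) (B k) g = Some e ->
  O_ k g = if widx g =? pw k then 0
           else if widx g =? J (blk k) then / INR (m (J (blk k))) * Z k e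
           else if widx g <? J (blk k) then / INR (m (widx g)) * O_ k e else 0.
Proof. intros V W E. rewrite (path_child n) by auto. now rewrite E. Qed.

Lemma Z_leaf k g : valid n g -> (1 <= widx g)%nat -> child (A k) (B k) g = None ->
  Z k g = if widx g =? pw k then 1 else 0.
Proof.
  intros V W E. rewrite (path_child n) by auto. rewrite E. simpl.
  destruct (widx g =? pw k); auto. destruct (widx g <? J (blk k)); ring.
Qed.

Lemma O_leaf k g : valid n g -> (1 <= widx g)%nat -> child (A k) (B k) g = None -> O_ k g = 0.
Proof.
  intros V W E. rewrite (path_child n) by auto. rewrite E. simpl.
  destruct (widx g =? pw k); auto. destruct (widx g =? J (blk k)); [ring|].
  destruct (widx g <? J (blk k)); ring.
Qed.

Lemma Z_bounds k g : valid n g -> 0 <= Z k g <= 1.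
Proof. intros V. apply (Zl_bounds m n G). now apply (path_weights n). Qed.

Lemma O_bounds k g : valid n g -> 0 <= O_ k g.
Proof.
  intros V. apply (Ol_bounds m n G).
  - specialize (J_ge (blk k)). lia.
  - now apply (path_weights n).
Qed.

Lemma path_weightless k g : valid n g -> (widx g < 1)%nat -> pth k g = [].
Proof. destruct g; simpl; auto; lia. Qed.

(** [Z] admits only weight indices below [J i] before [pw k], so [tree_bound] applies with
    [q = J i]. A node of index at least [J i] keeps only the [k] with [pw k] equal to that index, at
    most one by injectivity; hence [C = 1]. *)
Lemma block_Z_sum i g a c : valid n g -> (s i <= a <= c)%nat -> (c <= s (S i))%nat ->
  isum a c (fun k => Z k g) <= 5 * INR (n (J i)) * (/ INR (m (J i)) * / INR (m (J i))).
Proof.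
  intros V Ha Hc. assert (HJ := J_ge i). assert (HsS := sS i).
  assert (TB : isum a c (fun k => Z k g) <= isum a c (fun _ => 0)
    + 5 * 1 * INR (n (J i)) * (/ INR (m (J i)) * / INR (m (J i)))).
  { apply (tree_bound A B AB n m G (fun k g => Z k g) (fun _ _ => 0) (J i) (s i) (s (S i)) 1);
      auto; try lia; try lra.
    - intros k e _ Ve. apply Z_bounds; auto.
    - intros k e Hk Ve Hw Hr.
      assert (Hb := blk_eq k i Hk). assert (HJp := J_pw k). rewrite Hb in HJp.
      destruct (le_lt_dec 1 (widx e)) as [L|L].
      + destruct (child (A k) (B k) e) as [e'|] eqn:Ce.
        * exfalso. clear - Ce Hr Ve AB. destruct (AB k) as [Hab _].
          assert (K : forall g, valid n g -> child (A k) (B k) g = Some e' -> (B k < rank g)%nat).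
          { clear - Hab. intros g; induction g as [|r j t eta IHe|r xi IHx j t eta IHe]; simpl; intros V E.
            - discriminate.
            - destruct (Nat.ltb_spec (B k) r); [auto|discriminate].
            - destruct (Nat.leb_spec (B k) (rank xi)); [lia|].
              destruct (Nat.ltb_spec (B k) r); [auto|]. rewrite andb_false_r in E. discriminate. }
          specialize (K e Ve Ce). lia.
        * rewrite Z_leaf by auto. destruct (Nat.eqb_spec (widx e) (pw k)); [lia|lra].
      + rewrite path_weightless by auto. simpl. lra.
    - intros; lra.
    - intros k f e Hk Vf Hw Hce. assert (Hb := blk_eq k i Hk). assert (HJp := J_pw k). rewrite Hb in HJp.
      rewrite (Z_cons k f e) by (auto; lia). rewrite Hb.
      destruct (Nat.eqb_spec (widx f) (pw k)); [lia|].
      destruct (Nat.ltb_spec (widx f) (J i)); [|lia]. split; lra.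
    - intros f a' c' Vf Hw Ha' Hc'. rewrite isum_const, Rmult_0_l, Rplus_0_l.
      assert (HZ : forall k, (a' <= k < c')%nat -> Z k f <> 0 -> widx f = pw k).
      { intros k Hk HZ. assert (Hb := blk_eq k i ltac:(lia)).
        rewrite (path_child n) in HZ by (auto; lia). simpl in HZ.
        destruct (Nat.eqb_spec (widx f) (pw k)); auto.
        destruct (Nat.ltb_spec (widx f) (J (blk k))); [rewrite Hb in *; lia|]. tauto. }
      apply isum_at_most_one; [lia|lra| |].
      + intros k _. apply Z_bounds; auto.
      + intros k l Hk Hl Zk Zl'. apply pw_inj. rewrite <- (HZ k), <- (HZ l); auto. }
  rewrite isum_const in TB. lra.
Qed.

(** The bound of [block_Z_sum] times the coefficient [al i * m_J / n_J]: the price of dropping a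
    block seen through [Z]. *)
Definition err (i : nat) : R := 5 * al i * / INR (m (J i)).

Lemma err_pos i : 0 <= err i.
Proof.
  unfold err. assert (H := inv_m_bounds m n G (J i) ltac:(specialize (J_ge i); lia)).
  specialize (al_pos i). nra.
Qed.

Lemma block_bZ_sum i g a c : valid n g -> (s i <= a <= c)%nat -> (c <= s (S i))%nat -> (c <= N0)%nat ->
  isum a c (fun k => Rabs (b k) * Z k g) <= err i.
Proof.
  intros V Ha Hc HN. assert (H := block_Z_sum i g a c V Ha Hc).
  assert (HJ := J_ge i). assert (Hm := Rm_ge4 m n G (J i) ltac:(lia)).
  assert (Hn := Rn_ge4 m n G (J i) ltac:(lia)). specialize (al_pos i).
  rewrite (isum_ext a c _ (fun k => al i * (INR (m (J i)) / INR (n (J i))) * Z k g)) by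
    (try lia; intros k Hk; rewrite b_eq, (blk_eq k i) by lia; reflexivity).
  rewrite isum_scal.
  apply Rle_trans with (al i * (INR (m (J i)) / INR (n (J i))) *
     (5 * INR (n (J i)) * (/ INR (m (J i)) * / INR (m (J i))))).
  - apply Rmult_le_compat_l; auto. apply Rmult_le_pos; auto. left. apply Rdiv_lt_0_compat; lra.
  - right. unfold err. field. lra.
Qed.

(** No error appears: [Z] vanishes at cut indices unless the node has weight index [pw k], and such
    a node keeps only that one index of the block, because for the others its weight index exceeds
    [J i]. It becomes a unit functional. *)
Lemma Z_dominated : forall d g a c i, (rank g < d)%nat -> valid n g ->
  (s i <= a <= c)%nat -> (c <= s (S i))%nat -> (c <= N0)%nat ->
  exists v, dominated m n b N0 a c v /\ isum a c (fun k => Rabs (b k) * Z k g) <= v.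
Proof.
  induction d as [|d IH]; intros g a c i Hd V Ha Hc HN; [lia|].
  assert (HJ : forall k, (a <= k < c)%nat -> blk k = i /\ (J i < pw k)%nat).
  { intros k Hk. assert (Hb := blk_eq k i ltac:(lia)). split; auto. rewrite <- Hb. apply J_pw. }
  destruct (le_lt_dec 1 (widx g)) as [W|W].
  2:{ exists 0. split; [left; lra|]. right. apply isum_zero; [lia|]. intros k _.
      rewrite path_weightless by auto. simpl. ring. }
  destruct (classic (exists k, (a <= k < c)%nat /\ pw k = widx g)) as [(k0 & Hk0 & E0)|NE].
  - exists (Rabs (b k0)). split; [now apply dominated_unit|].
    rewrite (isum_single a c k0); auto.
    + assert (H := Z_bounds k0 g V). assert (H1 := Rabs_pos (b k0)). nra.
    + intros k Hk Hne. destruct (HJ k Hk) as [Hb Hp]. destruct (HJ k0 Hk0) as [_ Hp0].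
      rewrite (path_child n) by auto. simpl.
      destruct (Nat.eqb_spec (widx g) (pw k)); [exfalso; apply Hne, pw_inj; congruence|].
      rewrite Hb. destruct (Nat.ltb_spec (widx g) (J i)); [lia|ring].
  - assert (NE' : forall k, (a <= k < c)%nat -> (widx g =? pw k) = false).
    { intros k Hk. apply Nat.eqb_neq. intros E. apply NE. eauto. }
    destruct (tree_decomposition A B AB n g V W a c ltac:(lia)) as (l & L & Pc & Ch & Su).
    specialize (Su (fun k => Rabs (b k) * Z k g) 0 ltac:(lra)).
    assert (HA := valid_age_le m n g G V W).
    assert (Hm := inv_m_bounds m n G (widx g) W).
    assert (Z0 : forall k, (a <= k < c)%nat -> child (A k) (B k) g = None -> Rabs (b k) * Z k g <= 0).
    { intros k Hk Hce. rewrite Z_leaf, NE' by auto. lra. }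
    specialize (Su Z0 (fun k Hk Hce _ => Z0 k Hk Hce)).
    destruct (dominated_assemble m n G b N0 (widx g) l (fun _ k => Rabs (b k) * Z k g) (fun _ _ => 0)
      W ltac:(lia) ltac:(intros; lra) ltac:(intros; lra) a c Pc) as (v & Dv & Hv).
    + intros e a1 c1 Hin. destruct (Ch e a1 c1 Hin) as (C1 & C2 & C3 & C4 & C5).
      destruct (IH e a1 c1 i ltac:(lia) C1 ltac:(lia) ltac:(lia) ltac:(lia)) as (v & Dv & Hv).
      exists v. split; auto. rewrite Rplus_0_r.
      apply Rle_trans with (/ INR (m (widx g)) * isum a1 c1 (fun k => Rabs (b k) * Z k e));
        [|apply Rmult_le_compat_l; lra].
      rewrite <- isum_scal. apply isum_le; [lia|]. intros k Hk.
      rewrite (Z_cons k g e), NE' by (auto; lia). assert (H1 := Rabs_pos (b k)).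
      assert (H2 := Z_bounds k e C1).
      destruct (widx g <? J (blk k)); [right; ring|].
      rewrite Rmult_0_r. apply Rmult_le_pos; [lra|]. apply Rmult_le_pos; lra.
    + exists v. split; auto. lra.
Qed.

(** A block is charged when its end lies strictly inside the interval. If the interval is split,
    that end is strictly inside at most one part, so no block is charged twice along the tree. *)
Definition Err (a c : nat) : R :=
  rsum I0 (fun i => if andb (a <? s (S i)) (s (S i) <? c) then err i else 0).

Lemma Err_pos a c : 0 <= Err a c.
Proof.
  unfold Err. rewrite rsum_isum. apply isum_nonneg; [lia|]. intros i _.
  destruct (andb _ _); [apply err_pos|lra].
Qed.

Lemma Err_super a a1 c1 c : (a <= a1 <= c1)%nat -> (c1 <= c)%nat -> Err a1 c1 + Err c1 c <= Err a c.
Proof.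
  intros H1 H2. unfold Err. rewrite !rsum_isum, <- isum_plus. apply isum_le; [lia|].
  intros i _. assert (H := err_pos i).
  destruct (Nat.ltb_spec a1 (s (S i))), (Nat.ltb_spec (s (S i)) c1), (Nat.ltb_spec c1 (s (S i))),
    (Nat.ltb_spec (s (S i)) c), (Nat.ltb_spec a (s (S i))); simpl; try lia; lra.
Qed.

Lemma Err_single i a c : (i < I0)%nat -> (a < s (S i) < c)%nat -> err i <= Err a c.
Proof.
  intros Hi H. unfold Err. rewrite rsum_isum.
  apply Rle_trans with (isum i (S i) (fun i => if andb (a <? s (S i)) (s (S i) <? c) then err i else 0)).
  - rewrite isum_S, isum_nil. destruct (Nat.ltb_spec a (s (S i))); [|lia].
    destruct (Nat.ltb_spec (s (S i)) c); [|lia]. simpl; lra.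
  - apply isum_sub_le; try lia. intros k _. destruct (andb _ _); [apply err_pos|lra].
Qed.

Lemma Err_total : Err 0 N0 <= rsum I0 err.
Proof.
  unfold Err. rewrite !rsum_isum. apply isum_le; [lia|]. intros i _. assert (H := err_pos i).
  destruct (andb _ _); lra.
Qed.

(* At a node of weight [m_(J i)], the children that meet the block [i] and also later blocks give
   up the block [i]; there is one such child at most, so that the number of children stays [<= n_(J i)]. *)
Lemma O_dominated : forall d g a c, (rank g < d)%nat -> valid n g -> (a <= c)%nat -> (c <= N0)%nat ->
  exists v, dominated m n b N0 a c v /\ isum a c (fun k => Rabs (b k) * O_ k g) <= v + Err a c.
Proof.
  induction d as [|d IH]; intros g a c Hd V Ha HN; [lia|].
  destruct (le_lt_dec 1 (widx g)) as [W|W].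
  2:{ exists 0. split; [left; lra|]. assert (H := Err_pos a c).
      rewrite isum_zero; [lra|lia|]. intros k _.
      rewrite path_weightless by auto. simpl. ring. }
  destruct (tree_decomposition A B AB n g V W a c Ha) as (l & L & Pc & Ch & Su).
  specialize (Su (fun k => Rabs (b k) * O_ k g) 0 ltac:(lra)).
  assert (HA := valid_age_le m n g G V W).
  assert (Hm := inv_m_bounds m n G (widx g) W).
  assert (Z0 : forall k, (a <= k < c)%nat -> child (A k) (B k) g = None -> Rabs (b k) * O_ k g <= 0).
  { intros k Hk Hce. rewrite O_leaf by auto. lra. }
  specialize (Su Z0 (fun k Hk Hce _ => Z0 k Hk Hce)).
  set (mu := / INR (m (widx g))) in *.
  destruct (dominated_assemble m n G b N0 (widx g) l (fun _ k => Rabs (b k) * O_ k g) Err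
    W ltac:(lia) Err_pos Err_super a c Pc) as (v & Dv & Hv); [|exists v; split; auto; lra].
  intros e a1 c1 Hin. destruct (Ch e a1 c1 Hin) as (C1 & C2 & C3 & C4 & C5).
  fold mu.
  assert (OthO : forall k, (a1 <= k < c1)%nat -> widx g <> J (blk k) ->
     Rabs (b k) * O_ k g <= mu * (Rabs (b k) * O_ k e)).
  { intros k Hk Hne. rewrite (O_cons k g e) by (auto; lia).
    assert (H1 := Rabs_pos (b k)). assert (H2 := O_bounds k e C1).
    assert (0 <= mu * (Rabs (b k) * O_ k e)) by (apply Rmult_le_pos; [lra|apply Rmult_le_pos; lra]).
    destruct (widx g =? pw k); [lra|]. destruct (Nat.eqb_spec (widx g) (J (blk k))); [lia|].
    fold mu. destruct (widx g <? J (blk k)); lra. }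
  destruct (classic (exists k, (a1 <= k < c1)%nat /\ J (blk k) = widx g)) as [(k0 & Hk0 & E0)|NE].
  2:{ destruct (IH e a1 c1 ltac:(lia) C1 ltac:(lia) ltac:(lia)) as (v & Dv & Hv).
      exists v. split; auto.
      apply Rle_trans with (mu * isum a1 c1 (fun k => Rabs (b k) * O_ k e)).
      - rewrite <- isum_scal. apply isum_le; [lia|]. intros k Hk. apply OthO; auto.
        intros E. apply NE. eauto.
      - assert (HE := Err_pos a1 c1).
        assert (mu * isum a1 c1 (fun k => Rabs (b k) * O_ k e) <= mu * (v + Err a1 c1))
          by (apply Rmult_le_compat_l; lra).
        nra. }
  set (i := blk k0) in *. assert (Hi := blk_spec k0). fold i in Hi.
  (* For earlier blocks [widx g] is larger than [J (blk k)], so the path does not count in [O_]. *)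
  assert (Low : forall k, (a1 <= k < c1)%nat -> (k < s i)%nat -> Rabs (b k) * O_ k g = 0).
  { intros k Hk Hks. rewrite (O_cons k g e) by (auto; lia).
    assert (Hb : (blk k < i)%nat) by (apply s_lt_inv; assert (H1 := blk_spec k); lia).
    apply J_lt in Hb. destruct (widx g =? pw k); [ring|].
    destruct (Nat.eqb_spec (widx g) (J (blk k))); [lia|].
    destruct (Nat.ltb_spec (widx g) (J (blk k))); [lia|ring]. }
  assert (Mid : forall k, (a1 <= k < c1)%nat -> (s i <= k < s (S i))%nat ->
     Rabs (b k) * O_ k g <= mu * (Rabs (b k) * Z k e)).
  { intros k Hk Hks. rewrite (O_cons k g e) by (auto; lia). rewrite (blk_eq k i Hks).
    assert (H1 := Rabs_pos (b k)). assert (H2 := Z_bounds k e C1). rewrite (blk_eq k i Hks) in H2.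
    assert (0 <= mu * (Rabs (b k) * Zl m (J i) (pw k) (pth k e)))
      by (apply Rmult_le_pos; [lra|apply Rmult_le_pos; lra]).
    destruct (widx g =? pw k); [lra|]. rewrite E0, Nat.eqb_refl. fold mu. lra. }
  set (a2 := max a1 (s i)).
  destruct (le_lt_dec c1 (s (S i))) as [Lc|Lc].
  - destruct (Z_dominated d e a2 c1 i ltac:(lia) C1 ltac:(lia) Lc ltac:(lia)) as (v & Dv & Hv).
    exists v. split; [eapply dominated_mono; [exact Dv|lia|lia]|].
    rewrite (isum_restrict a1 a2 c1 c1) by (try lia; intros; apply Low; lia).
    assert (HE := Err_pos a1 c1).
    apply Rle_trans with (mu * isum a2 c1 (fun k => Rabs (b k) * Z k e)).
    + rewrite <- isum_scal. apply isum_le; [lia|]. intros k Hk. apply Mid; lia.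
    + assert (mu * isum a2 c1 (fun k => Rabs (b k) * Z k e) <= mu * v) by (apply Rmult_le_compat_l; lra).
      lra.
  (* The child goes beyond the block [i]: this block is charged to [Err], and the recursion restarts
     at its end, which is no longer an interior point. *)
  - assert (HiI : (i < I0)%nat) by (apply s_lt_inv; lia).
    destruct (IH e (s (S i)) c1 ltac:(lia) C1 ltac:(lia) ltac:(lia)) as (v & Dv & Hv).
    exists v. split; [eapply dominated_mono; [exact Dv|lia|lia]|].
    rewrite <- (isum_chasles a1 a2 c1), <- (isum_chasles a2 (s (S i)) c1).
    rewrite (isum_zero a1 a2) by (try lia; intros; apply Low; lia).
    assert (H1 : isum a2 (s (S i)) (fun k => Rabs (b k) * O_ k g) <= mu * err i).
    { apply Rle_trans with (mu * isum a2 (s (S i)) (fun k => Rabs (b k) * Z k e)).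
      - rewrite <- isum_scal. apply isum_le; [lia|]. intros k Hk. apply Mid; lia.
      - apply Rmult_le_compat_l; [lra|]. apply block_bZ_sum; auto; lia. }
    assert (H2 : isum (s (S i)) c1 (fun k => Rabs (b k) * O_ k g) <= mu * (v + Err (s (S i)) c1)).
    { apply Rle_trans with (mu * isum (s (S i)) c1 (fun k => Rabs (b k) * O_ k e)).
      - rewrite <- isum_scal. apply isum_le; [lia|]. intros k Hk. apply OthO; [lia|].
        rewrite <- E0. assert (Hb : (i < blk k)%nat).
        { assert (H2 := blk_spec k). assert (H3 : (S i < S (blk k))%nat) by (apply s_lt_inv; lia). lia. }
        apply J_lt in Hb. lia.
      - apply Rmult_le_compat_l; lra. }
    assert (H3 := Err_single i a1 c1 HiI ltac:(lia)).
    assert (H4 := Err_super a1 (s (S i)) (s (S i)) c1 ltac:(lia) ltac:(lia)).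
    assert (H5 := Err_pos (s (S i)) (s (S i))). assert (H6 := err_pos i).
    assert (H7 := Err_pos (s (S i)) c1). nra.
Qed.

Variable Amax : R.
Hypothesis Amax_pos : 0 <= Amax.
Hypothesis s0 : s O = O.
Hypothesis al_le : forall i, (i < I0)%nat -> al i <= Amax.

(** Three errors, from [Z], from [Err] and from the remainder of [Gl_split], are each at most the
    sum of the [err i]; this sum is at most [5/12 * Amax], because [/ m (J i) <= 4^-(i+2)]. *)
Lemma tree_dominated g : valid n g ->
  exists v, dominated m n b N0 0 N0 v /\
    rsum N0 (fun k => Rabs (b k) * Gl m (pw k) (pth k g)) <= v + 4 * Amax.
Proof.
  intros V. destruct (O_dominated (S (rank g)) g 0%nat N0 ltac:(lia) V ltac:(lia) ltac:(lia)) as (v & Dv & Hv).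
  exists v. split; auto.
  assert (Split : rsum N0 (fun k => Rabs (b k) * Gl m (pw k) (pth k g)) <=
    isum 0 N0 (fun k => Rabs (b k) * Z k g) + isum 0 N0 (fun k => Rabs (b k) * O_ k g)
    + isum 0 N0 (fun k => Rabs (b k) * (2 * (/ INR (m (J (blk k))) * / INR (m (J (blk k))))))).
  { rewrite rsum_isum, <- !isum_plus. apply isum_le; [lia|]. intros k _.
    assert (H := Gl_split m n G (J (blk k)) (pw k) (pth k g)
      ltac:(split; [specialize (J_ge (blk k)); lia|apply J_pw]) (path_weights n _ _ g V)).
    assert (H1 := Rabs_pos (b k)). nra. }
  assert (HZ : isum 0 N0 (fun k => Rabs (b k) * Z k g) <= rsum I0 err).
  { rewrite <- rsum_isum, (rsum_blocks s I0 _ s0), !rsum_isum. apply isum_le; [lia|]. intros i Hi.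
    assert (Hs := s_mono i (S i) ltac:(lia)). assert (Hs' := s_mono (S i) I0 ltac:(lia)).
    apply block_bZ_sum; auto; lia. }
  assert (HR : isum 0 N0 (fun k => Rabs (b k) * (2 * (/ INR (m (J (blk k))) * / INR (m (J (blk k)))))) <= rsum I0 err).
  { rewrite <- rsum_isum, (rsum_blocks s I0 _ s0), !rsum_isum. apply isum_le; [lia|]. intros i Hi.
    assert (Hs := s_mono i (S i) ltac:(lia)). assert (Hs' := s_mono (S i) I0 ltac:(lia)).
    assert (HJ := J_ge i). assert (Hm := Rm_ge4 m n G (J i) ltac:(lia)).
    assert (Hn := Rn_ge4 m n G (J i) ltac:(lia)).
    rewrite (isum_ext (s i) (s (S i)) _ (fun _ => al i * (INR (m (J i)) / INR (n (J i))) *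
       (2 * (/ INR (m (J i)) * / INR (m (J i)))))) by
      (try lia; intros k Hk; rewrite b_eq, (blk_eq k i) by lia; reflexivity).
    rewrite isum_const, sS, plus_INR. unfold err.
    replace (al i * (INR (m (J i)) / INR (n (J i))) * (2 * (/ INR (m (J i)) * / INR (m (J i)))) *
       (INR (s i) + INR (n (J i)) - INR (s i))) with (2 * al i * / INR (m (J i))) by (field; lra).
    apply Rmult_le_compat_r; [left; apply Rinv_0_lt_compat; lra|]. specialize (al_pos i). lra. }
  assert (HT := Err_total).
  assert (HE : rsum I0 err <= 5 * Amax * (/4) * (1/3)).
  { rewrite rsum_isum. apply Rle_trans with (isum 0 I0 (fun i => 5 * Amax * /4 * (/4) ^ S i)).
    - apply isum_le; [lia|]. intros i Hi. unfold err.
      assert (HJ := J_ge i). assert (H1 := inv_m_geom m n G (J i) ltac:(lia)).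
      assert (H2 : / INR (m (J i)) <= (/4) ^ (S (S i))).
      { eapply Rle_trans; [|apply (inv_m_geom m n G); lia]. apply (inv_m_mono m n G); lia. }
      assert (H3 := inv_m_bounds m n G (J i) ltac:(lia)).
      assert (H4 := al_pos i). assert (H5 := al_le i ltac:(lia)).
      change ((/4) ^ S (S i)) with (/4 * (/4) ^ S i) in H2. nra.
    - rewrite isum_scal. assert (H := geom4_isum 0 I0 ltac:(lia)). nra. }
  lra.
Qed.

End Blocks.

(** * Assembling the two sequences *)

Fixpoint bstart (n : nat -> nat) (i : nat) : nat :=
  match i with O => O | S i' => (bstart n i' + n (bstart n i' + i' + 2))%nat end.

(** The summand [i + 2] makes the inverse weights geometrically small; since [bstart n i <= k] on
    the block [i], the index stays below [pweight k]. *)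
Definition bindex (n : nat -> nat) (i : nat) : nat := (bstart n i + i + 2)%nat.

Fixpoint bnum (n : nat -> nat) (k : nat) : nat :=
  match k with
  | O => O
  | S k' => if bstart n (S (bnum n k')) <=? S k' then S (bnum n k') else bnum n k'
  end.

(** The coordinate at [k] of the combination of the vectors [zvec] with coefficients [a]; every [k]
    lies in exactly one block. *)
Definition bvec (m n : nat -> nat) (a : nat -> R) (k : nat) : R :=
  a (bnum n k) * (INR (m (bindex n (bnum n k))) / INR (n (bindex n (bnum n k)))).

Lemma finite_lub (E : R -> Prop) r0 M :
  E r0 -> (forall r, E r -> r <= M) ->
  exists t, Lub_Rbar E = Finite t /\ (forall r, E r -> r <= t) /\
    (forall M', (forall r, E r -> r <= M') -> t <= M').
Proof.
  intros H0 HM. destruct (Lub_Rbar_correct E) as [U L].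
  assert (U0 := U r0 H0). assert (LM := L (Finite M) HM).
  destruct (Lub_Rbar E) as [t| |]; simpl in *; try tauto.
  exists t. split; [reflexivity|]. split; [exact U|]. intros M' HM'. exact (L (Finite M') HM').
Qed.

Section Assembly.
Variables (m n : nat -> nat).
Hypothesis G : growth m n.

Lemma bstart_S i : bstart n (S i) = (bstart n i + n (bindex n i))%nat.
Proof. reflexivity. Qed.

Lemma bindex_ge i : (i + 2 <= bindex n i)%nat.
Proof. unfold bindex. lia. Qed.

Lemma bsize_ge i : (4 <= n (bindex n i))%nat.
Proof. apply (n_ge4 m n G). assert (H := bindex_ge i). lia. Qed.

Lemma bindex_lt i i' : (i < i')%nat -> (bindex n i < bindex n i')%nat.
Proof.
  induction 1 as [|i' H IH]; [|eapply Nat.lt_trans; [exact IH|]];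
    unfold bindex at 2; rewrite bstart_S; unfold bindex; lia.
Qed.

Lemma bnum_spec k : (bstart n (bnum n k) <= k < bstart n (S (bnum n k)))%nat.
Proof.
  induction k as [|k IH].
  - assert (H := bsize_ge 0). unfold bindex in H. simpl in *. lia.
  - cbn [bnum]. destruct (Nat.leb_spec (bstart n (S (bnum n k))) (S k)); [|lia].
    assert (H1 := bsize_ge (S (bnum n k))). rewrite (bstart_S (S (bnum n k))). lia.
Qed.

Lemma bnum_eq k i : (bstart n i <= k < bstart n (S i))%nat -> bnum n k = i.
Proof. apply (blk_eq n (bstart n) (bindex n) (bnum n) bstart_S bnum_spec). Qed.

Lemma bnum_mono k : (bnum n k <= bnum n (S k))%nat.
Proof. cbn [bnum]. destruct (_ <=? _); lia. Qed.

Definition pweight (k : nat) : nat := (k + bnum n k + 3)%nat.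

Lemma pweight_lt k k' : (k < k')%nat -> (pweight k < pweight k')%nat.
Proof.
  induction 1 as [|k' H IH]; unfold pweight in *.
  - assert (H1 := bnum_mono k). lia.
  - assert (H1 := bnum_mono k'). lia.
Qed.

Lemma bindex_pweight k : (bindex n (bnum n k) < pweight k)%nat.
Proof. unfold bindex, pweight. assert (H := bnum_spec k). lia. Qed.

Lemma ratio_bounds i : 0 < INR (m (bindex n i)) / INR (n (bindex n i)) <= 1.
Proof.
  assert (HJ := bindex_ge i). assert (H1 := Rm_ge4 m n G (bindex n i) ltac:(lia)).
  assert (H2 := Rn_ge4 m n G (bindex n i) ltac:(lia)).
  assert (H3 := m_le_n m n G (bindex n i) ltac:(lia)). apply le_INR in H3.
  split; [apply Rdiv_lt_0_compat; lra|].
  apply Rmult_le_reg_r with (INR (n (bindex n i))); [lra|].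
  unfold Rdiv. rewrite Rmult_assoc, Rinv_l by lra. lra.
Qed.

(** The flat functional of weight [m (bindex n i)] on the block [i], with the sign of [a i], takes
    exactly the value [|a i|]. This absorbs all errors that are multiples of the largest
    coefficient. *)
Lemma coefficient_le a N t i :
  (forall f, inW m n f -> rsum (bstart n N) (fun k => f k * bvec m n a k) <= t) ->
  (i < N)%nat -> Rabs (a i) <= t.
Proof.
  intros Ht Hi. assert (HJ := bindex_ge i). assert (HB := bsize_ge i).
  set (sg := if Rle_dec 0 (a i) then true else false).
  assert (W := inW_flat m n (bindex n i) (bstart n i) (n (bindex n i)) (fun _ => sg) ltac:(lia) ltac:(lia)).
  specialize (Ht _ W).
  assert (Hs : (bstart n (S i) <= bstart n N)%nat) by (apply (s_mono n _ _ bstart_S); lia).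
  rewrite rsum_isum in Ht.
  rewrite (isum_restrict 0 (bstart n i) (bstart n (S i)) (bstart n N)) in Ht; [|rewrite bstart_S; lia|lia| |].
  - rewrite (isum_ext _ _ _ (fun _ => Rabs (a i) * / INR (n (bindex n i)))) in Ht; [|rewrite bstart_S; lia|].
    + rewrite isum_const, bstart_S, plus_INR in Ht.
      assert (H2 := Rn_ge4 m n G (bindex n i) ltac:(lia)).
      replace (Rabs (a i) * / INR (n (bindex n i)) * (INR (bstart n i) + INR (n (bindex n i)) - INR (bstart n i)))
        with (Rabs (a i)) in Ht by (field; lra). exact Ht.
    + intros k Hk. unfold bvec. rewrite (bnum_eq k i Hk). rewrite bstart_S in Hk.
      destruct (Nat.leb_spec (bstart n i) k); [|lia].
      destruct (Nat.ltb_spec k (bstart n i + n (bindex n i))); [|lia]. simpl andb. cbv iota.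
      assert (H2 := Rn_ge4 m n G (bindex n i) ltac:(lia)). assert (H1 := Rm_ge4 m n G (bindex n i) ltac:(lia)).
      unfold sg. destruct (Rle_dec 0 (a i)); simpl.
      * rewrite Rabs_pos_eq by auto. field. lra.
      * rewrite Rabs_left by lra. field. lra.
  - intros k Hk. destruct (Nat.leb_spec (bstart n i) k); [lia|]. simpl. ring.
  - intros k Hk. rewrite bstart_S in Hk. destruct (Nat.ltb_spec k (bstart n i + n (bindex n i))); [lia|].
    rewrite andb_false_r. ring.
Qed.

Lemma functional_bound_nonneg a N t :
  (forall f, inW m n f -> rsum (bstart n N) (fun k => f k * bvec m n a k) <= t) -> 0 <= t.
Proof.
  intros Ht. specialize (Ht _ (W_unit m n (bstart n N) true)).
  rewrite rsum_isum, isum_zero in Ht; [exact Ht|lia|].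
  intros k Hk. destruct (Nat.eqb_spec k (bstart n N)); [lia|ring].
Qed.

Variable X : nat -> gam -> R.
Hypothesis HX : forall P0, exists k p q g,
  (P0 <= p <= q)%nat /\ Blk m n (X k) p q /\ valid n g /\ X k g <> 0.

(** The constant is 288 * (1 + 4) + 288 * 6 / 3: the dominating functional, the error [4 * Amax] of
    [tree_dominated], and the terms [6 / m (pweight k)] summed over [k]. *)
Lemma good_sequence : exists (x : nat -> gam -> R) (P Q : nat -> nat) (lf : nat -> gam),
  spread m n x P Q lf /\ (forall k, YB m n X (x k) (P k) (Q k) /\ (P k <= Q k < P (S k))%nat) /\
  forall N a t, (forall f, inW m n f -> rsum (bstart n N) (fun k => f k * bvec m n a k) <= t) ->
    forall g, valid n g -> Rabs (rsum (bstart n N) (fun k => bvec m n a k * x k g)) <= 2016 * t.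
Proof.
  destruct (leafed_sequence m n X (fun k _ x p1 q1 _ => forall d, valid n d ->
     exists A B, (p1 <= A <= B)%nat /\ (B <= q1)%nat /\
       Rabs (x d) <= 288 * (Gl m (pweight k) (path A B d) + 6 * / INR (m (pweight k)))) 3 ltac:(lia))
    as (x & P & Q & lf & P0 & Sp & Hx).
  { intros k P0 HP0.
    destruct (ris_averages m n G X HX (pweight k) P0 ltac:(unfold pweight; lia) HP0)
      as (x & p1 & q1 & g & H1 & H2 & A & B & H3 & H4).
    exists x, p1, q1, g. split; [auto|split; [auto|]]. intros d Vd.
    destruct (H4 d Vd) as (l & Hl & Hb). exists (A l), (B l).
    destruct (H3 l Hl). auto. }
  exists x, P, Q, lf. split; [exact Sp|]. split.
  { intros k. destruct (Hx k) as ((HY & HPQ & _) & H1 & H2 & _). destruct (Hx (S k)) as (_ & H3 & _).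
    split; [exact HY|lia]. }
  intros N a t Ht g Vg.
  assert (t0 := functional_bound_nonneg a N t Ht).
  (* With [g] fixed, each [x k] is replaced by one representative range; the choice depends on [g],
     but the constants do not. *)
  assert (C : forall k, exists AB, (P k <= fst AB <= snd AB)%nat /\ (snd AB <= Q k)%nat /\
     Rabs (x k g) <= 288 * (Gl m (pweight k) (path (fst AB) (snd AB) g) + 6 * / INR (m (pweight k)))).
  { intros k. destruct (Hx k) as (_ & _ & _ & H). destruct (H g Vg) as (A & B & ? & ? & ?).
    exists (A, B). auto. }
  set (F := fun k => proj1_sig (constructive_indefinite_description _ (C k))).
  assert (HF : forall k, (P k <= fst (F k) <= snd (F k))%nat /\ (snd (F k) <= Q k)%nat /\
     Rabs (x k g) <= 288 * (Gl m (pweight k) (path (fst (F k)) (snd (F k)) g) + 6 * / INR (m (pweight k)))).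
  { intros k. unfold F. exact (proj2_sig (constructive_indefinite_description _ (C k))). }
  set (A := fun k => fst (F k)). set (B := fun k => snd (F k)).
  assert (AB : forall k, (A k <= B k)%nat /\ (B k < A (S k))%nat).
  { intros k. unfold A, B. destruct (HF k) as (? & ? & _). destruct (HF (S k)) as (? & _).
    destruct (Hx k) as (_ & _ & ? & _). destruct (Hx (S k)) as (_ & ? & _). lia. }
  assert (A2 : forall k, (2 <= A k)%nat).
  { intros k. unfold A. destruct (HF k) as (? & _). destruct (Hx k) as (_ & ? & _). lia. }
  destruct (tree_dominated m n G (bstart n) (bindex n) pweight (bnum n) bstart_S bindex_ge
    bindex_lt pweight_lt bnum_spec bindex_pweight A B AB A2 (bvec m n a) (fun i => Rabs (a i)) N
    (fun i => Rabs_pos (a i))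
    ltac:(intros k _; unfold bvec; rewrite Rabs_mult; f_equal; apply Rabs_pos_eq;
          left; apply ratio_bounds) t t0 eq_refl
    ltac:(intros i Hi; exact (coefficient_le a N t i Ht Hi)) g Vg) as (v & Dv & Hv).
  assert (vt : v <= t).
  { destruct Dv as [Dv|(f & Wf & _ & Hf)]; [lra|]. specialize (Ht f Wf). lra. }
  set (T := bstart n N) in *.
  assert (bt : forall k, (k < T)%nat -> Rabs (bvec m n a k) <= t).
  { intros k Hk. assert (Hb := bnum_spec k).
    assert (bnum n k < N)%nat by (apply (s_lt_inv n _ _ bstart_S); fold T; lia).
    assert (H1 := coefficient_le a N t (bnum n k) Ht ltac:(auto)).
    unfold bvec. rewrite Rabs_mult. assert (H2 := ratio_bounds (bnum n k)).
    rewrite (Rabs_pos_eq (_ / _)) by lra. assert (H3 := Rabs_pos (a (bnum n k))). nra. }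
  rewrite rsum_isum.
  apply Rle_trans with (isum 0 T (fun k =>
     288 * (Rabs (bvec m n a k) * Gl m (pweight k) (path (A k) (B k) g)) + 288 * 6 * t * (/4) ^ (S k))).
  - eapply Rle_trans; [apply isum_abs; lia|]. apply isum_le; [lia|]. intros k Hk.
    rewrite Rabs_mult. destruct (HF k) as (_ & _ & H1). fold (A k) (B k) in H1.
    specialize (bt k ltac:(lia)).
    assert (H2 : / INR (m (pweight k)) <= (/4) ^ S k).
    { eapply Rle_trans; [|apply (inv_m_geom m n G); lia]. apply (inv_m_mono m n G); unfold pweight; lia. }
    assert (H3 := Rabs_pos (bvec m n a k)).
    assert (H4 := inv_m_bounds m n G (pweight k) ltac:(unfold pweight; lia)).
    apply Rle_trans with (Rabs (bvec m n a k) *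
      (288 * (Gl m (pweight k) (path (A k) (B k) g) + 6 * / INR (m (pweight k)))));
      [apply Rmult_le_compat_l; auto|].
    assert (Rabs (bvec m n a k) * / INR (m (pweight k)) <= t * (/4) ^ S k) by (apply Rmult_le_compat; lra).
    lra.
  - rewrite isum_plus, !isum_scal, <- rsum_isum.
    assert (H := geom4_isum 0 T ltac:(lia)). nra.
Qed.

(** * Passage to the type [Gamma] and to the two norms *)

Lemma Blk_supported v p q : Blk m n v p q -> supported_in m n (fun d => v (proj1_sig d)) p q.
Proof.
  intros (l & F & E).
  assert (K : exists l' : list (Gamma n * R), l = map (fun pr => (proj1_sig (fst pr), snd pr)) l').
  { clear E. induction F as [|[d c] l [Vd Hd] F (l' & IH)]; [exists []; reflexivity|].
    exists ((exist _ d Vd, c) :: l'). simpl. now rewrite IH. }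
  destruct K as (l' & ->). exists l'. split.
  - apply Forall_map in F. eapply Forall_impl; [|exact F]. simpl. tauto.
  - intros d. rewrite E. clear. induction l' as [|[d' c] l' IH]; unfold lcomb, lincomb in *; simpl; [auto|].
    now rewrite IH.
Qed.

Lemma supported_lcomb (l : list (Gamma n * R)) d :
  lincomb m n l d = lcomb m (map (fun pr => (proj1_sig (fst pr), snd pr)) l) (proj1_sig d).
Proof.
  induction l as [|[d' c] l IH]; unfold lcomb, lincomb in *; simpl; [auto|]. now rewrite IH.
Qed.

(** In [zvec] the second index runs from 1 to [n (J i)], hence the shift by one. *)
Definition bpos (i j : nat) : nat := (bstart n i + j - 1)%nat.

Lemma zvec_block i t : zvec m n (bindex n) bpos i t =
  INR (m (bindex n i)) / INR (n (bindex n i)) *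
  (if andb (bstart n i <=? t) (t <? bstart n (S i)) then 1 else 0).
Proof.
  unfold zvec. f_equal. rewrite rsum_isum, bstart_S.
  destruct (Nat.leb_spec (bstart n i) t); [destruct (Nat.ltb_spec t (bstart n i + n (bindex n i)))|]; simpl.
  - rewrite (isum_single 0 _ (t - bstart n i)); [|lia|].
    + unfold bpos. destruct (Nat.eqb_spec (bstart n i + S (t - bstart n i) - 1) t); [auto|lia].
    + intros k _ Hk. unfold bpos. destruct (Nat.eqb_spec (bstart n i + S k - 1) t); [lia|auto].
  - apply isum_zero; [lia|]. intros k Hk. unfold bpos.
    destruct (Nat.eqb_spec (bstart n i + S k - 1) t); [lia|auto].
  - apply isum_zero; [lia|]. intros k Hk. unfold bpos.
    destruct (Nat.eqb_spec (bstart n i + S k - 1) t); [lia|auto].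
Qed.

Lemma zsum_bvec N a t : rsum N (fun i => a i * zvec m n (bindex n) bpos i t) =
  if t <? bstart n N then bvec m n a t else 0.
Proof.
  rewrite rsum_isum. assert (Hb := bnum_spec t).
  assert (Z : forall i, i <> bnum n t -> a i * zvec m n (bindex n) bpos i t = 0).
  { intros i Hi. rewrite zvec_block.
    destruct (Nat.leb_spec (bstart n i) t); [destruct (Nat.ltb_spec t (bstart n (S i)))|]; simpl; try ring.
    exfalso. apply Hi. symmetry. apply bnum_eq. lia. }
  destruct (Nat.ltb_spec t (bstart n N)) as [L|L].
  - assert (bnum n t < N)%nat by (apply (s_lt_inv n _ _ bstart_S); lia).
    rewrite (isum_single 0 N (bnum n t)); [|lia|intros; now apply Z].
    rewrite zvec_block. unfold bvec.
    destruct (Nat.leb_spec (bstart n (bnum n t)) t); [|lia].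
    destruct (Nat.ltb_spec t (bstart n (S (bnum n t)))); [|lia]. simpl. ring.
  - apply isum_zero; [lia|]. intros i Hi. apply Z. intros ->.
    assert (bstart n (S (bnum n t)) <= bstart n N)%nat by (apply (s_mono n _ _ bstart_S); lia). lia.
Qed.

(** [Tnorm] admits every cut-off [M] beyond which the vector vanishes; all of them give the same
    pairing as the end of the last block. *)
Lemma Tnorm_values N a f M :
  (forall k, (M <= k)%nat -> rsum N (fun i => a i * zvec m n (bindex n) bpos i k) = 0) ->
  rsum M (fun k => f k * rsum N (fun i => a i * zvec m n (bindex n) bpos i k)) =
  rsum (bstart n N) (fun k => f k * bvec m n a k).
Proof.
  intros HM. set (S0 := bstart n N).
  assert (E : rsum M (fun k => f k * rsum N (fun i => a i * zvec m n (bindex n) bpos i k)) =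
    isum 0 (max M S0) (fun k => f k * rsum N (fun i => a i * zvec m n (bindex n) bpos i k))).
  { rewrite rsum_isum. symmetry. apply isum_restrict; try lia. intros k Hk. rewrite HM by lia. ring. }
  rewrite E, (isum_restrict 0 0 S0 (max M S0)), rsum_isum; try lia.
  - apply isum_ext; [lia|]. intros k Hk. rewrite zsum_bvec. fold S0.
    destruct (Nat.ltb_spec k S0); [auto|lia].
  - intros k Hk. rewrite zsum_bvec. fold S0. destruct (Nat.ltb_spec k S0); [lia|ring].
Qed.

End Assembly.

Theorem theorem4p1 (m n : nat -> nat)
  (hm1 : m 1%nat = 4%nat) (hn1 : n 1%nat = 4%nat)
  (hm : forall j, (1 <= j)%nat -> (m j * m j <= m (S j))%nat)
  (hn : forall j, (1 <= j)%nat ->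
     INR (m (S j)) ^ 2 * Rpower (INR (4 * n j)) (ln (INR (m (S j))) / ln 2)
       <= INR (n (S j)))
  (x : nat -> vec n) (hx : is_block m n x) :
  exists y : nat -> vec n,
    is_block m n y /\ (forall i, in_closed_span n x (y i)) /\
    exists (J : nat -> nat) (k : nat -> nat -> nat) (K : R),
      (forall i, (1 <= J i)%nat) /\ 1 <= K /\
      forall (N : nat) (a : nat -> R),
        Rbar_le (Rbar_mult (Finite (/ K))
                   (Tnorm m n (fun t => rsum N (fun i => a i * zvec m n J k i t))))
                (Bnorm n (fun d => rsum N (fun i => a i * y i d))) /\
        Rbar_le (Bnorm n (fun d => rsum N (fun i => a i * y i d)))
                (Rbar_mult (Finite K)
                   (Tnorm m n (fun t => rsum N (fun i => a i * zvec m n J k i t)))).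
Proof.
  assert (G := growth_of_hyps m n hm1 hn1 hm hn).
  destruct hx as (p & q & Hpq).
  assert (C : forall k, exists l : list (Gamma n * R),
    List.Forall (fun pr => (p k <= rank (proj1_sig (fst pr)) <= q k)%nat) l /\
    forall d, x k d = lincomb m n l d).
  { intros k. destruct (Hpq k) as (_ & _ & H & _). exact H. }
  set (F := fun k => proj1_sig (constructive_indefinite_description _ (C k))).
  assert (HF : forall k, List.Forall (fun pr => (p k <= rank (proj1_sig (fst pr)) <= q k)%nat) (F k) /\
    forall d, x k d = lincomb m n (F k) d).
  { intros k. exact (proj2_sig (constructive_indefinite_description _ (C k))). }
  (* The chosen combination extends [x k] from [Gamma] to all of [gam]. *)
  set (X := fun k g => lcomb m (map (fun pr => (proj1_sig (fst pr), snd pr)) (F k)) g).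
  assert (HXx : forall k d, X k (proj1_sig d) = x k d).
  { intros k d. destruct (HF k) as [_ E]. rewrite E. symmetry. apply supported_lcomb. }
  assert (HX : forall P0, exists k p q g,
    (P0 <= p <= q)%nat /\ Blk m n (X k) p q /\ valid n g /\ X k g <> 0).
  { intros P0. destruct (Hpq P0) as (H1 & _ & _ & (d & Hd)).
    exists P0, (p P0), (q P0), (proj1_sig d). split.
    - split; [|exact H1]. clear - Hpq. induction P0 as [|k IH]; [lia|].
      destruct (Hpq k) as (H1 & H2 & _). lia.
    - split; [|split; [exact (proj2_sig d)|now rewrite HXx]].
      destruct (HF P0) as [F1 _]. exists (map (fun pr => (proj1_sig (fst pr), snd pr)) (F P0)).
      split; [|reflexivity]. apply Forall_map. eapply Forall_impl; [|exact F1].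
      intros [[e Ve] c] He; simpl in *. auto. }
  destruct (good_sequence m n G X HX) as (u & P & Q & lf & Sp & Hu & Up).
  set (Y := fun i g => isum (bstart n i) (bstart n (S i))
     (fun k => INR (m (bindex n i)) / INR (n (bindex n i)) * u k g)).
  assert (Hsz := bsize_ge m n G).
  assert (PQ : forall k, (P k <= Q k)%nat /\ (Q k < P (S k))%nat) by (intros k; apply (Hu k)).
  assert (HYB : forall i, YB m n X (Y i) (P (bstart n i)) (Q (bstart n (S i) - 1)%nat)).
  { intros i. specialize (Hsz i). rewrite bstart_S.
    unfold Y. rewrite bstart_S.
    apply (YB_isum m n X u P Q (fun _ => INR (m (bindex n i)) / INR (n (bindex n i)))); [lia|].
    intros k Hk. split; [apply Hu|]. split.
    - destruct (Nat.eq_dec k (bstart n i)) as [->|Ne]; auto.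
      assert (H2 := AB_lt P Q PQ (bstart n i) k ltac:(lia)). destruct (PQ (bstart n i)). lia.
    - destruct (Nat.eq_dec k (bstart n i + n (bindex n i) - 1)) as [->|Ne]; auto.
      assert (H2 := AB_lt P Q PQ k (bstart n i + n (bindex n i) - 1) ltac:(lia)).
      destruct (PQ (bstart n i + n (bindex n i) - 1)%nat). lia. }
  assert (Hsum : forall N a g, rsum N (fun i => a i * Y i g) =
     rsum (bstart n N) (fun k => bvec m n a k * u k g)).
  { intros N a g. rewrite (rsum_blocks (bstart n) N _ eq_refl), !rsum_isum.
    apply isum_ext; [lia|]. intros i _. unfold Y. rewrite <- isum_scal.
    apply isum_ext; [rewrite bstart_S; lia|]. intros k Hk. unfold bvec.
    rewrite (bnum_eq m n G k i Hk). ring. }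
  exists (fun i d => Y i (proj1_sig d)). split; [|split].
  - exists (fun i => P (bstart n i)), (fun i => Q (bstart n (S i) - 1)%nat). intros i.
    specialize (Hsz i). rewrite bstart_S.
    split.
    { destruct (Nat.eq_dec (bstart n i) (bstart n i + n (bindex n i) - 1)) as [E|E]; [lia|].
      assert (H2 := AB_lt P Q PQ (bstart n i) (bstart n i + n (bindex n i) - 1) ltac:(lia)).
      destruct (PQ (bstart n i)), (PQ (bstart n i + n (bindex n i) - 1)%nat). lia. }
    split; [apply (AB_lt P Q PQ); lia|].
    split; [apply Blk_supported; rewrite <- bstart_S; apply HYB|].
    destruct (Sp (bstart n i)) as (_ & Vl & _).
    exists (exist _ (lf (bstart n i)) Vl). simpl. unfold Y.
    rewrite (isum_single _ _ (bstart n i)); [|rewrite bstart_S; lia|].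
    + rewrite (sp_leaf m n u P Q lf Sp). destruct (Nat.eq_dec (bstart n i) (bstart n i)); [|lia].
      rewrite Rmult_1_r. assert (H := ratio_bounds m n G i). lra.
    + intros k _ Hk. rewrite (sp_leaf m n u P Q lf Sp).
      destruct (Nat.eq_dec k (bstart n i)); [lia|ring].
  (* [Y i] is itself a finite combination of the [x k], so the approximation error is zero. *)
  - intros i eps Heps. destruct (HYB i) as [_ (N & c & E)]. exists N, c. intros d.
    rewrite E, (rsum_isum N (fun k => c k * x k d)), (isum_ext 0 N _ (fun k => c k * X k (proj1_sig d)));
      [|lia|intros; now rewrite HXx].
    rewrite <- rsum_isum, Rminus_diag, Rabs_R0. lra.
  (* The upper constant 2016 also covers the lower constant 4/3. *)
  - exists (bindex n), (bpos n), 2016. split; [intros i; assert (H := bindex_ge n i); lia|].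
    split; [lra|]. intros N a. set (T := bstart n N).
    set (z := fun t => rsum N (fun i => a i * zvec m n (bindex n) (bpos n) i t)).
    assert (Tv : forall f M, (forall k, (M <= k)%nat -> z k = 0) ->
       rsum M (fun k => f k * z k) = rsum T (fun k => f k * bvec m n a k)).
    { intros f M HM. apply (Tnorm_values m n G N a f M HM). }
    assert (zT : forall k, (T <= k)%nat -> z k = 0).
    { intros k Hk. unfold z. rewrite (zsum_bvec m n G). fold T.
      destruct (Nat.ltb_spec k T); [lia|auto]. }
    destruct (finite_lub (fun r => exists (f : nat -> R) (M : nat),
        inW m n f /\ (forall k, (M <= k)%nat -> z k = 0) /\ r = rsum M (fun k => f k * z k))
        (rsum T (fun k => (if Nat.eqb k 0 then sgn true else 0) * z k))
        (isum 0 T (fun k => Rabs (bvec m n a k)))) as (t & Et & Ut & Lt).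
    { exists (fun k => if Nat.eqb k 0 then sgn true else 0), T.
      split; [apply W_unit|]. split; [exact zT|reflexivity]. }
    { intros r (f & M & Wf & HM & ->). rewrite Tv by auto. rewrite rsum_isum.
      apply isum_le; [lia|]. intros k _. eapply Rle_trans; [apply Rle_abs|].
      rewrite Rabs_mult. assert (H1 := inW_bound m n f k G Wf).
      assert (H2 := Rabs_pos (bvec m n a k)). nra. }
    assert (Ht : forall f, inW m n f -> rsum T (fun k => f k * bvec m n a k) <= t).
    { intros f Wf. rewrite <- (Tv f T zT). apply Ut. exists f, T. auto. }
    assert (Upper := Up N a t Ht).
    set (v := fun d : Gamma n => rsum N (fun i => a i * Y i (proj1_sig d))).
    assert (Hv : forall d, v d = rsum T (fun k => bvec m n a k * u k (proj1_sig d))).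
    { intros d. apply Hsum. }
    destruct (finite_lub (fun r => exists d : Gamma n, r = Rabs (v d))
        (Rabs (v (exist _ G1 I))) (2016 * t)) as (bn & Eb & Ub & Lb).
    { now exists (exist _ G1 I). }
    { intros r (d & ->). rewrite Hv. apply Upper. exact (proj2_sig d). }
    assert (HB : Bnorm n v = Finite bn) by exact Eb.
    assert (HT : Tnorm m n z = Finite t) by exact Et.
    fold z v. rewrite HB, HT. simpl. split.
    + assert (t <= 4/3 * bn).
      { apply Lt. intros r (f & M & Wf & HM & ->). rewrite Tv by auto.
        eapply Rle_trans; [apply Rle_abs|].
        apply (lower_estimate m n G u P Q lf Sp (bvec m n a) f T bn Wf).
        intros g Vg. apply Ub. exists (exist _ g Vg). now rewrite Hv. }
      assert (0 <= bn).
      { eapply Rle_trans; [apply Rabs_pos|]. apply Ub. now exists (exist _ G1 I). }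
      lra.
    + apply Lb. intros r (d & ->). rewrite Hv. apply Upper. exact (proj2_sig d).
Qed.
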